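(* Let $n\ge 3$ and let $(M^n,g(t))$ be an $n$-dimensional Riemannian manifold evolving by the Ricci flow $\frac{\partial}{\partial t}g_{ij}=-2R_{ij}$ on some time interval. Then the Cotton tensor satisfies \begin{align*} (\partial_t-\Delta)C_{ijk}={}&\tfrac{1}{n-2}\Big[g^{pq}R_{pj}\big(C_{kqi}+C_{qki}+(n-3)C_{ikq}\big)+(n+2)g^{pq}R_{ip}C_{qkj}\\ &\qquad\quad-g^{pq}R_{pk}\big(C_{jqi}+C_{qji}+(n-3)C_{ijq}\big)\Big]\\ &+\tfrac{2}{n-2}R\,C_{ijk}+\tfrac{2}{n-2}R^{ql}C_{qjl}g_{ik}-\tfrac{2}{n-2}R^{ql}C_{qkl}g_{ij}\\ &+\tfrac{1}{(n-1)(n-2)}\nabla_k|\mathrm{Ric}|^2g_{ij}-\tfrac{1}{(n-1)(n-2)}\nabla_j|\mathrm{Ric}|^2g_{ik}\\ &+\tfrac{R}{(n-1)(n-2)}\nabla_jR\,g_{ik}-\tfrac{R}{(n-1)(n-2)}\nabla_kR\,g_{ij}\\ &+\tfrac{2}{n-2}g^{pq}R_{pk}\nabla_jR_{qi}-\tfrac{2}{n-2}g^{pq}R_{pj}\nabla_kR_{qi}+\tfrac{1}{n-2}R_{ij}\nabla_kR-\tfrac{1}{n-2}R_{ik}\nabla_jR\\ &-2g^{pq}W_{pikl}C_{qjl}+2g^{pq}W_{pijl}C_{qkl}-2g^{pq}W_{jklp}C_{qil}\\ &+2g^{pq}R_{pl}\nabla_jW_{qikl}-2g^{pq}R_{pl}\nabla_kW_{qijl}.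 \end{align*} In particular, if the Cotton tensor vanishes identically along the flow, then \begin{align*} 0={}&\tfrac{1}{(n-1)(n-2)}\nabla_k|\mathrm{Ric}|^2g_{ij}-\tfrac{1}{(n-1)(n-2)}\nabla_j|\mathrm{Ric}|^2g_{ik}+\tfrac{R}{(n-1)(n-2)}\nabla_jR\,g_{ik}-\tfrac{R}{(n-1)(n-2)}\nabla_kR\,g_{ij}\\ &+\tfrac{2}{n-2}g^{pq}R_{pk}\nabla_jR_{qi}-\tfrac{2}{n-2}g^{pq}R_{pj}\nabla_kR_{qi}+\tfrac{1}{n-2}R_{ij}\nabla_kR-\tfrac{1}{n-2}R_{ik}\nabla_jR\\ &+2g^{pq}R_{pl}\nabla_jW_{qikl}-2g^{pq}R_{pl}\nabla_kW_{qijl}, \end{align*} while, if $n\ge4$ and the Weyl tensor vanishes identically along the flow, then \begin{align*} 0={}&\tfrac{1}{(n-1)(n-2)}\nabla_k|\mathrm{Ric}|^2g_{ij}-\tfrac{1}{(n-1)(n-2)}\nabla_j|\mathrm{Ric}|^2g_{ik}+\tfrac{R}{(n-1)(n-2)}\nabla_jR\,g_{ik}-\tfrac{R}{(n-1)(n-2)}\nabla_kR\,g_{ij}\\ &+\tfrac{2}{n-2}g^{pq}R_{pk}\nabla_jR_{qi}-\tfrac{2}{n-2}g^{pq}R_{pj}\nabla_kR_{qi}+\tfrac{1}{n-2}R_{ij}\nabla_kR-\tfrac{1}{n-2}R_{ik}\nabla_jR . \end{align*}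
   Context: Repeated indices are summed; an index repeated in two lower positions (here $l$) is contracted with the inverse metric. Curvature conventions: $\mathrm{Riem}(X,Y)Z=\nabla_Y\nabla_XZ-\nabla_X\nabla_YZ+\nabla_{[X,Y]}Z$, $R^l_{ijk}\partial_l=\mathrm{Riem}(\partial_i,\partial_j)\partial_k$, $R_{ijkl}=g_{lm}R^m_{ijk}$ (so $R_{ijkl}v^iw^jv^kw^l>0$ on round spheres for linearly independent $v,w$), Ricci tensor $R_{ik}=g^{jl}R_{ijkl}$ (denoted $\mathrm{Ric}$), scalar curvature $R=g^{ik}R_{ik}$, $R^{ql}=g^{qa}g^{lb}R_{ab}$, $|\mathrm{Ric}|^2=R^{ij}R_{ij}$. $\nabla$ is the Levi-Civita connection of $g(t)$ and $\Delta=g^{ab}\nabla_a\nabla_b$. The Weyl tensor $W$ is defined for $n\ge3$ by $$R_{ijkl}=\tfrac{1}{n-2}(R_{ik}g_{jl}-R_{il}g_{jk}+R_{jl}g_{ik}-R_{jk}g_{il})-\tfrac{R}{(n-1)(n-2)}(g_{ik}g_{jl}-g_{il}g_{jk})+W_{ijkl}.$$ The Cotton tensor is $$C_{ijk}=\nabla_kR_{ij}-\nabla_jR_{ik}-\tfrac{1}{2(n-1)}\big(\nabla_kR\,g_{ij}-\nabla_jR\,g_{ik}\big).$$ Components are taken with respect to a fixed (time-independent) local coordinate frame, not a moving frame; $\partial_tC_{ijk}$ is the time derivative of these components. *)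

(* Defs.v *)
From HB Require Import structures.
From mathcomp Require Import all_boot all_order all_algebra.
From mathcomp Require Import all_classical all_reals all_analysis.

Set Implicit Arguments.
Unset Strict Implicit.
Unset Printing Implicit Defensive.

Import Order.TTheory GRing.Theory Num.Theory.
Import numFieldNormedType.Exports.

Local Open Scope classical_set_scope.
Local Open Scope ring_scope.

(* This development uses MathComp-Analysis over an arbitrary realType.        *)
(*                                                                            *)
(* Tensor fields on a coordinate domain are given by their components; in an  *)
(* application [T i1 ... ir x] the indices are read from left to right and    *)
(* [x] is the point. In covariant derivatives the index of differentiation    *)
(* comes first. All derivative operators are total, and are meaningful only   *)
(* at interior points where the derivatives exist.                            *)

Definition pderiv (R : realType) (n : nat) (i : 'I_n)
    (f : 'rV[R]_n -> R) (x : 'rV[R]_n) : R :=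
  'D_(delta_mx 0 i) f x.

Definition smooth_on (R : realType) (n : nat) (U : set 'rV[R]_n)
    (f : 'rV[R]_n -> R) : Prop :=
  forall (w : seq 'I_n) (x : 'rV[R]_n), U x ->
    {for x, continuous (foldr (@pderiv R n) f w)} /\
    forall i : 'I_n, derivable (foldr (@pderiv R n) f w) x (delta_mx 0 i).

(* Time derivative relative to the time interval [I]: it is the ordinary      *)
(* derivative at interior times and the one-sided one at an end point of [I]. *)
Definition time_quotient (R : realType) (f : R -> R) (t s : R) : R :=
  (f s - f t) / (s - t).

Definition time_derivable (R : realType) (I : set R) (f : R -> R) (t : R) :
    Prop :=
  cvg (time_quotient f t @ within I t^').

Definition dtime (R : realType) (I : set R) (f : R -> R) (t : R) : R :=
  lim (time_quotient f t @ within I t^').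

(* [None] is the time direction, [Some i] the i-th space direction. *)
Definition spacetime_deriv (R : realType) (n : nat) (I : set R)
    (o : option 'I_n) (f : R -> 'rV[R]_n -> R) : R -> 'rV[R]_n -> R :=
  match o with
  | None => fun t x => dtime I (f ^~ x) t
  | Some i => fun t x => pderiv i (f t) x
  end.

(* Smoothness on [I * U], up to the end points belonging to [I]: all iterated *)
(* (mixed) derivatives exist and are jointly continuous on [I * U].           *)
Definition smooth_spacetime (R : realType) (n : nat) (I : set R)
    (U : set 'rV[R]_n) (f : R -> 'rV[R]_n -> R) : Prop :=
  forall w : seq (option 'I_n),
    let h := foldr (@spacetime_deriv R n I) f w in
    {within I `*` U, continuous (fun p : R * 'rV[R]_n => h p.1 p.2)} /\
    forall (t : R) (x : 'rV[R]_n), I t -> U x ->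
      time_derivable I (h ^~ x) t /\
      forall i : 'I_n, derivable (h t) x (delta_mx 0 i).

Record smooth_atlas (R : realType) (n : nat) (M : topologicalType) := {
  chart_index : Type;
  chart_dom : chart_index -> set M;
  chart_map : chart_index -> M -> 'rV[R]_n;
  chart_inv : chart_index -> 'rV[R]_n -> M;
  chart_dom_open : forall a, open (chart_dom a);
  chart_img_open : forall a, open (chart_map a @` chart_dom a);
  chart_mapK : forall a p, chart_dom a p -> chart_inv a (chart_map a p) = p;
  chart_map_continuous : forall a, {within chart_dom a, continuous (chart_map a)};
  chart_inv_continuous : forall a,
    {within chart_map a @` chart_dom a, continuous (chart_inv a)};
  chart_cover : forall p, exists a, chart_dom a p;
  chart_transition_smooth : forall a b (k : 'I_n),
    smooth_on (chart_map a @` (chart_dom a `&` chart_dom b))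
      (fun x => chart_map b (chart_inv a x) 0 k)
}.

Definition chart_img (R : realType) (n : nat) (M : topologicalType)
    (A : smooth_atlas R n M) (a : chart_index A) : set 'rV[R]_n :=
  chart_map a @` chart_dom a.

(* The k-th component of the change of coordinates from chart [a] to [b]. *)
Definition transition (R : realType) (n : nat) (M : topologicalType)
    (A : smooth_atlas R n M) (a b : chart_index A) (k : 'I_n)
    (x : 'rV[R]_n) : R :=
  chart_map b (chart_inv a x) 0 k.

(* [metric g a t x] is the Gram matrix of the metric at time [t] in the       *)
(* coordinate frame of the chart [a], at the point of coordinates [x].        *)
Record metric_family (R : realType) (n : nat) (M : topologicalType)
    (A : smooth_atlas R n M) (I : set R) := {
  metric : chart_index A -> R -> 'rV[R]_n -> 'M[R]_n;
  metric_smooth : forall a (i j : 'I_n),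
    smooth_spacetime I (chart_img a) (fun t x => metric a t x i j);
  metric_sym : forall a t x, I t -> chart_img a x ->
    (metric a t x)^T = metric a t x;
  metric_pos : forall a t x (v : 'rV[R]_n), I t -> chart_img a x -> v != 0 ->
    0 < (v *m metric a t x *m v^T) 0 0;
  metric_change : forall a b t x (i j : 'I_n), I t ->
    (chart_map a @` (chart_dom a `&` chart_dom b)) x ->
    metric a t x i j =
      \sum_k \sum_l pderiv i (transition a b k) x
                    * pderiv j (transition a b l) x
                    * metric b t (chart_map b (chart_inv a x)) k l
}.

Definition ginv (R : realType) (n : nat) (G : 'rV[R]_n -> 'M[R]_n)
    (i j : 'I_n) (x : 'rV[R]_n) : R :=
  invmx (G x) i j.

(* The Levi-Civita connection: [christoffel G m i j] is $\Gamma^m_{ij}$. *)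
Definition christoffel (R : realType) (n : nat) (G : 'rV[R]_n -> 'M[R]_n)
    (m i j : 'I_n) (x : 'rV[R]_n) : R :=
  2^-1 * \sum_l ginv G m l x *
    (pderiv i (fun y => G y j l) x + pderiv j (fun y => G y i l) x
     - pderiv l (fun y => G y i j) x).

Definition coord_field (R : realType) (n : nat) (i l : 'I_n)
    (x : 'rV[R]_n) : R := (l == i)%:R.

Definition nabla_vect (R : realType) (n : nat) (G : 'rV[R]_n -> 'M[R]_n)
    (X Z : 'I_n -> 'rV[R]_n -> R) (l : 'I_n) (x : 'rV[R]_n) : R :=
  \sum_a X a x * (pderiv a (Z l) x + \sum_b christoffel G l a b x * Z b x).

Definition lie_bracket (R : realType) (n : nat)
    (X Y : 'I_n -> 'rV[R]_n -> R) (l : 'I_n) (x : 'rV[R]_n) : R :=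
  \sum_a (X a x * pderiv a (Y l) x - Y a x * pderiv a (X l) x).

(* Riem(X,Y)Z = nabla_Y nabla_X Z - nabla_X nabla_Y Z + nabla_[X,Y] Z *)
Definition Riem (R : realType) (n : nat) (G : 'rV[R]_n -> 'M[R]_n)
    (X Y Z : 'I_n -> 'rV[R]_n -> R) (l : 'I_n) (x : 'rV[R]_n) : R :=
  nabla_vect G Y (nabla_vect G X Z) l x
  - nabla_vect G X (nabla_vect G Y Z) l x
  + nabla_vect G (lie_bracket X Y) Z l x.

(* [riem_up G l i j k] is $R^l_{ijk}$. *)
Definition riem_up (R : realType) (n : nat) (G : 'rV[R]_n -> 'M[R]_n)
    (l i j k : 'I_n) (x : 'rV[R]_n) : R :=
  Riem G (@coord_field R n i) (@coord_field R n j) (@coord_field R n k) l x.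

Definition riem (R : realType) (n : nat) (G : 'rV[R]_n -> 'M[R]_n)
    (i j k l : 'I_n) (x : 'rV[R]_n) : R :=
  \sum_m G x l m * riem_up G m i j k x.

Definition ricci (R : realType) (n : nat) (G : 'rV[R]_n -> 'M[R]_n)
    (i k : 'I_n) (x : 'rV[R]_n) : R :=
  \sum_j \sum_l ginv G j l x * riem G i j k l x.

Definition scal (R : realType) (n : nat) (G : 'rV[R]_n -> 'M[R]_n)
    (x : 'rV[R]_n) : R :=
  \sum_i \sum_k ginv G i k x * ricci G i k x.

(* $R^{ql}$ *)
Definition ricci_up (R : realType) (n : nat) (G : 'rV[R]_n -> 'M[R]_n)
    (q l : 'I_n) (x : 'rV[R]_n) : R :=
  \sum_a \sum_b ginv G q a x * ginv G l b x * ricci G a b x.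

Definition ricci_norm2 (R : realType) (n : nat) (G : 'rV[R]_n -> 'M[R]_n)
    (x : 'rV[R]_n) : R :=
  \sum_i \sum_j ricci_up G i j x * ricci G i j x.

Definition weyl (R : realType) (n : nat) (G : 'rV[R]_n -> 'M[R]_n)
    (i j k l : 'I_n) (x : 'rV[R]_n) : R :=
  riem G i j k l x
  - (n%:R - 2)^-1 *
    (ricci G i k x * G x j l - ricci G i l x * G x j k
     + ricci G j l x * G x i k - ricci G j k x * G x i l)
  + scal G x / ((n%:R - 1) * (n%:R - 2)) *
    (G x i k * G x j l - G x i l * G x j k).

(* Covariant derivatives of covariant tensors of rank 2, 3 and 4. *)
Definition nabla2 (R : realType) (n : nat) (G : 'rV[R]_n -> 'M[R]_n)
    (T : 'I_n -> 'I_n -> 'rV[R]_n -> R) (a i j : 'I_n) (x : 'rV[R]_n) : R :=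
  pderiv a (T i j) x
  - \sum_m (christoffel G m a i x * T m j x
            + christoffel G m a j x * T i m x).

Definition nabla3 (R : realType) (n : nat) (G : 'rV[R]_n -> 'M[R]_n)
    (T : 'I_n -> 'I_n -> 'I_n -> 'rV[R]_n -> R)
    (a i j k : 'I_n) (x : 'rV[R]_n) : R :=
  pderiv a (T i j k) x
  - \sum_m (christoffel G m a i x * T m j k x
            + christoffel G m a j x * T i m k x
            + christoffel G m a k x * T i j m x).

Definition nabla4 (R : realType) (n : nat) (G : 'rV[R]_n -> 'M[R]_n)
    (T : 'I_n -> 'I_n -> 'I_n -> 'I_n -> 'rV[R]_n -> R)
    (a i j k l : 'I_n) (x : 'rV[R]_n) : R :=
  pderiv a (T i j k l) x
  - \sum_m (christoffel G m a i x * T m j k l x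
            + christoffel G m a j x * T i m k l x
            + christoffel G m a k x * T i j m l x
            + christoffel G m a l x * T i j k m x).

Definition laplacian3 (R : realType) (n : nat) (G : 'rV[R]_n -> 'M[R]_n)
    (T : 'I_n -> 'I_n -> 'I_n -> 'rV[R]_n -> R)
    (i j k : 'I_n) (x : 'rV[R]_n) : R :=
  \sum_a \sum_b ginv G a b x * nabla4 G (nabla3 G T) a b i j k x.

Definition cotton (R : realType) (n : nat) (G : 'rV[R]_n -> 'M[R]_n)
    (i j k : 'I_n) (x : 'rV[R]_n) : R :=
  nabla2 G (ricci G) k i j x - nabla2 G (ricci G) j i k x
  - (2 * (n%:R - 1))^-1 *
    (pderiv k (scal G) x * G x i j - pderiv j (scal G) x * G x i k).

Definition ricci_flow (R : realType) (n : nat) (M : topologicalType)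
    (A : smooth_atlas R n M) (I : set R) (g : metric_family A I) : Prop :=
  forall (a : chart_index A) (t : R) (x : 'rV[R]_n) (i j : 'I_n),
    I t -> chart_img a x ->
    dtime I (fun s => metric g a s x i j) t = - 2 * ricci (metric g a t) i j x.

(* The right-hand side of the evolution equation of the Cotton tensor, split  *)
(* into three groups: the terms linear in the Cotton tensor, the remaining    *)
(* terms involving only the Ricci tensor, and the terms with the covariant    *)
(* derivative of the Weyl tensor. A repeated pair of lower indices [l] is     *)
(* contracted with [ginv G l m].                                              *)
Definition cotton_terms (R : realType) (n : nat) (G : 'rV[R]_n -> 'M[R]_n)
    (i j k : 'I_n) (x : 'rV[R]_n) : R :=
  let g i j := G x i j in
  let gi p q := ginv G p q x in
  let Rc i j := ricci G i j x in
  let Rcu i j := ricci_up G i j x in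
  let C i j k := cotton G i j k x in
  let W i j k l := weyl G i j k l x in
  (n%:R - 2)^-1 *
    (\sum_p \sum_q gi p q * Rc p j *
       (C k q i + C q k i + (n%:R - 3) * C i k q)
     + (n%:R + 2) * \sum_p \sum_q gi p q * Rc i p * C q k j
     - \sum_p \sum_q gi p q * Rc p k *
         (C j q i + C q j i + (n%:R - 3) * C i j q))
  + 2 / (n%:R - 2) * scal G x * C i j k
  + 2 / (n%:R - 2) * (\sum_q \sum_l Rcu q l * C q j l) * g i k
  - 2 / (n%:R - 2) * (\sum_q \sum_l Rcu q l * C q k l) * g i j
  - 2 * (\sum_p \sum_q \sum_l \sum_m gi p q * gi l m * W p i k l * C q j m)
  + 2 * (\sum_p \sum_q \sum_l \sum_m gi p q * gi l m * W p i j l * C q k m)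
  - 2 * (\sum_p \sum_q \sum_l \sum_m gi p q * gi l m * W j k l p * C q i m).

Definition ricci_terms (R : realType) (n : nat) (G : 'rV[R]_n -> 'M[R]_n)
    (i j k : 'I_n) (x : 'rV[R]_n) : R :=
  let g i j := G x i j in
  let gi p q := ginv G p q x in
  let Rc i j := ricci G i j x in
  let dRc a i j := nabla2 G (ricci G) a i j x in
  let S := scal G x in
  let dS a := pderiv a (scal G) x in
  let dN a := pderiv a (ricci_norm2 G) x in
  1 / ((n%:R - 1) * (n%:R - 2)) * dN k * g i j
  - 1 / ((n%:R - 1) * (n%:R - 2)) * dN j * g i k
  + S / ((n%:R - 1) * (n%:R - 2)) * dS j * g i k
  - S / ((n%:R - 1) * (n%:R - 2)) * dS k * g i j
  + 2 / (n%:R - 2) * (\sum_p \sum_q gi p q * Rc p k * dRc j q i)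
  - 2 / (n%:R - 2) * (\sum_p \sum_q gi p q * Rc p j * dRc k q i)
  + 1 / (n%:R - 2) * Rc i j * dS k
  - 1 / (n%:R - 2) * Rc i k * dS j.

Definition nabla_weyl_terms (R : realType) (n : nat) (G : 'rV[R]_n -> 'M[R]_n)
    (i j k : 'I_n) (x : 'rV[R]_n) : R :=
  let gi p q := ginv G p q x in
  let Rc i j := ricci G i j x in
  let dW a i j k l := nabla4 G (weyl G) a i j k l x in
  2 * (\sum_p \sum_q \sum_l \sum_m gi p q * gi l m * Rc p l * dW j q i k m)
  - 2 * (\sum_p \sum_q \sum_l \sum_m gi p q * gi l m * Rc p l * dW k q i j m).

(* Main.v *)
Require Import Defs.
From HB Require Import structures.
From mathcomp Require Import all_boot all_order all_algebra.
From mathcomp Require Import all_classical all_reals all_analysis.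
From mathcomp Require Import ring lra.

Set Implicit Arguments.
Unset Strict Implicit.
Unset Printing Implicit Defensive.

Import Order.TTheory GRing.Theory Num.Theory.
Import numFieldNormedType.Exports.

Local Open Scope classical_set_scope.
Local Open Scope ring_scope.

(** Write $S = \mathrm{Ric} - \frac{R}{2(n-1)} g$, so that
    $C_{ijk} = \nabla_k S_{ij} - \nabla_j S_{ik}$. Under the flow
    $\partial_t S = \Delta S + Q$ with $Q$ quadratic in the curvature
    ([dt_Ric], [dt_Scal], [dt_Sch]). To differentiate $C$ in time one commutes
    $\partial_t$ with $\nabla$, which costs the variation of the Christoffel
    symbols, a first derivative of Ricci ([g_dtGam], [dt_cov2]), and then
    $\nabla$ with $\Delta$, which by the Ricci identities and the contracted
    second Bianchi identity costs products of curvature with $\nabla S$ and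
    of $\nabla\mathrm{Ric}$ with $S$ ([comm_lap2]). Hence
    $(\partial_t - \Delta) C$ is a contraction of curvature with its first
    derivatives ([dt_Cot_lap], [evol_halfE]). The rest is multilinear algebra at
    a point: replacing the curvature by the Weyl tensor on the right-hand side
    and expanding both sides into the same short list of contractions, they agree
    ([cotton_algebra]).

    None of this uses more about smooth functions than that they form a
    commutative ring with commuting derivations, in which the metric has an
    inverse and the integers 2, n - 1 and n - 2 are invertible. The tensor
    calculus is therefore done over an abstract such ring, up to
    [cotton_evolution]. It applies to the ring [sfun] of functions that are
    smooth on the product of the time interval and the image of a chart. That
    this is a ring containing the inverse metric is closure of smoothness
    under products and reciprocals ([SmM], [SmV], [Sm_invmx]); that the
    derivations commute, one-sided time derivatives included, is [schwarz].

    If the Cotton tensor vanishes along the flow, everything linear in it drops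
    out of the formula. If the Weyl tensor vanishes and n is at least 4, its
    divergence, which is $\frac{n-3}{n-2}$ times the Cotton tensor up to sign,
    vanishes too ([weyl0_cotton0]), which reduces to the previous case. *)

(** * Derivations and metric contractions *)
Section Derivation.
Variables (A : comPzRingType) (D : A -> A).
Hypothesis DD : forall x y, D (x + y) = D x + D y.
Hypothesis DM : forall x y, D (x * y) = D x * y + x * D y.

Lemma drv0 : D 0 = 0.
Proof. by apply: (addrI (D 0)); rewrite -DD !addr0. Qed.

Lemma drvN x : D (- x) = - D x.
Proof. by apply: (addrI (D x)); rewrite -DD !subrr drv0. Qed.

Lemma drvB x y : D (x - y) = D x - D y.
Proof. by rewrite DD drvN. Qed.

Lemma drv_sum (J : Type) (r : seq J) (P : pred J) (F : J -> A) :
  D (\sum_(i <- r | P i) F i) = \sum_(i <- r | P i) D (F i).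
Proof. by apply: (big_morph D) => [x y|]; rewrite ?DD ?drv0. Qed.

Lemma drv1 : D 1 = 0.
Proof.
by apply: (addrI (D 1)); have := DM 1 1; rewrite !mulr1 mul1r addr0 => <-.
Qed.

Lemma drv_nat m : D m%:R = 0.
Proof. by elim: m => [|m IH]; rewrite ?drv0 // -natr1 DD IH drv1 addr0. Qed.

(** From $x m = 1$ follows $D(x)\, m = 0$, and $m$ is invertible. *)
Lemma drv_inv_nat m x : x * m%:R = 1 -> D x = 0.
Proof.
move=> xm; have: D (x * m%:R) = D x * m%:R by rewrite DM drv_nat; ring.
rewrite xm drv1 => /(congr1 ( *%R^~ x)); rewrite mul0r => E.
have -> : D x = D x * m%:R * x by rewrite -mulrA [_ * x]mulrC xm mulr1.
by rewrite -E.
Qed.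
End Derivation.

Section Contraction.
Variables (A : comPzRingType) (n : nat).
Local Notation T1 := ('I_n -> A).
Local Notation T2 := ('I_n -> 'I_n -> A).
Local Notation T4 := ('I_n -> 'I_n -> 'I_n -> 'I_n -> A).

Variables (g gi : T2).
Hypothesis gC : forall i j, g i j = g j i.
Hypothesis giC : forall i j, gi i j = gi j i.
Hypothesis gig : forall i j, \sum_k gi i k * g k j = (i == j)%:R.

(** All contractions are applications of this one operator, which is linear and
    commutes with itself; no orthonormal frame is ever chosen. *)
Definition contr (F : T2) : A := \sum_p \sum_q gi p q * F p q.

Local Notation ct := contr.

Lemma eq_ct F G : (forall p q, F p q = G p q) -> ct F = ct G.
Proof. by move=> E; apply: eq_bigr => p _; apply: eq_bigr => q _; rewrite E. Qed.

Lemma ctD F G : ct (fun p q => F p q + G p q) = ct F + ct G.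
Proof.
rewrite /contr -big_split /=; apply: eq_bigr => p _.
by rewrite -big_split /=; apply: eq_bigr => q _; rewrite mulrDr.
Qed.

Lemma ctZl c F : ct (fun p q => c * F p q) = c * ct F.
Proof.
rewrite /contr mulr_sumr; apply: eq_bigr => p _; rewrite mulr_sumr.
by apply: eq_bigr => q _; rewrite mulrCA.
Qed.

Lemma ctZr c F : ct (fun p q => F p q * c) = ct F * c.
Proof. by rewrite mulrC -ctZl; apply: eq_ct => p q; rewrite mulrC. Qed.

Lemma ctN F : ct (fun p q => - F p q) = - ct F.
Proof. by rewrite -mulN1r -ctZl; apply: eq_ct => p q; rewrite mulN1r. Qed.

Lemma ctB F G : ct (fun p q => F p q - G p q) = ct F - ct G.
Proof. by rewrite ctD ctN. Qed.

Lemma ct0 : ct (fun _ _ => 0) = 0.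
Proof. by rewrite /contr big1 // => p _; rewrite big1 // => q _; rewrite mulr0. Qed.

Lemma ct_sum (J : finType) (F : J -> T2) :
  ct (fun p q => \sum_j F j p q) = \sum_j ct (F j).
Proof.
rewrite /contr [RHS]exchange_big /=; apply: eq_bigr => p _.
rewrite [RHS]exchange_big /=; apply: eq_bigr => q _.
by rewrite mulr_sumr.
Qed.

Lemma ctC F : ct F = ct (fun p q => F q p).
Proof.
rewrite /contr exchange_big /=; apply: eq_bigr => p _; apply: eq_bigr => q _.
by rewrite giC.
Qed.

Lemma ct_ct (F : T4) :
  ct (fun p q => ct (fun l m => F p q l m)) = ct (fun l m => ct (fun p q => F p q l m)).
Proof.
rewrite {1}/contr.
transitivity (\sum_p \sum_q ct (fun l m => gi p q * F p q l m)).
  by apply: eq_bigr => p _; apply: eq_bigr => q _; rewrite ctZl.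
transitivity (\sum_p (ct (fun l m => \sum_q gi p q * F p q l m))).
  by apply: eq_bigr => p _; rewrite ct_sum.
by rewrite -ct_sum.
Qed.

Lemma sum_delta (i : 'I_n) (F : T1) : \sum_k (k == i)%:R * F k = F i.
Proof.
rewrite (bigD1 i) //= eqxx mul1r big1 ?addr0 // => j /negPf ->.
by rewrite mul0r.
Qed.

Lemma ct_gl i (F : T1) : ct (fun p q => g i p * F q) = F i.
Proof.
rewrite /contr exchange_big /= -[RHS](sum_delta i); apply: eq_bigr => q _.
rewrite -gig mulr_suml; apply: eq_bigr => k _.
by rewrite giC (gC i); ring.
Qed.

Lemma ct_gr i (F : T1) : ct (fun p q => F p * g q i) = F i.
Proof. by rewrite ctC -[RHS]ct_gl; apply: eq_ct => p q; rewrite mulrC gC. Qed.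

Lemma ct_gg : ct g = n%:R.
Proof.
rewrite /contr (eq_bigr (fun=> 1)) ?sumr_const ?card_ord // => p _.
by rewrite (eq_bigr (fun q => gi p q * g q p)) ?gig ?eqxx // => q _; rewrite (gC p).
Qed.

(** Lowering an index loses nothing; identities for mixed tensors are proved
    after lowering. *)
Lemma g_inj (F G : T1) :
  (forall l, \sum_m g l m * F m = \sum_m g l m * G m) -> forall m, F m = G m.
Proof.
move=> E m.
have K (H : T1) : \sum_l gi m l * (\sum_k g l k * H k) = H m.
  rewrite -[RHS](sum_delta m).
  under eq_bigr do rewrite mulr_sumr.
  rewrite exchange_big /=; apply: eq_bigr => k _.
  rewrite eq_sym -gig mulr_suml; apply: eq_bigr => l _; exact: mulrA.
by rewrite -[LHS]K -[RHS]K; apply: eq_bigr => l _; rewrite E.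
Qed.

(** Contracting a lowered index with the inverse metric is the plain pairing of an
    upper with a lower index. *)
Lemma ct_low (F X : T1) :
  ct (fun p q => (\sum_m g p m * F m) * X q) = \sum_m F m * X m.
Proof.
transitivity (ct (fun p q => \sum_m g m p * (F m * X q))).
  by apply: eq_ct => p q; rewrite mulr_suml; apply: eq_bigr => m _; rewrite (gC m) mulrA.
by rewrite ct_sum; apply: eq_bigr => m _; rewrite (ct_gl m (fun q => F m * X q)).
Qed.

Definition pair1 (X Y : T1) := ct (fun p q => X p * Y q).
Definition pair2 (X Y : T2) := ct (fun p q => ct (fun l m => X p l * Y q m)).
Local Notation dot := pair1.
Local Notation dot2 := pair2.

Lemma dot2C U V : dot2 U V = dot2 V U.
Proof.
rewrite /pair2 ctC; apply: eq_ct => p q; rewrite ctC; apply: eq_ct => l m.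
exact: mulrC.
Qed.

Lemma dotC U V : dot U V = dot V U.
Proof. by rewrite /pair1 ctC; apply: eq_ct => p q; exact: mulrC. Qed.

Lemma dot2T U V : dot2 U V = dot2 (fun p l => U l p) (fun p l => V l p).
Proof. by rewrite /pair2 ct_ct. Qed.

Lemma ct_inj (F : T1) : (forall X : T1, ct (fun p q => F p * X q) = 0) ->
  forall l, F l = 0.
Proof. by move=> E l; rewrite -(ct_gr l F) (E (fun q => g q l)). Qed.

Lemma eq_dot X X' V V' : X =1 X' -> V =1 V' -> dot X V = dot X' V'.
Proof. by move=> E F; apply: eq_ct => p q; rewrite E F. Qed.
Lemma eq_dot2 X X' V V' : X =2 X' -> V =2 V' -> dot2 X V = dot2 X' V'.
Proof. by move=> E F; apply: eq_ct => p q; apply: eq_ct => l m; rewrite E F. Qed.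

Lemma dotDr X V W : dot X (fun q => V q + W q) = dot X V + dot X W.
Proof. by rewrite /pair1 -ctD; apply: eq_ct => p q; rewrite mulrDr. Qed.
Lemma dotZr X a V : dot X (fun q => a * V q) = a * dot X V.
Proof. by rewrite /pair1 -ctZl; apply: eq_ct => p q; rewrite mulrCA. Qed.
Lemma dotNr X V : dot X (fun q => - V q) = - dot X V.
Proof. by rewrite /pair1 -ctN; apply: eq_ct => p q; rewrite mulrN. Qed.
Lemma dotBr X V W : dot X (fun q => V q - W q) = dot X V - dot X W.
Proof. by rewrite dotDr dotNr. Qed.
Lemma dotDl X V W : dot (fun q => V q + W q) X = dot V X + dot W X.
Proof. by rewrite /pair1 -ctD; apply: eq_ct => p q; rewrite mulrDl. Qed.
Lemma dotZl X a V : dot (fun q => a * V q) X = a * dot V X.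
Proof. by rewrite /pair1 -ctZl; apply: eq_ct => p q; rewrite mulrA. Qed.
Lemma dotNl X V : dot (fun q => - V q) X = - dot V X.
Proof. by rewrite /pair1 -ctN; apply: eq_ct => p q; rewrite mulNr. Qed.
Lemma dotBl X V W : dot (fun q => V q - W q) X = dot V X - dot W X.
Proof. by rewrite dotDl dotNl. Qed.
Lemma dot_gr X i : dot X (fun q => g q i) = X i.
Proof. exact: ct_gr. Qed.
Lemma dot_gr2 X i : dot X (g i) = X i.
Proof. by rewrite -[RHS]dot_gr; apply: eq_dot => // q; exact: gC. Qed.
Lemma dotMr X a V : dot X (fun q => V q * a) = dot X V * a.
Proof. by rewrite mulrC -dotZr; apply: eq_dot => // q; exact: mulrC. Qed.
Lemma dot_gl X i : dot (g i) X = X i.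
Proof. exact: ct_gl. Qed.

Lemma dot2Dr X V W : dot2 X (fun p q => V p q + W p q) = dot2 X V + dot2 X W.
Proof. by rewrite /pair2 -ctD; apply: eq_ct => p q; exact: (dotDr (X p)). Qed.
Lemma dot2Zr X a V : dot2 X (fun p q => a * V p q) = a * dot2 X V.
Proof. by rewrite /pair2 -ctZl; apply: eq_ct => p q; exact: (dotZr (X p)). Qed.
Lemma dot2Mr X a V : dot2 X (fun p q => V p q * a) = dot2 X V * a.
Proof. by rewrite mulrC -dot2Zr; apply: eq_dot2 => // p q; exact: mulrC. Qed.
Lemma dot2Nr X V : dot2 X (fun p q => - V p q) = - dot2 X V.
Proof. by rewrite /pair2 -ctN; apply: eq_ct => p q; exact: (dotNr (X p)). Qed.
Lemma dot2Br X V W : dot2 X (fun p q => V p q - W p q) = dot2 X V - dot2 X W.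
Proof. by rewrite dot2Dr dot2Nr. Qed.
Lemma dot2Dl X V W : dot2 (fun p q => V p q + W p q) X = dot2 V X + dot2 W X.
Proof. by rewrite /pair2 -ctD; apply: eq_ct => p q; exact: (dotDl (X q)). Qed.
Lemma dot2Zl X a V : dot2 (fun p q => a * V p q) X = a * dot2 V X.
Proof. by rewrite /pair2 -ctZl; apply: eq_ct => p q; exact: (dotZl (X q)). Qed.
Lemma dot2Nl X V : dot2 (fun p q => - V p q) X = - dot2 V X.
Proof. by rewrite /pair2 -ctN; apply: eq_ct => p q; exact: (dotNl (X q)). Qed.
Lemma dot2Bl X V W : dot2 (fun p q => V p q - W p q) X = dot2 V X - dot2 W X.
Proof. by rewrite dot2Dl dot2Nl. Qed.

Lemma dot2_gR a i V : dot2 (fun p l => a p * g i l) V = dot a (fun q => V q i).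
Proof.
apply: eq_ct => p q; rewrite -(ct_gl i (V q)) -ctZl.
by apply: eq_ct => l m; rewrite mulrA.
Qed.
Lemma dot2_gL b i V : dot2 (fun p l => g i p * b l) V = dot b (V i).
Proof.
rewrite dot2T -[RHS](dot2_gR b i (fun p l => V l p)).
by apply: eq_ct => p q; apply: eq_ct => l m; rewrite (mulrC (b p)).
Qed.
Lemma dot2_gg k i V : dot2 (fun p l => g k p * g i l) V = V k i.
Proof. by rewrite dot2_gL dot_gl. Qed.
Lemma dot2_g V : dot2 g V = ct V.
Proof. by rewrite [RHS]ctC; apply: eq_ct => p q; rewrite ct_gl. Qed.

(** The transposition of both arguments leaves the pairing unchanged and changes
    the sign of the second one. *)
Lemma dot2_sym_anti X V : (forall p l, X p l = X l p) ->
  (forall p l, V p l = - V l p) -> (forall x : A, x = - x -> x = 0) -> dot2 X V = 0.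
Proof.
move=> XC VN H; apply: H; rewrite {1}dot2T -dot2Nr.
by apply: eq_dot2 => p l //; rewrite VN ?opprK.
Qed.

End Contraction.

(** * The evolution equation as an identity of multilinear algebra *)

(** The variables stand for the values at a point of the curvature [Rm], its
    covariant derivative [dRm], the Ricci tensor [Ric], its covariant derivative
    [r], the scalar curvature [Sc] and its differential [s]; only their
    symmetries and traces matter. The scalars are
    $c = \frac1{2(n-1)}$ and $u = \frac1{n-2}$. *)
Section CurvatureAlgebra.
Variables (A : comPzRingType) (n : nat).
Local Notation T1 := ('I_n -> A).
Local Notation T2 := ('I_n -> 'I_n -> A).
Local Notation T3 := ('I_n -> 'I_n -> 'I_n -> A).
Local Notation T4 := ('I_n -> 'I_n -> 'I_n -> 'I_n -> A).
Variables (g gi : T2).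
Hypothesis gC : forall i j, g i j = g j i.
Hypothesis giC : forall i j, gi i j = gi j i.
Hypothesis gig : forall i j, \sum_k gi i k * g k j = (i == j)%:R.
Local Notation ct := (contr gi).
Local Notation dot := (pair1 gi).
Local Notation dot2 := (pair2 gi).
Let dotC := dotC giC.
Let dot_gr2 := dot_gr2 gC giC gig.
Let dot2_gg := dot2_gg gC giC gig.
Let dot2C := dot2C giC.
Let dot_gr := dot_gr gC giC gig.
Let dot_gl := dot_gl gC giC gig.
Let dot2_gR := dot2_gR gC giC gig.
Let dot2_gL := dot2_gL gC giC gig.
Let dot2_g := dot2_g gC giC gig.
Let ct_gg := ct_gg gC gig.

Variables (Rm : T4) (dRm : 'I_n -> T4) (Ric : T2) (r : T3) (Sc : A) (s : T1).
Hypothesis RmN12 : forall i j k l, Rm j i k l = - Rm i j k l.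
Hypothesis RmN34 : forall i j k l, Rm i j l k = - Rm i j k l.
Hypothesis RmC : forall i j k l, Rm k l i j = Rm i j k l.
Hypothesis bianchi1 : forall i j k l, Rm i j k l + Rm j k i l + Rm k i j l = 0.
Hypothesis dRmN12 : forall a i j k l, dRm a j i k l = - dRm a i j k l.
Hypothesis RicE : forall i k, ct (fun j l => Rm i j k l) = Ric i k.
Hypothesis RicC : forall i j, Ric i j = Ric j i.
Hypothesis ScE : ct Ric = Sc.
Hypothesis rC : forall a i j, r a i j = r a j i.
Hypothesis sE : forall a, ct (r a) = s a.
Variables (half c u : A).
Hypothesis half2 : half * 2 = 1.
Hypothesis div_r : forall k, ct (fun a i => r a i k) = half * s k.
Hypothesis cE : c * (n%:R - 1) = half.
Hypothesis uE : u * (n%:R - 2) = 1.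

Let uN : u * n%:R - 1 - 2 * u = 0.
Proof.
have -> : u * n%:R - 1 - 2 * u = u * (n%:R - 2) - 1 by ring.
by rewrite uE subrr.
Qed.

(** $\frac1{(n-1)(n-2)} = \frac1{n-2} - \frac1{n-1}$. *)
Let uc : 2 * (u * c) - (u - 2 * c) = 0.
Proof.
have E1 : u * (2 * (c * (n%:R - 1))) = u by rewrite cE (mulrC 2) half2 mulr1.
transitivity (2 * (u * c) - (u * (2 * (c * (n%:R - 1))) - 2 * c * (u * (n%:R - 2)))).
  by rewrite E1 uE mulr1.
ring.
Qed.

Let anti0 (x : A) : x = - x -> x = 0.
Proof.
move=> E; have : x + x = 0 by rewrite {1}E addNr.
by move=> /(congr1 ( *%R half)); rewrite mulr0 -mulr2n -mulr_natr mulrCA half2 mulr1.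
Qed.

Definition cot_part i j k := r k i j - r j i k - c * (s k * g i j - s j * g i k).
Definition weyl_part i j k l := Rm i j k l
  - u * (Ric i k * g j l - Ric i l * g j k + Ric j l * g i k - Ric j k * g i l)
  + 2 * c * u * Sc * (g i k * g j l - g i l * g j k).
Definition nab_weyl_part a i j k l := dRm a i j k l
  - u * (r a i k * g j l - r a i l * g j k + r a j l * g i k - r a j k * g i l)
  + 2 * c * u * s a * (g i k * g j l - g i l * g j k).

(** Both sides of the evolution equation are combinations of the following
    contractions, of [ric_cot], and of products of [g], [Ric], [r], [s]
    and [Sc]. *)
Definition ric_div k i j := dot (Ric k) (fun q => r q i j).
Definition ric_der j k i := dot (Ric j) (r k i).
Definition ric_dscal k := dot (Ric k) s.
Definition rm_dric k i j := dot2 (fun a p => Rm k a i p) (fun b q => r b q j).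
Definition rm_dscal k i j := dot (fun a => Rm k a i j) s.
Definition drm_ric k i j := dot2 (fun p q => dRm k i p j q) Ric.
Definition rm_dric_tr k i j := dot2 (fun p q => Rm i p j q) (r k).
Definition ric_dric k := dot2 (r k) Ric.
Definition ric_cot j := dot2 Ric (fun q l => cot_part q j l).

Lemma ric_divC k i j : ric_div k i j = ric_div k j i.
Proof. by apply: eq_dot => // q; rewrite rC. Qed.

Lemma rm_dscalN k i j : rm_dscal k j i = - rm_dscal k i j.
Proof. by rewrite -dotNl; apply: eq_dot => // a; rewrite RmN34. Qed.

Lemma dot_ric_cot1 a k i : dot (Ric a) (fun q => cot_part k q i) =
  ric_der a i k - ric_div a k i - c * (s i * Ric a k - ric_dscal a * g k i).
Proof.
rewrite dotBr dotBr dotZr dotBr.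
by rewrite dotZr dotMr dot_gr2.
Qed.

Lemma dot_ric_cot0 a k i : dot (Ric a) (fun q => cot_part q k i) =
  ric_der a i k - ric_der a k i - c * (s i * Ric a k - s k * Ric a i).
Proof.
rewrite dotBr dotBr dotZr dotBr !dotZr !dot_gr; congr (_ - _ - _).
  by apply: eq_dot => // q; rewrite rC.
by apply: eq_dot => // q; rewrite rC.
Qed.

Lemma dot_ric_cot2 a i k : dot (Ric a) (cot_part i k) =
  ric_div a i k - ric_der a k i - c * (ric_dscal a * g i k - s k * Ric a i).
Proof. by rewrite dotBr dotBr dotZr dotBr dotZr dotMr dot_gr2. Qed.

(** The trace is $\frac12 - 1 + c(n-1) = 0$ times $\nabla_j R$, by the contracted
    second Bianchi identity. *)
Lemma tr_cot j : ct (fun q m => cot_part q j m) = 0.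
Proof.
have -> : ct (fun q m => cot_part q j m) = ct (fun a i => r a i j) - ct (r j)
    - c * (ct (fun q m => s m * g q j) - s j * ct g).
  rewrite (ctC giC (fun a i => r a i j)) -!ctZl -!ctB -ctZl -ctB.
  exact: eq_ct.
rewrite div_r sE ct_gg (_ : ct _ = s j); last first.
  by rewrite -[RHS](dot_gr2 s) dotC; apply: eq_ct => q m; rewrite mulrC (gC q).
transitivity (half * s j - s j + (c * (n%:R - 1)) * s j); first by ring.
rewrite cE; have {2}-> : s j = half * 2 * s j by rewrite half2 mul1r.
ring.
Qed.

(** The terms of the Weyl tensor that contract $C$ on its outer indices vanish,
    since $C$ is trace-free. *)
Lemma weyl_cot i j k :
  dot2 (fun p l => weyl_part p i k l) (fun q m => cot_part q j m) =
  - rm_dric k i j + rm_dric_tr j i k - c * (rm_dscal k j i + s j * Ric i k)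
  - u * (dot (Ric k) (fun q => cot_part q j i) - g i k * ric_cot j
         + dot (Ric i) (cot_part k j))
  + 2 * c * u * Sc * cot_part k j i.
Proof.
have R1 : dot2 (fun p l => Rm p i k l) (fun q m => cot_part q j m) =
    - rm_dric k i j + rm_dric_tr j i k - c * (rm_dscal k j i + s j * Ric i k).
  rewrite dot2Br dot2Br dot2Zr dot2Br dot2Zr.
  have -> : dot2 (fun p l => Rm p i k l) (fun q m => r m q j) = - rm_dric k i j.
    rewrite dot2T -dot2Nl; apply: eq_dot2 => // p q.
    by rewrite -RmC RmN34.
  have -> : dot2 (fun p l => Rm p i k l) (r j) = - rm_dric_tr j i k.
    by rewrite -dot2Nl; apply: eq_dot2 => // p q; rewrite RmN12.
  have -> : dot2 (fun p l => Rm p i k l) (fun q m => s m * g q j) = rm_dscal k j i.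
    rewrite dot2C (eq_dot2 gi (X' := fun q m => g j q * s m)
      (V' := fun p l => Rm p i k l)) // => [|q m]; last by rewrite mulrC gC.
    by rewrite dot2_gL dotC; apply: eq_dot => // a; rewrite RmC.
  have -> : dot2 (fun p l => Rm p i k l) g = - Ric i k.
    by rewrite dot2C dot2_g -RicE -ctN; apply: eq_ct => p l; rewrite RmN12.
  ring.
rewrite dot2Dl dot2Bl R1 !dot2Zl dot2Bl.
rewrite dot2Bl dot2Dl dot2Bl.
have -> : dot2 (fun p l => Ric p k * g i l) (fun q m => cot_part q j m) =
    dot (Ric k) (fun q => cot_part q j i).
  by rewrite dot2_gR; apply: eq_dot => // p; rewrite RicC.
have -> : dot2 (fun p l => Ric p l * g i k) (fun q m => cot_part q j m) = g i k * ric_cot j.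
  by rewrite -dot2Zl; apply: eq_dot2 => // p l; rewrite mulrC.
have -> : dot2 (fun p l => Ric i l * g p k) (fun q m => cot_part q j m) = dot (Ric i) (cot_part k j).
  by rewrite -(dot2_gL (Ric i) k (fun q m => cot_part q j m)); apply: eq_dot2 => // p l; rewrite mulrC gC.
have -> : dot2 (fun p l => Ric i k * g p l) (fun q m => cot_part q j m) = 0.
  by rewrite dot2Zl dot2_g tr_cot mulr0.
have -> : dot2 (fun p l => g p k * g i l) (fun q m => cot_part q j m) = cot_part k j i.
  by rewrite -(dot2_gg k i (fun q m => cot_part q j m)); apply: eq_dot2 => // p l; rewrite (gC p).
have -> : dot2 (fun p l => g p l * g i k) (fun q m => cot_part q j m) = 0.
  by rewrite (eq_dot2 gi (X' := fun p l => g i k * g p l) (V' := fun q m => cot_part q j m))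
    // => [|p l]; rewrite 1?mulrC // dot2Zl dot2_g tr_cot mulr0.
ring.
Qed.

(** $R_{jklp}$ is antisymmetric in $l, p$ and annihilates $\nabla_i R_{pl}$; by the
    first Bianchi identity its contraction with $\nabla_l R_{pi}$ is a difference of
    two contractions of the kind [rm_dric]. *)
Lemma weyl_cot3 i j k :
  dot2 (fun p l => weyl_part j k l p) (fun q m => cot_part q i m) =
  rm_dric j k i - rm_dric k j i - c * (rm_dscal j k i - rm_dscal k j i)
  - u * (dot (Ric j) (cot_part k i) - dot (Ric j) (fun q => cot_part q i k)
         + dot (Ric k) (fun q => cot_part q i j) - dot (Ric k) (cot_part j i))
  + 2 * c * u * Sc * (cot_part k i j - cot_part j i k).
Proof.
have RE p l : Rm j k l p = Rm j l k p - Rm k l j p.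
  have /eqP := bianchi1 j k l p; rewrite -addrA addr_eq0 => /eqP ->.
  by rewrite (RmN12 j l); ring.
have R1 : dot2 (fun p l => Rm j k l p) (fun q m => cot_part q i m) =
    rm_dric j k i - rm_dric k j i - c * (rm_dscal j k i - rm_dscal k j i).
  rewrite dot2Br dot2Br dot2Zr dot2Br dot2Zr.
  have -> : dot2 (fun p l => Rm j k l p) (fun q m => r m q i) = rm_dric j k i - rm_dric k j i.
    by rewrite dot2T -dot2Bl; apply: eq_dot2 => // l p /=; rewrite RE.
  have -> : dot2 (fun p l => Rm j k l p) (r i) = 0.
    by rewrite dot2C dot2_sym_anti // => p l; exact: RmN34.
  have -> : dot2 (fun p l => Rm j k l p) (fun q m => s m * g q i) = rm_dscal j k i - rm_dscal k j i.
    rewrite dot2C (eq_dot2 gi (X' := fun q m => g i q * s m)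
      (V' := fun p l => Rm j k l p)) // => [|q m]; last by rewrite mulrC gC.
    by rewrite dot2_gL dotC -dotBl; apply: eq_dot => // l; rewrite RE.
  have -> : dot2 (fun p l => Rm j k l p) g = 0.
    by rewrite dot2C dot2_sym_anti // => p l; exact: RmN34.
  ring.
rewrite dot2Dl dot2Bl R1 !dot2Zl dot2Bl.
rewrite dot2Bl dot2Dl dot2Bl.
have -> : dot2 (fun p l => Ric j l * g k p) (fun q m => cot_part q i m) = dot (Ric j) (cot_part k i).
  by rewrite -(dot2_gL (Ric j) k (fun q m => cot_part q i m)); apply: eq_dot2 => // p l; rewrite mulrC.
have -> : dot2 (fun p l => Ric j p * g k l) (fun q m => cot_part q i m) =
    dot (Ric j) (fun q => cot_part q i k) by rewrite dot2_gR.
have -> : dot2 (fun p l => Ric k p * g j l) (fun q m => cot_part q i m) =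
    dot (Ric k) (fun q => cot_part q i j) by rewrite dot2_gR.
have -> : dot2 (fun p l => Ric k l * g j p) (fun q m => cot_part q i m) = dot (Ric k) (cot_part j i).
  by rewrite -(dot2_gL (Ric k) j (fun q m => cot_part q i m)); apply: eq_dot2 => // p l; rewrite mulrC.
have -> : dot2 (fun p l => g j l * g k p) (fun q m => cot_part q i m) = cot_part k i j.
  by rewrite -(dot2_gg k j (fun q m => cot_part q i m)); apply: eq_dot2 => // p l; rewrite mulrC.
by rewrite dot2_gg.
Qed.

Lemma ric_nab_weyl a i k :
  dot2 Ric (fun q m => nab_weyl_part a q i k m) =
  - drm_ric a i k - u * (ric_der i a k - ric_dric a * g i k + ric_der k a i - Sc * r a i k)
  + 2 * c * u * s a * (Ric k i - Sc * g i k).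
Proof.
rewrite dot2Dr dot2Br !dot2Zr dot2Br.
rewrite dot2Br dot2Dr dot2Br.
have -> : dot2 Ric (fun q m => dRm a q i k m) = - drm_ric a i k.
  by rewrite dot2C -dot2Nl; apply: eq_dot2 => // p q; rewrite dRmN12.
have -> : dot2 Ric (fun q m => r a q k * g i m) = ric_der i a k.
  by rewrite dot2C dot2_gR dotC; apply: eq_dot => // q; rewrite ?(RicC q) ?(rC _ q).
have -> : dot2 Ric (fun q m => r a q m * g i k) = ric_dric a * g i k.
  by rewrite dot2Mr dot2C.
have -> : dot2 Ric (fun q m => r a i m * g q k) = ric_der k a i.
  rewrite dot2C (eq_dot2 gi (X' := fun q m => g k q * r a i m) (V' := Ric)) // => [|q m].
    by rewrite dot2_gL dotC.
  by rewrite mulrC gC.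
have -> : dot2 Ric (fun q m => r a i k * g q m) = Sc * r a i k.
  by rewrite dot2Zr dot2C dot2_g ScE mulrC.
have -> : dot2 Ric (fun q m => g q k * g i m) = Ric k i.
  by rewrite dot2C -(dot2_gg k i Ric); apply: eq_dot2 => // p l; rewrite (gC p).
have -> : dot2 Ric (fun q m => g q m * g i k) = Sc * g i k.
  by rewrite dot2Mr dot2C dot2_g ScE.
ring.
Qed.

(** The half of $(\partial_t - \Delta) C_{ijk}$ coming from $\nabla_k S_{ij}$. The
    terms are, in order: $-R_k{}^m \nabla_m S_{ij}$, the two contractions of
    $\mathrm{Rm}$ with $\nabla S$ and the two of its divergence with $S$ from the
    commutator of $\nabla_k$ and $\Delta$; the derivative of the reaction term; the
    variation of the Christoffel symbols. *)
Definition evol_part k i j :=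
  - (ric_div k i j - c * g i j * ric_dscal k) + 2 * (rm_dric k i j - c * rm_dscal k i j)
  + 2 * (rm_dric k j i - c * rm_dscal k j i)
  + (ric_div j i k - ric_der j i k - c * Sc * (r j i k - r i j k))
  + (ric_div i j k - ric_der i j k - c * Sc * (r i j k - r j i k))
  + (2 * (drm_ric k i j + rm_dric_tr k i j) - 2 * (ric_der j k i + ric_der i k j)
     - 2 * c * (2 * ric_dric k) * g i j + 2 * c * (s k * Ric i j + Sc * r k i j))
  - (ric_div j k i - ric_der j k i - ric_der j i k - c * Sc * (r j k i - r k i j - r i k j)).

(** After expansion each side is a polynomial in the elementary contractions, and in
    [u], [c] and [n]. Each index symmetry is used once to bring the contractions into
    a common form; the difference of the sides then lies in the ideal of the
    two relations between [u], [c] and [n]. *)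
Theorem cotton_algebra i j k :
  evol_part k i j - evol_part j i k =
  u * (dot (Ric j) (fun q => cot_part k q i + cot_part q k i + (n%:R - 3) * cot_part i k q)
       + (n%:R + 2) * dot (Ric i) (fun q => cot_part q k j)
       - dot (Ric k) (fun q => cot_part j q i + cot_part q j i + (n%:R - 3) * cot_part i j q))
  + 2 * u * Sc * cot_part i j k + 2 * u * ric_cot j * g i k - 2 * u * ric_cot k * g i j
  - 2 * dot2 (fun p l => weyl_part p i k l) (fun q m => cot_part q j m)
  + 2 * dot2 (fun p l => weyl_part p i j l) (fun q m => cot_part q k m)
  - 2 * dot2 (fun p l => weyl_part j k l p) (fun q m => cot_part q i m)
  + (2 * c * u * (2 * ric_dric k) * g i j - 2 * c * u * (2 * ric_dric j) * g i k
     + 2 * c * u * Sc * s j * g i k - 2 * c * u * Sc * s k * g i j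
     + 2 * u * ric_der k j i - 2 * u * ric_der j k i + u * Ric i j * s k - u * Ric i k * s j)
  + (2 * dot2 Ric (fun q m => nab_weyl_part j q i k m)
     - 2 * dot2 Ric (fun q m => nab_weyl_part k q i j m)).
Proof.
rewrite !weyl_cot weyl_cot3 !ric_nab_weyl.
have T a k' : dot (Ric a)
    (fun q => cot_part k' q i + cot_part q k' i + (n%:R - 3) * cot_part i k' q) =
    dot (Ric a) (fun q => cot_part k' q i) + dot (Ric a) (fun q => cot_part q k' i)
    + (n%:R - 3) * dot (Ric a) (cot_part i k') by rewrite dotDr dotDr dotZr.
rewrite !T !dot_ric_cot1 !dot_ric_cot0 !dot_ric_cot2 /evol_part /cot_part.
rewrite (ric_divC k j i) (ric_divC j k i) (ric_divC i k j).
rewrite (rm_dscalN k i j) (rm_dscalN j i k).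
rewrite ?(gC j i) ?(gC k i) ?(gC k j) ?(RicC j i) ?(RicC k i) ?(RicC k j).
rewrite ?(rC _ j i) ?(rC _ k i) ?(rC _ k j).
apply/eqP; rewrite -subr_eq0; apply/eqP.
(* The cofactors come from dividing the difference of the two sides by the
   relations [uN] and then [uc]. *)
transitivity (
  (ric_div k i j - ric_div j i k + ric_der j k i - ric_der i j k + ric_der i k j - ric_der k j i
   + c * g i k * ric_dscal j - c * g i j * ric_dscal k - 2 * c * Ric i j * s k
   + 2 * c * Ric i k * s j) * (u * n%:R - 1 - 2 * u)
  + (- Ric i k * s j + Ric i j * s k - 2 * g i j * ric_dric k + 2 * g i k * ric_dric j)
    * (2 * (u * c) - (u - 2 * c))); last by rewrite uN uc; ring.
ring.
Qed.

End CurvatureAlgebra.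

(** * Levi-Civita connection over a ring with derivations *)

(** The commuting derivations [d] play the role of the coordinate fields; all
    formulas are those of a coordinate chart. *)
Section TensorCalculus.
Variables (A : comPzRingType) (n : nat).
Local Notation T1 := ('I_n -> A).
Local Notation T2 := ('I_n -> 'I_n -> A).
Local Notation T3 := ('I_n -> 'I_n -> 'I_n -> A).
Local Notation T4 := ('I_n -> 'I_n -> 'I_n -> 'I_n -> A).

Variable d : 'I_n -> A -> A.
Hypothesis dD : forall a x y, d a (x + y) = d a x + d a y.
Hypothesis dM : forall a x y, d a (x * y) = d a x * y + x * d a y.
Hypothesis dC : forall a b x, d a (d b x) = d b (d a x).

Variable half : A.
Hypothesis half2 : half * 2 = 1.

Variables (g gi : T2).
Hypothesis gC : forall i j, g i j = g j i.
Hypothesis giC : forall i j, gi i j = gi j i.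
Hypothesis gig : forall i j, \sum_k gi i k * g k j = (i == j)%:R.

Lemma d0 a : d a 0 = 0. Proof. exact: (drv0 (dD a)). Qed.
Lemma dN a x : d a (- x) = - d a x. Proof. exact: (drvN (dD a)). Qed.
Lemma dB a x y : d a (x - y) = d a x - d a y. Proof. exact: (drvB (dD a)). Qed.
Lemma d_sum a (J : Type) (r : seq J) (P : pred J) (F : J -> A) :
  d a (\sum_(i <- r | P i) F i) = \sum_(i <- r | P i) d a (F i).
Proof. exact: (drv_sum (dD a)). Qed.
Lemma d_nat a m : d a m%:R = 0.
Proof. exact: (drv_nat (dD a) (dM a)). Qed.

Local Notation ct := (contr gi).
Local Notation dot := (pair1 gi).
Local Notation dot2 := (pair2 gi).
Let ctC := ctC giC.
Let ct_gl := ct_gl gC giC gig.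
Let ct_gr := ct_gr gC giC gig.
Let g_inj := g_inj gig.
Let ct_low := ct_low gC giC gig.
Let ct_inj := ct_inj gC giC gig.
Let dotC := dotC giC.

Definition Gam m i j : A :=
  half * \sum_l gi m l * (d i (g j l) + d j (g i l) - d l (g i j)).

(** The connection acting on one covariant index. Writing every covariant derivative
    with it makes the contributions of different indices independent: they are
    linear and commute ([gam_gam]), so identities can be checked index by index. *)
Definition gam a i (X : T1) : A := \sum_m Gam m a i * X m.

Definition cov1 (T : T1) a i := d a (T i) - gam a i T.
Definition cov2 (T : T2) a i j :=
  d a (T i j) - gam a i (fun m => T m j) - gam a j (fun m => T i m).
Definition cov3 (T : T3) a i j k :=
  d a (T i j k) - gam a i (fun m => T m j k) - gam a j (fun m => T i m k)
  - gam a k (fun m => T i j m).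
Definition cov4 (T : T4) a i j k l :=
  d a (T i j k l) - gam a i (fun m => T m j k l) - gam a j (fun m => T i m k l)
  - gam a k (fun m => T i j m l) - gam a l (fun m => T i j k m).

Lemma eq_gam a i X V : (forall m, X m = V m) -> gam a i X = gam a i V.
Proof. by move=> E; apply: eq_bigr => m _; rewrite E. Qed.
Lemma gamD a i X V : gam a i (fun m => X m + V m) = gam a i X + gam a i V.
Proof. by rewrite /gam -big_split /=; apply: eq_bigr => m _; rewrite mulrDr. Qed.
Lemma gamZl a i c X : gam a i (fun m => c * X m) = c * gam a i X.
Proof. by rewrite /gam mulr_sumr; apply: eq_bigr => m _; rewrite mulrCA. Qed.
Lemma gamZr a i c X : gam a i (fun m => X m * c) = gam a i X * c.
Proof. by rewrite /gam mulr_suml; apply: eq_bigr => m _; rewrite mulrA. Qed.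
Lemma gamN a i X : gam a i (fun m => - X m) = - gam a i X.
Proof. by rewrite -mulN1r -gamZl; apply: eq_gam => m; rewrite mulN1r. Qed.
Lemma gamB a i X V : gam a i (fun m => X m - V m) = gam a i X - gam a i V.
Proof. by rewrite gamD gamN. Qed.
Lemma gam_ct a i (F : T3) :
  gam a i (fun m => ct (F m)) = ct (fun p q => gam a i (fun m => F m p q)).
Proof. by rewrite /gam ct_sum; apply: eq_bigr => m _; rewrite ctZl. Qed.
Lemma gam_gam a i b j (F : T2) :
  gam a i (fun m => gam b j (fun k => F m k)) =
  gam b j (fun k => gam a i (fun m => F m k)).
Proof.
rewrite /gam; under eq_bigr do rewrite mulr_sumr.
rewrite exchange_big /=; apply: eq_bigr => k _; rewrite mulr_sumr.
by apply: eq_bigr => m _; rewrite mulrCA.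
Qed.

Lemma GamC m i j : Gam m i j = Gam m j i.
Proof.
congr (_ * _); apply: eq_bigr => l _; rewrite (gC i j).
by congr (_ * _); ring.
Qed.

Lemma gamC a i X : gam a i X = gam i a X.
Proof. by apply: eq_bigr => m _; rewrite GamC. Qed.

Lemma g_Gam l i j :
  \sum_m g l m * Gam m i j = half * (d i (g j l) + d j (g i l) - d l (g i j)).
Proof.
rewrite -[RHS](sum_delta l (fun l => half * (d i (g j l) + d j (g i l) - d l (g i j)))).
under eq_bigr do rewrite /Gam mulrCA mulr_sumr.
rewrite -mulr_sumr exchange_big /= mulr_sumr; apply: eq_bigr => k _.
rewrite -gig mulrCA mulr_suml; congr (_ * _).
by apply: eq_bigr => m _; rewrite giC (gC l); ring.
Qed.

(** The Koszul formula in lowered form, of which $\nabla g = 0$ is the symmetrization. *)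
Lemma gam_g a i j : gam a i (g j) = half * (d a (g i j) + d i (g a j) - d j (g a i)).
Proof. by rewrite -g_Gam; apply: eq_bigr => m _; rewrite mulrC. Qed.

Lemma cov_g a i j : cov2 g a i j = 0.
Proof.
rewrite /cov2 (eq_gam _ _ (V := g j)) => [|m]; last exact: gC.
rewrite !gam_g (gC j i).
have {1}-> : d a (g i j) = half * 2 * d a (g i j) by rewrite half2 mul1r.
ring.
Qed.

Lemma d_g a i j : d a (g i j) = gam a i (fun m => g m j) + gam a j (fun m => g i m).
Proof. by move/eqP: (cov_g a i j); rewrite /cov2 -addrA -opprD subr_eq0 => /eqP. Qed.

Lemma d_gi a p q : d a (gi p q) =
  - \sum_m (Gam p a m * gi m q + Gam q a m * gi p m).
Proof.
move: q; apply: g_inj => l.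
have E : \sum_m g l m * d a (gi p m) = - \sum_m gi p m * d a (g m l).
  apply/eqP; rewrite -subr_eq0 opprK -big_split /=; apply/eqP.
  transitivity (d a (\sum_m gi p m * g m l)); last by rewrite gig d_nat.
  by rewrite d_sum; apply: eq_bigr => m _; rewrite dM (gC l); ring.
rewrite {}E.
under eq_bigr do rewrite d_g mulrDr.
under [in RHS]eq_bigr do rewrite mulrN.
rewrite sumrN; congr (- _).
under [in RHS]eq_bigr do rewrite big_split /= mulrDr.
rewrite !big_split /= addrC; congr (_ + _).
- transitivity (Gam p a l).
    rewrite -[RHS](sum_delta p (fun k => Gam k a l)).
    under eq_bigr do rewrite mulr_sumr.
    rewrite exchange_big /=; apply: eq_bigr => k _.
    rewrite eq_sym -gig mulr_suml; apply: eq_bigr => m _; ring.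
  rewrite -[LHS](sum_delta l).
  under [RHS]eq_bigr do rewrite mulr_sumr.
  rewrite exchange_big /=; apply: eq_bigr => k _.
  rewrite -gig mulr_suml; apply: eq_bigr => m _.
  by rewrite (gC l); ring.
- under eq_bigr do rewrite mulr_sumr.
  rewrite exchange_big /=; apply: eq_bigr => k _; rewrite mulr_sumr.
  by apply: eq_bigr => m _; rewrite (gC l); ring.
Qed.

(** Covariant differentiation commutes with contraction: the derivative of the inverse
    metric provides exactly the connection terms of the two contracted indices. The
    versions for tensors with further indices follow by linearity. *)
Lemma d_ct a F : d a (ct F) =
  ct (fun p q => d a (F p q) - gam a p (fun m => F m q) - gam a q (F p)).
Proof.
rewrite !ctB /contr d_sum.
under eq_bigr do rewrite d_sum.
under eq_bigr do under eq_bigr do rewrite dM d_gi mulNr addrC.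
under eq_bigr do rewrite sumrB.
rewrite sumrB -addrA -opprD; congr (_ - _).
under eq_bigr do under eq_bigr do rewrite big_split /= mulrDl.
under eq_bigr do rewrite big_split /=.
rewrite big_split /=; congr (_ + _).
- rewrite exchange_big [RHS]exchange_big; apply: eq_bigr => q _ /=.
  under [RHS]eq_bigr do rewrite mulr_sumr.
  rewrite exchange_big; apply: eq_bigr => p _ /=; rewrite mulr_suml.
  by apply: eq_bigr => m _; ring.
- apply: eq_bigr => p _ /=.
  under [RHS]eq_bigr do rewrite mulr_sumr.
  rewrite exchange_big; apply: eq_bigr => q _ /=; rewrite mulr_suml.
  by apply: eq_bigr => m _; ring.
Qed.


(** * Curvature, Ricci and Bianchi identities *)

(** $R^l{}_{ijk}$, with the sign for which $R_{ijij} > 0$ on round spheres. *)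
Definition curv l i j k := d j (Gam l i k) - d i (Gam l j k)
  + \sum_m (Gam l j m * Gam m i k - Gam l i m * Gam m j k).
Definition Rm i j k l := \sum_m g l m * curv m i j k.
(** The curvature acting on one covariant index; $[\nabla_a, \nabla_b]$ is the sum of
    these actions over the indices of the tensor. *)
Definition curv_act a b i (X : T1) := \sum_m curv m a b i * X m.
Definition dgam c b i (X : T1) := \sum_m d c (Gam m b i) * X m.

Lemma d_gam a b i X :
  d a (gam b i X) = gam b i (fun m => d a (X m)) + dgam a b i X.
Proof.
by rewrite d_sum -big_split /=; apply: eq_bigr => m _; rewrite dM addrC.
Qed.

Lemma curv_actE a b i X : curv_act a b i X =
  dgam b a i X - dgam a b i X
  + gam a i (fun m => gam b m X) - gam b i (fun m => gam a m X).
Proof.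
have gg c e : gam c i (fun m => gam e m X)
    = \sum_m (\sum_q Gam m e q * Gam q c i) * X m.
  rewrite /gam; under eq_bigr do rewrite mulr_sumr.
  rewrite exchange_big; apply: eq_bigr => m _ /=; rewrite mulr_suml.
  by apply: eq_bigr => q _; ring.
rewrite !gg /dgam -!sumrB -big_split -sumrB /=; apply: eq_bigr => m _.
by rewrite /curv sumrB; ring.
Qed.

(** The connection terms of the index of the first derivative cancel because there is no
    torsion. In higher rank there are also cross terms between different indices,
    which cancel by [gam_gam]. *)
Lemma ricci_id1 X a b i :
  cov2 (cov1 X) a b i - cov2 (cov1 X) b a i = curv_act a b i X.
Proof.
rewrite /cov2 /cov1 !dB !d_gam !gamB curv_actE !(gamC b a) (dC b a); ring.
Qed.

Lemma ricci_id2 T a b i j :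
  cov3 (cov2 T) a b i j - cov3 (cov2 T) b a i j
  = curv_act a b i (fun m => T m j) + curv_act a b j (T i).
Proof.
rewrite /cov3 /cov2 !dB !d_gam !gamB !curv_actE !(gamC b a) (dC b a).
rewrite (gam_gam b i a j) (gam_gam b j a i (fun k m => T m k)).
ring.
Qed.

Lemma ricci_id3 T a b i j k :
  cov4 (cov3 T) a b i j k - cov4 (cov3 T) b a i j k
  = curv_act a b i (fun m => T m j k) + curv_act a b j (fun m => T i m k)
    + curv_act a b k (T i j).
Proof.
rewrite /cov4 /cov3 !dB !d_gam !gamB !curv_actE !(gamC b a) (dC b a).
rewrite (gam_gam b i a j) (gam_gam b j a i (fun l m => T m l k)).
rewrite (gam_gam b i a k) (gam_gam b k a i (fun l m => T m j l)).
rewrite (gam_gam b j a k) (gam_gam b k a j (fun l m => T i m l)).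
ring.
Qed.

Lemma Rm_op a b i l : Rm a b i l = curv_act a b i (g l).
Proof. by apply: eq_bigr => m _; rewrite mulrC. Qed.

Lemma curv_act_ct a b i X : curv_act a b i X = ct (fun p q => Rm a b i p * X q).
Proof.
transitivity (ct (fun p q => \sum_m g m p * (curv m a b i * X q))).
  rewrite ct_sum; apply: eq_bigr => m _.
  by rewrite (ct_gl m (fun q => curv m a b i * X q)).
apply: eq_ct => p q; rewrite /Rm mulr_suml; apply: eq_bigr => m _.
by rewrite (gC m) mulrA.
Qed.

Lemma RmN12 i j k l : Rm j i k l = - Rm i j k l.
Proof.
rewrite /Rm -sumrN; apply: eq_bigr => m _; rewrite /curv !sumrB; ring.
Qed.

(** The Ricci identity for the metric, whose covariant derivative vanishes. *)
Lemma RmN34 i j k l : Rm i j l k = - Rm i j k l.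
Proof.
apply/eqP; rewrite -addr_eq0 !Rm_op; apply/eqP.
have E : forall a b c, cov2 g a b c = 0 := cov_g.
have Z a (T : T3) : (forall b c e, T b c e = 0) -> forall b c e, cov3 T a b c e = 0.
  move=> T0 b c e; rewrite /cov3 T0 d0 /gam.
  by rewrite !big1 ?subr0 // => m _; rewrite T0 mulr0.
transitivity (cov3 (cov2 g) i j l k - cov3 (cov2 g) j i l k).
  by rewrite ricci_id2; congr (_ + _); apply: eq_bigr => m _; rewrite gC.
by rewrite !Z // subrr.
Qed.

Lemma bianchi1 i j k l : Rm i j k l + Rm j k i l + Rm k i j l = 0.
Proof.
rewrite /Rm -!big_split /= big1 // => m _.
rewrite -!mulrDr (_ : _ + _ = 0) ?mulr0 // /curv !sumrB.
have E a b c : \sum_q Gam m a q * Gam q b c = \sum_q Gam m a q * Gam q c b.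
  by apply: eq_bigr => q _; rewrite (GamC q b).
rewrite (GamC m j i) (GamC m k j) (GamC m k i) (E j k) (E i k) (E k j).
ring.
Qed.

Lemma half_inj (x y : A) : x *+ 2 = y *+ 2 -> x = y.
Proof.
move=> E; have F z : z = half * (z *+ 2).
  by rewrite -[LHS]mul1r -half2 -mulr_natr; ring.
by rewrite [x]F E -F.
Qed.

(** A signed sum of the four Bianchi identities that differ in the last index. *)
Lemma RmC i j k l : Rm k l i j = Rm i j k l.
Proof.
apply: half_inj; apply/eqP; rewrite -subr_eq0; apply/eqP.
have e1 := bianchi1 k i j l; have e2 := bianchi1 i j l k.
have e3 := bianchi1 j l k i; have e4 := bianchi1 l k i j.
have -> : Rm k l i j *+ 2 - Rm i j k l *+ 2 =
  - ((Rm k i j l + Rm i j k l + Rm j k i l)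
   - (Rm i j l k + Rm j l i k + Rm l i j k)
   - (Rm j l k i + Rm l k j i + Rm k j l i)
   + (Rm l k i j + Rm k i l j + Rm i l k j)).
  rewrite (RmN34 k i j l) (RmN34 i j k l) (RmN12 k l i j) (RmN12 k l j i).
  rewrite (RmN34 k l i j) (RmN12 j k l i) (RmN34 j k i l) (RmN34 j l i k).
  rewrite (RmN12 l i k j) (RmN34 l i j k).
  ring.
by rewrite e1 e2 e3 e4 !(subr0, addr0, oppr0).
Qed.

Lemma eq_cov1 X V a i : (forall i, X i = V i) -> cov1 X a i = cov1 V a i.
Proof. by move=> E; rewrite /cov1 E; congr (_ - _); apply: eq_gam. Qed.
Lemma eq_cov2 X V a i j : (forall i j, X i j = V i j) ->
  cov2 X a i j = cov2 V a i j.
Proof.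
by move=> E; rewrite /cov2 E; congr (_ - _ - _); apply: eq_gam.
Qed.
Lemma eq_cov3 X V a i j k : (forall i j k, X i j k = V i j k) ->
  cov3 X a i j k = cov3 V a i j k.
Proof.
by move=> E; rewrite /cov3 E; congr (_ - _ - _ - _); apply: eq_gam.
Qed.
Lemma eq_cov4 X V a i j k l : (forall i j k l, X i j k l = V i j k l) ->
  cov4 X a i j k l = cov4 V a i j k l.
Proof.
by move=> E; rewrite /cov4 E; congr (_ - _ - _ - _ - _); apply: eq_gam.
Qed.

Lemma cov2D X V a i j : cov2 (fun i j => X i j + V i j) a i j
  = cov2 X a i j + cov2 V a i j.
Proof. by rewrite /cov2 dD !gamD; ring. Qed.
Lemma cov2B X V a i j : cov2 (fun i j => X i j - V i j) a i j
  = cov2 X a i j - cov2 V a i j.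
Proof. by rewrite /cov2 dB !gamB; ring. Qed.
Lemma cov3B X V a i j k : cov3 (fun i j k => X i j k - V i j k) a i j k
  = cov3 X a i j k - cov3 V a i j k.
Proof. by rewrite /cov3 dB !gamB; ring. Qed.
Lemma cov4D X V a i j k l : cov4 (fun i j k l => X i j k l + V i j k l) a i j k l
  = cov4 X a i j k l + cov4 V a i j k l.
Proof. by rewrite /cov4 dD !gamD; ring. Qed.
Lemma cov4B X V a i j k l : cov4 (fun i j k l => X i j k l - V i j k l) a i j k l
  = cov4 X a i j k l - cov4 V a i j k l.
Proof. by rewrite /cov4 dB !gamB; ring. Qed.

Lemma cov3_ctM (T : T4) (X : T1) a i j k :
  cov3 (fun i j k => ct (fun p q => T i j k p * X q)) a i j k =
  ct (fun p q => cov4 T a i j k p * X q) + ct (fun p q => T i j k p * cov1 X a q).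
Proof.
rewrite -ctD /cov3 d_ct !gam_ct -!ctB; apply: eq_ct => p q.
by rewrite /cov4 /cov1 dM !gamZl !gamZr; ring.
Qed.

(** For any covector field $X$, the cyclic sum of
    $[\nabla_a, \nabla_b] \nabla_c X_k$ equals that of
    $\nabla_a [\nabla_b, \nabla_c] X_k$. Evaluating both by Ricci identities, the terms
    with $\nabla X$ cancel, by the first Bianchi identity or pairwise, and the cyclic sum
    of $\nabla \mathrm{Rm}$ applied to $X$ remains. *)
Lemma bianchi2 a b c k l :
  cov4 Rm a b c k l + cov4 Rm b c a k l + cov4 Rm c a b k l = 0.
Proof.
move: l; apply: (ct_inj (F := fun l => _ + _ + _)) => X.
pose N := cov2 (cov1 X).
have S a' b' c' : ct (fun p q => cov4 Rm a' b' c' k p * X q) =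
    cov3 N a' b' c' k - cov3 N a' c' b' k
    - ct (fun p q => Rm b' c' k p * cov1 X a' q).
  apply/esym/eqP; rewrite subr_eq; apply/eqP.
  rewrite -cov3_ctM.
  transitivity (cov3 (fun b c k => N b c k - N c b k) a' b' c' k).
    by rewrite /cov3 !dB !gamB; ring.
  by apply: eq_cov3 => *; rewrite /N ricci_id1 curv_act_ct.
have L a' b' c' : ct (fun p q => Rm a' b' c' p * cov1 X q k) =
    cov3 N a' b' c' k - cov3 N b' a' c' k
    - ct (fun p q => Rm a' b' k p * cov1 X c' q).
  by rewrite ricci_id2 !curv_act_ct addrK.
have : ct (fun p q => Rm a b c p * cov1 X q k)
       + ct (fun p q => Rm b c a p * cov1 X q k)
       + ct (fun p q => Rm c a b p * cov1 X q k) = 0.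
  rewrite -!ctD -[RHS](ct0 gi); apply: eq_ct => p q.
  by rewrite -!mulrDl bianchi1 mul0r.
move=> Z; transitivity (ct (fun p q => cov4 Rm a b c k p * X q)
  + ct (fun p q => cov4 Rm b c a k p * X q)
  + ct (fun p q => cov4 Rm c a b k p * X q)).
  by rewrite -!ctD; apply: eq_ct => p q; rewrite -!mulrDl.
by rewrite !S -Z !L; ring.
Qed.

Definition Ric i k := ct (fun j l => Rm i j k l).
Definition Scal := ct Ric.

Lemma RicC i k : Ric i k = Ric k i.
Proof. by rewrite /Ric ctC; apply: eq_ct => p q; rewrite RmC. Qed.

Lemma cov2_C (T : T2) a i j : (forall i j, T i j = T j i) ->
  cov2 T a i j = cov2 T a j i.
Proof.
move=> TC; rewrite (eq_cov2 _ _ _ (V := fun i j => T j i)) // /cov2; ring.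
Qed.

Lemma covRmN12 a i j k l : cov4 Rm a j i k l = - cov4 Rm a i j k l.
Proof.
rewrite (eq_cov4 _ _ _ _ _ (V := fun j i k l => - Rm i j k l)).
  by rewrite /cov4 dN !gamN; ring.
by move=> *; exact: RmN12.
Qed.

Lemma covRmN34 a i j k l : cov4 Rm a i j l k = - cov4 Rm a i j k l.
Proof.
rewrite (eq_cov4 _ _ _ _ _ (V := fun i j l k => - Rm i j k l)).
  by rewrite /cov4 dN !gamN; ring.
by move=> *; exact: RmN34.
Qed.

Lemma covRmC a i j k l : cov4 Rm a k l i j = cov4 Rm a i j k l.
Proof.
rewrite (eq_cov4 _ _ _ _ _ (V := fun k l i j => Rm i j k l)).
  by rewrite /cov4; ring.
by move=> *; exact: RmC.
Qed.

Lemma cov_Ric a i k : cov2 Ric a i k = ct (fun j l => cov4 Rm a i j k l).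
Proof.
rewrite /cov2 d_ct !gam_ct -!ctB; apply: eq_ct => p q; rewrite /cov4; ring.
Qed.

Lemma d_Scal a : d a Scal = ct (cov2 Ric a).
Proof. by rewrite d_ct. Qed.

(** Contracted second Bianchi identity. *)
Lemma div_Rm i j k : ct (fun a l => cov4 Rm a i j k l) =
  cov2 Ric j i k - cov2 Ric i j k.
Proof.
rewrite !cov_Ric -ctB; apply: eq_ct => a l.
have /eqP := bianchi2 a i j k l; rewrite -addrA addr_eq0 => /eqP ->.
by rewrite (covRmN12 j i a); ring.
Qed.

(** A second contraction. The trace of the divergence of the curvature is computed in
    two ways, which gives twice the divergence of Ricci as $\nabla R$. *)
Lemma div_Ric k : ct (fun a i => cov2 Ric a i k) = half * d k Scal.
Proof.
have E : ct (fun a i => cov2 Ric a i k) = d k Scal - ct (fun a i => cov2 Ric a i k).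
  transitivity (ct (fun a l => ct (fun i m => cov4 Rm a i k m l))).
    apply: eq_ct => a l; rewrite cov2_C ?cov_Ric; last exact: RicC.
    by apply: eq_ct => i m; rewrite covRmN12 covRmN34 opprK.
  rewrite ct_ct d_Scal -ctB; apply: eq_ct => i m.
  by rewrite div_Rm (cov2_C i k m RicC).
rewrite -[LHS]mul1r -half2 -mulrA; congr (_ * _).
by rewrite mulr2n mulrDl !mul1r {1}E subrK.
Qed.

Lemma cov1_ct (T : T3) a k :
  cov1 (fun k => ct (fun p q => T p q k)) a k = ct (fun p q => cov3 T a p q k).
Proof.
rewrite /cov1 d_ct !gam_ct -!ctB; apply: eq_ct => p q; rewrite /cov3; ring.
Qed.

Lemma cov2_ct (T : T4) a i j :
  cov2 (fun i j => ct (fun p q => T p q i j)) a i j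
  = ct (fun p q => cov4 T a p q i j).
Proof.
rewrite /cov2 d_ct !gam_ct -!ctB; apply: eq_ct => p q; rewrite /cov4; ring.
Qed.

Definition lap2 (S : T2) i j := ct (fun a b => cov3 (cov2 S) a b i j).
Definition lap3 (T : T3) i j k := ct (fun a b => cov4 (cov3 T) a b i j k).

Lemma cov4_ctMl (S : T2) a b k i j :
  cov4 (fun b k i j => ct (fun p q => Rm b k i p * S q j)) a b k i j =
  ct (fun p q => cov4 Rm a b k i p * S q j)
  + ct (fun p q => Rm b k i p * cov2 S a q j).
Proof.
rewrite -ctD {1}/cov4 d_ct !gam_ct -!ctB; apply: eq_ct => p q.
by rewrite /cov4 /cov2 dM !gamZl !gamZr; ring.
Qed.

Lemma cov4_ctMr (S : T2) a b k i j :
  cov4 (fun b k i j => ct (fun p q => Rm b k j p * S i q)) a b k i j =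
  ct (fun p q => cov4 Rm a b k j p * S i q)
  + ct (fun p q => Rm b k j p * cov2 S a i q).
Proof.
rewrite -ctD {1}/cov4 d_ct !gam_ct -!ctB; apply: eq_ct => p q.
by rewrite /cov4 /cov2 dM !gamZl !gamZr; ring.
Qed.

(** $\nabla_k \nabla_a \nabla_a S - \nabla_a \nabla_a \nabla_k S$ is the commutator
    $[\nabla_k, \nabla_a]$ on the rank 3 tensor $\nabla_a S$ plus $\nabla_a$ of the
    commutator on $S$. Contraction over $a$ turns the first slot of the former into
    Ricci and the divergence of the curvature in the latter into $\nabla\mathrm{Ric}$. *)
Lemma comm_lap2 (S : T2) k i j :
  cov2 (lap2 S) k i j - lap3 (fun k i j => cov2 S k i j) k i j =
  - ct (fun p q => Ric k p * cov2 S q i j)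
  + ct (fun a b => ct (fun p q => Rm k a i p * cov2 S b q j)) *+ 2
  + ct (fun a b => ct (fun p q => Rm k a j p * cov2 S b i q)) *+ 2
  + ct (fun p q => (cov2 Ric p i k - cov2 Ric i p k) * S q j)
  + ct (fun p q => (cov2 Ric p j k - cov2 Ric j p k) * S i q).
Proof.
rewrite cov2_ct.
have H a b : cov4 (cov3 (cov2 S)) k a b i j =
    cov4 (cov3 (cov2 S)) a b k i j
    + (curv_act k a b (fun m => cov2 S m i j) + curv_act k a i (fun m => cov2 S b m j)
       + curv_act k a j (cov2 S b i))
    + (cov4 (fun k b i j => ct (fun p q => Rm k b i p * S q j)) a k b i j
       + cov4 (fun k b i j => ct (fun p q => Rm k b j p * S i q)) a k b i j).
  rewrite -(ricci_id3 (cov2 S)).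
  have <- : cov4 (cov3 (cov2 S)) a k b i j - cov4 (cov3 (cov2 S)) a b k i j =
     cov4 (fun k b i j => ct (fun p q => Rm k b i p * S q j)) a k b i j
     + cov4 (fun k b i j => ct (fun p q => Rm k b j p * S i q)) a k b i j.
    transitivity (cov4 (fun k b i j =>
       cov3 (cov2 S) k b i j - cov3 (cov2 S) b k i j) a k b i j).
      rewrite (cov4B (cov3 (cov2 S)) (fun k b i j => cov3 (cov2 S) b k i j)).
      by congr (_ - _); rewrite /cov4; ring.
    rewrite -(cov4D (fun k b i j => ct (fun p q => Rm k b i p * S q j))
       (fun k b i j => ct (fun p q => Rm k b j p * S i q))).
    by apply: eq_cov4 => *; rewrite ricci_id2 !curv_act_ct.
  ring.
have E : ct (fun p q => cov4 (cov3 (cov2 S)) k p q i j) =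
   lap3 (cov2 S) k i j
  + ct (fun a b => ct (fun p q => Rm k a b p * cov2 S q i j))
  + (ct (fun a b => ct (fun p q => Rm k a i p * cov2 S b q j))
     + ct (fun a b => ct (fun p q => Rm k b i p * cov2 S a q j)))
  + (ct (fun a b => ct (fun p q => Rm k a j p * cov2 S b i q))
     + ct (fun a b => ct (fun p q => Rm k b j p * cov2 S a i q)))
  + ct (fun a b => ct (fun p q => cov4 Rm a k b i p * S q j))
  + ct (fun a b => ct (fun p q => cov4 Rm a k b j p * S i q)).
  rewrite /lap3 -!ctD; apply: eq_ct => a b.
  by rewrite H cov4_ctMl cov4_ctMr !curv_act_ct; ring.
have F1 : ct (fun a b => ct (fun p q => Rm k a b p * cov2 S q i j)) =
  - ct (fun p q => Ric k p * cov2 S q i j).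
  rewrite ct_ct -ctN; apply: eq_ct => p q; rewrite ctZr -mulNr; congr (_ * _).
  by rewrite -ctN; apply: eq_ct => a b; rewrite RmN34.
have F2 i' : forall T : T1,
  ct (fun a b => ct (fun p q => cov4 Rm a k b i' p * T q)) =
  ct (fun p q => (cov2 Ric p i' k - cov2 Ric i' p k) * T q).
  move=> T; rewrite ct_ct; apply: eq_ct => p q; rewrite ctZr; congr (_ * _).
  by rewrite -div_Rm; apply: eq_ct => a b; rewrite covRmC.
rewrite {}E F1 !F2 (ctC (fun a b => ct (fun p q => Rm k b i p * cov2 S a q j))).
by rewrite (ctC (fun a b => ct (fun p q => Rm k b j p * cov2 S a i q))); ring.
Qed.


(** * Evolution of the connection and of the curvature *)
Variable dt : A -> A.
Hypothesis dtD : forall x y, dt (x + y) = dt x + dt y.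
Hypothesis dtM : forall x y, dt (x * y) = dt x * y + x * dt y.
Hypothesis dtC : forall a x, dt (d a x) = d a (dt x).
Hypothesis flow : forall i j, dt (g i j) = - (2 * Ric i j).

Let dtB := drvB dtD.
Let dt_sum := drv_sum dtD.
Let dt_nat := drv_nat dtD dtM.

Lemma dt_gi p q : dt (gi p q) =
  2 * \sum_a \sum_b gi p a * gi q b * Ric a b.
Proof.
move: q; apply: g_inj => l.
have -> : \sum_m g l m * dt (gi p m) = - \sum_m gi p m * dt (g m l).
  apply/eqP; rewrite -subr_eq0 opprK -big_split /=; apply/eqP.
  transitivity (dt (\sum_m gi p m * g m l)); last by rewrite gig dt_nat.
  by rewrite dt_sum; apply: eq_bigr => m _; rewrite dtM (gC l); ring.
transitivity (2 * \sum_a gi p a * Ric a l).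
  by rewrite -sumrN mulr_sumr; apply: eq_bigr => m _; rewrite flow; ring.
rewrite -[\sum_a _](sum_delta l (fun l => \sum_a gi p a * Ric a l)).
under [RHS]eq_bigr do rewrite mulrCA mulr_sumr.
rewrite -mulr_sumr; congr (_ * _).
under eq_bigr do rewrite mulr_sumr.
rewrite exchange_big [RHS]exchange_big; apply: eq_bigr => a _ /=.
under [RHS]eq_bigr do rewrite mulr_sumr.
rewrite exchange_big; apply: eq_bigr => b _ /=.
rewrite -gig mulr_suml; apply: eq_bigr => m _.
by rewrite (gC l) (giC b); ring.
Qed.

Lemma dt_ct F : dt (ct F) = ct (fun p q => dt (F p q)) + 2 * dot2 F Ric.
Proof.
rewrite /contr dt_sum.
under eq_bigr do rewrite dt_sum.
under eq_bigr do under eq_bigr do rewrite dtM dt_gi addrC.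
under eq_bigr do rewrite big_split.
rewrite big_split; congr (_ + _).
rewrite /pair2 /contr mulr_sumr; apply: eq_bigr => p _.
transitivity (\sum_a \sum_q \sum_b 2 * (gi p a * (gi q b * (F p q * Ric a b)))).
  rewrite [RHS]exchange_big; apply: eq_bigr => q _ /=.
  rewrite mulr_sumr mulr_suml; apply: eq_bigr => a _.
  by rewrite mulr_sumr mulr_suml; apply: eq_bigr => b _; ring.
rewrite mulr_sumr; apply: eq_bigr => a _; rewrite !mulr_sumr.
by apply: eq_bigr => q _; rewrite !mulr_sumr.
Qed.

(** $g_{lm} \partial_t \Gamma^m_{ij}$ under the flow, see [g_dtGam]. *)
Definition dGam l i j := cov2 Ric l i j - cov2 Ric i j l - cov2 Ric j i l.

(** Differentiate [g_Gam] in time. The connection terms that turn partial derivatives of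
    Ricci into covariant ones cancel against the derivative of the metric. *)
Lemma g_dtGam l i j : \sum_m g l m * dt (Gam m i j) = dGam l i j.
Proof.
have := congr1 dt (g_Gam l i j).
rewrite dt_sum dtM (drv_inv_nat dtD dtM half2) mul0r add0r dtB dtD !dtC !flow.
under eq_bigr do rewrite dtM flow.
rewrite big_split /= !dN !dM !d_nat => /(canRL (addKr _)) ->.
have -> : \sum_m - (2 * Ric l m) * Gam m i j = - (2 * gam i j (Ric l)).
  by rewrite -mulNr mulr_sumr; apply: eq_bigr => m _; ring.
have H x : half * (2 * x) = x by rewrite mulrA half2 mul1r.
rewrite -[RHS]H /dGam /cov2.
have RG a b c : gam a b (fun m => Ric m c) = gam a b (Ric c).
  by apply: eq_gam => m; rewrite RicC.
rewrite !RG (gamC j i) (gamC l i) (gamC l j) (RicC j l) (RicC i l).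
by rewrite -[2 * gam i j (Ric l)]H; ring.
Qed.

Lemma dtGam_ct i j (X : T1) :
  \sum_m dt (Gam m i j) * X m = dot (fun p => dGam p i j) X.
Proof.
rewrite -(ct_low (fun m => dt (Gam m i j)) X) /pair1.
by apply: eq_ct => p q; rewrite g_dtGam.
Qed.

Lemma dGamC l i j : dGam l i j = dGam l j i.
Proof. by rewrite /dGam (cov2_C l i j RicC); ring. Qed.

Lemma dt_cov2 (T : T2) k i j : dt (cov2 T k i j) =
  cov2 (fun i j => dt (T i j)) k i j
  - dot (fun p => dGam p k i) (fun q => T q j) - dot (fun p => dGam p k j) (T i).
Proof.
have E i' X : dt (gam k i' X) =
    gam k i' (fun m => dt (X m)) + dot (fun p => dGam p k i') X.
  rewrite -dtGam_ct dt_sum -big_split /=; apply: eq_bigr => m _.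
  by rewrite dtM addrC.
by rewrite /cov2 !dtB !E dtC; ring.
Qed.

Lemma Ric_curv i k : Ric i k = \sum_j curv j i j k.
Proof.
rewrite /Ric /contr; apply: eq_bigr => j _.
under eq_bigr do rewrite mulr_sumr.
rewrite exchange_big -[RHS](sum_delta j (fun m => curv m i j k)) /=.
apply: eq_bigr => m _; rewrite eq_sym -gig mulr_suml; apply: eq_bigr => l _.
ring.
Qed.

(** Lowering an index commutes with covariant differentiation, for the tensor
    $X^l_{ik}$ of type (1, 2). *)
Lemma cov3_low (X : T3) (T : T3) j q i k :
  (forall q i k, T q i k = \sum_l g q l * X l i k) ->
  cov3 T j q i k =
  \sum_l g q l * (d j (X l i k) + \sum_m Gam l j m * X m i k
                   - \sum_m Gam m j k * X l i m) - gam j i (fun m => T q m k).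
Proof.
move=> E; rewrite /cov3 E d_sum.
under eq_bigr do rewrite dM d_g mulrDl.
under [in RHS]eq_bigr do rewrite mulrBr mulrDr.
rewrite !big_split /= sumrN.
have -> : \sum_l gam j q (fun m => g m l) * X l i k = gam j q (fun m => T m i k).
  rewrite /gam; under [RHS]eq_bigr do rewrite E mulr_sumr.
  rewrite exchange_big; apply: eq_bigr => l _; rewrite mulr_suml.
  by apply: eq_bigr => m _; ring.
have -> : \sum_l gam j l (g q) * X l i k =
    \sum_l g q l * \sum_m Gam l j m * X m i k.
  rewrite /gam; under [RHS]eq_bigr do rewrite mulr_sumr.
  rewrite exchange_big; apply: eq_bigr => l _; rewrite mulr_suml.
  by apply: eq_bigr => m _; ring.
have -> : gam j k (T q i) = \sum_l g q l * \sum_m Gam m j k * X l i m.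
  rewrite /gam; under eq_bigr do rewrite E mulr_sumr.
  rewrite exchange_big; apply: eq_bigr => l _; rewrite mulr_sumr.
  by apply: eq_bigr => m _; ring.
ring.
Qed.

(** The Palatini identity: $\partial_t R^l{}_{ijk}$ is the antisymmetrized covariant
    derivative of $\partial_t \Gamma$. *)
Lemma low_dt_curv q i j k :
  \sum_l g q l * dt (curv l i j k) = cov3 dGam j q i k - cov3 dGam i q j k.
Proof.
have E q' i' k' : dGam q' i' k' = \sum_l g q' l * dt (Gam l i' k') by rewrite g_dtGam.
have K (x y z : A) : (x - z) - (y - z) = x - y by ring.
rewrite !(cov3_low _ _ _ _ E) (gamC i j) K -sumrB.
apply: eq_bigr => l _; rewrite -mulrBr; congr (_ * _).
rewrite /curv dtD dtB !dtC dt_sum.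
under eq_bigr do rewrite dtB !(dtM (Gam _ _ _)).
rewrite sumrB !big_split /=.
have M a b c : \sum_m dt (Gam l a m) * Gam m b c = \sum_m Gam m b c * dt (Gam l a m).
  by apply: eq_bigr => m _; rewrite mulrC.
rewrite !M; ring.
Qed.

Lemma dt_Ric_dGam i k : dt (Ric i k) = ct (fun j q => cov3 dGam j q i k - cov3 dGam i q j k).
Proof.
rewrite Ric_curv dt_sum /contr; apply: eq_bigr => j _.
under eq_bigr do rewrite -low_dt_curv mulr_sumr.
rewrite exchange_big -[LHS](sum_delta j (fun m => dt (curv m i j k))) /=.
apply: eq_bigr => m _; rewrite eq_sym -gig mulr_suml; apply: eq_bigr => l _.
ring.
Qed.

Lemma cov3_dGam a l i j : cov3 dGam a l i j =
  cov3 (cov2 Ric) a l i j - cov3 (cov2 Ric) a i j l - cov3 (cov2 Ric) a j i l.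
Proof.
rewrite cov3B (cov3B (cov2 Ric) (fun l i j => cov2 Ric i j l)).
rewrite /cov3; ring.
Qed.

Definition lap0 f := ct (fun a b => cov1 (fun b => d b f) a b).

Lemma hessC f a b : cov1 (fun b => d b f) a b = cov1 (fun b => d b f) b a.
Proof. by rewrite /cov1 dC gamC. Qed.

Lemma d_half a : d a half = 0. Proof. exact: (drv_inv_nat (dD a) (dM a) half2). Qed.

Lemma cov3_cov2C (T : T2) a b i j : (forall i j, T i j = T j i) ->
  cov3 (cov2 T) a b i j = cov3 (cov2 T) a b j i.
Proof.
move=> TC; rewrite (eq_cov3 _ _ _ _ (V := fun b i j => cov2 T b j i)).
  by rewrite /cov3; ring.
by move=> *; apply: cov2_C.
Qed.

Lemma RmRicC i k :
  dot2 (fun p q => Rm k p i q) Ric = dot2 (fun p q => Rm i p k q) Ric.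
Proof.
rewrite dot2T; apply: eq_ct => p q; apply: eq_ct => l m.
by rewrite RmC (RicC m).
Qed.

(** Of the six second derivatives of Ricci in the Palatini formula, one is the Laplacian,
    one is the Hessian of $R$, and two cancel. Commuting derivatives in the other two
    brings out the divergence of Ricci, hence half the Hessian of $R$ each. *)
Lemma dt_Ric i k : dt (Ric i k) =
  lap2 Ric i k + 2 * dot2 (fun p q => Rm i p k q) Ric - 2 * dot (Ric i) (Ric k).
Proof.
pose N := cov3 (cov2 Ric); pose h i k := cov1 (fun k => d k Scal) i k.
have H j q i' k' : N j i' k' q = N i' j k' q + curv_act j i' k' (Ric q) + curv_act j i' q (Ric k').
  rewrite /N; have /(canRL (subrK _)) -> := ricci_id2 Ric j i' k' q.
  rewrite /curv_act (eq_bigr (fun m => curv m j i' k' * Ric q m)) => [|m _]; last by rewrite (RicC q).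
  by rewrite addrC addrA.
have D i' k' : ct (fun j q => N i' j k' q) = half * h i' k'.
  transitivity (cov1 (fun k => half * d k Scal) i' k'); last first.
    by rewrite /h /cov1 dM d_half gamZl; ring.
  rewrite -(eq_cov1 _ _ div_Ric) cov1_ct; apply: eq_ct => a b.
  exact: (cov3_cov2C _ _ _ _ RicC).
have T1 : ct (fun j q => N i q j k) = half * h i k.
  rewrite ctC -D; apply: eq_ct => j q; exact: (cov3_cov2C _ _ _ _ RicC).
have T2 : ct (fun j q => N i k j q) = h i k.
  rewrite /h (eq_cov1 _ _ d_Scal) /cov1 d_ct !gam_ct -!ctB.
  by apply: eq_ct => p q; rewrite /N /cov3; ring.
have T3 i' k' : ct (fun j q => N j i' k' q) =
    half * h i' k' - dot2 (fun p q => Rm i' p k' q) Ric + dot (Ric i') (Ric k').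
  rewrite -D; under eq_ct do rewrite H.
  rewrite !ctD; congr (_ + _ + _); rewrite /pair2 /pair1.
    rewrite -ctN; apply: eq_ct => j q; rewrite curv_act_ct -ctN; apply: eq_ct => a b.
    by rewrite RmN12; ring.
  under eq_ct do rewrite curv_act_ct.
  rewrite ct_ct; apply: eq_ct => a b; rewrite ctZr; congr (_ * _).
  by apply: eq_ct => j q; rewrite RmN12 RmN34 opprK.
rewrite dt_Ric_dGam.
transitivity (lap2 Ric i k - ct (fun j q => N j i k q) - ct (fun j q => N j k i q)
  - ct (fun j q => N i q j k) + ct (fun j q => N i j k q) + ct (fun j q => N i k j q)).
  by rewrite -!ctB -!ctD; apply: eq_ct => j q; rewrite !cov3_dGam -/N; ring.
rewrite T1 D T2 !T3 RmRicC (dotC (Ric k)) /h (hessC Scal k).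
have S x : half * x + half * x = x by rewrite -mulrDl -mulr2n -mulr_natr half2 mul1r.
rewrite -[X in _ + X = _]S; ring.
Qed.

Definition nRic := dot2 Ric Ric.

Lemma lap0_Scal : ct (fun i k => lap2 Ric i k) = lap0 Scal.
Proof.
rewrite ct_ct; apply: eq_ct => a b; rewrite (eq_cov1 _ _ d_Scal) /cov1 d_ct !gam_ct -!ctB.
by apply: eq_ct => p q; rewrite /cov3; ring.
Qed.

Lemma dt_Scal : dt Scal = lap0 Scal + 2 * nRic.
Proof.
rewrite dt_ct -lap0_Scal -/nRic; congr (_ + _).
have E1 : ct (fun i k => dot2 (fun p q => Rm i p k q) Ric) = nRic.
  rewrite ct_ct; apply: eq_ct => p q.
  rewrite ct_ct; apply: eq_ct => l m; rewrite ctZr; congr (_ * _).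
  by apply: eq_ct => i k; rewrite RmN12 RmN34 opprK.
have E2 : ct (fun i k => dot (Ric i) (Ric k)) = nRic.
  rewrite /nRic /pair2; apply: eq_ct => p q; apply: eq_ct => l m; by [].
transitivity (ct (fun i k => lap2 Ric i k)
   + 2 * ct (fun i k => dot2 (fun p q => Rm i p k q) Ric)
   - 2 * ct (fun i k => dot (Ric i) (Ric k))).
  by rewrite -!ctZl -ctD -ctB; apply: eq_ct => i k; exact: dt_Ric.
by rewrite E1 E2; ring.
Qed.

(** * Evolution of the Cotton tensor *)
Variables (u c : A).
Hypothesis cE : c * (n%:R - 1) = half.
Hypothesis uE : u * (n%:R - 2) = 1.
Hypothesis dc : forall a, d a c = 0.
Hypothesis du : forall a, d a u = 0.
Hypothesis dtc : dt c = 0.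

(** $n - 2$ times the Schouten tensor. *)
Definition Sch i j := Ric i j - c * (Scal * g i j).
Definition Cot i j k := cov2 Ric k i j - cov2 Ric j i k
  - c * (d k Scal * g i j - d j Scal * g i k).

Lemma cov2Zg f a i j : cov2 (fun i j => f * g i j) a i j = d a f * g i j.
Proof.
rewrite /cov2 dM !gamZl d_g; ring.
Qed.

Lemma cov3Zg (w : T1) a b i j :
  cov3 (fun b i j => w b * g i j) a b i j = cov1 w a b * g i j.
Proof.
rewrite /cov3 /cov1 dM !gamZl gamZr d_g; ring.
Qed.

Lemma cov2_Sch a i j : cov2 Sch a i j = cov2 Ric a i j - c * d a Scal * g i j.
Proof.
rewrite (cov2B Ric (fun i j => c * (Scal * g i j))); congr (_ - _).
rewrite (eq_cov2 _ _ _ (V := fun i j => c * Scal * g i j)) => [|*]; last exact: mulrA.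
by rewrite cov2Zg dM dc mul0r add0r.
Qed.

Lemma Cot_Sch i j k : Cot i j k = cov2 Sch k i j - cov2 Sch j i k.
Proof. by rewrite /Cot !cov2_Sch; ring. Qed.

Lemma lap2_Sch i j : lap2 Sch i j = lap2 Ric i j - c * lap0 Scal * g i j.
Proof.
rewrite /lap2 /lap0 -ctZl -ctZr -ctB; apply: eq_ct => a b.
rewrite (eq_cov3 _ _ _ _ cov2_Sch).
rewrite (cov3B (cov2 Ric) (fun b i j => c * d b Scal * g i j)); congr (_ - _).
by rewrite (cov3Zg (fun b => c * d b Scal)) /cov1 dM dc gamZl; ring.
Qed.

Definition reaction i j := 2 * dot2 (fun p q => Rm i p j q) Ric - 2 * dot (Ric i) (Ric j)
  - 2 * c * nRic * g i j + 2 * c * Scal * Ric i j.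

Lemma dt_Sch i j : dt (Sch i j) = lap2 Sch i j + reaction i j.
Proof.
rewrite /Sch dtB !(dtM c) (dtM Scal) dtc dt_Ric dt_Scal flow lap2_Sch /reaction; ring.
Qed.

(** In $\partial_t \nabla_k S_{ij}$ the variation of the connection on the index $j$ is
    symmetric in $j, k$, and disappears from the Cotton tensor. *)
Definition evol_half k i j := cov2 (lap2 Sch) k i j - lap3 (cov2 Sch) k i j
  + cov2 reaction k i j - dot (fun p => dGam p k i) (fun q => Sch q j).

Lemma dt_Cot_lap i j k : dt (Cot i j k) - lap3 Cot i j k = evol_half k i j - evol_half j i k.
Proof.
have L : lap3 Cot i j k = lap3 (cov2 Sch) k i j - lap3 (cov2 Sch) j i k.
  rewrite /lap3 -ctB; apply: eq_ct => a b.
  rewrite (eq_cov4 _ _ _ _ _ (V := fun b i j k =>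
     cov3 (cov2 Sch) b k i j - cov3 (cov2 Sch) b j i k)).
    rewrite (cov4B (fun b i j k => cov3 (cov2 Sch) b k i j)
      (fun b i j k => cov3 (cov2 Sch) b j i k)).
    by congr (_ - _); rewrite /cov4; ring.
  move=> a' i' j' k'; rewrite (eq_cov3 _ _ _ _ Cot_Sch).
  rewrite (cov3B (fun i j k => cov2 Sch k i j) (fun i j k => cov2 Sch j i k)).
  by congr (_ - _); rewrite /cov3; ring.
have S X : dot (fun p => dGam p k j) X = dot (fun p => dGam p j k) X.
  by apply: eq_ct => p q; rewrite dGamC.
rewrite L Cot_Sch dtB !dt_cov2 !(eq_cov2 _ _ _ dt_Sch) !(cov2D (lap2 Sch) reaction) S /evol_half.
ring.
Qed.

Lemma d_dot2 a (X V : T2) :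
  d a (dot2 X V) = dot2 (cov2 X a) V + dot2 X (cov2 V a).
Proof.
rewrite /pair2 d_ct -ctD; apply: eq_ct => p q.
rewrite d_ct !gam_ct -ctD -!ctB; apply: eq_ct => l m.
by rewrite /cov2 dM !gamZl !gamZr; ring.
Qed.

Lemma cov2_dot2 (T : T4) (X : T2) a i j :
  cov2 (fun i j => dot2 (fun p q => T i p j q) X) a i j =
  dot2 (fun p q => cov4 T a i p j q) X + dot2 (fun p q => T i p j q) (cov2 X a).
Proof.
rewrite {1}/cov2 d_dot2 /pair2 !gam_ct -!ctD -!ctB; apply: eq_ct => p q.
rewrite !gam_ct -!ctD -!ctB; apply: eq_ct => l m.
by rewrite /cov4 /cov2 !gamZr; ring.
Qed.

Lemma cov2_dot (S T : T2) a i j :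
  cov2 (fun i j => dot (S i) (T j)) a i j =
  dot (cov2 S a i) (T j) + dot (S i) (cov2 T a j).
Proof.
rewrite {1}/cov2 /pair1 d_ct !gam_ct -!ctD -!ctB; apply: eq_ct => p q.
by rewrite /cov2 dM !gamZl !gamZr; ring.
Qed.

Lemma cov2Z f (T : T2) a i j :
  cov2 (fun i j => f * T i j) a i j = d a f * T i j + f * cov2 T a i j.
Proof. by rewrite /cov2 dM !gamZl; ring. Qed.

Local Notation dS := (fun a => d a Scal).
Local Notation dRic := (cov2 Ric).
Local Notation dRm := (cov4 Rm).

Lemma d2 a : d a 2 = 0. Proof. exact: d_nat. Qed.

Lemma cov2_reaction k i j : cov2 reaction k i j =
  2 * (drm_ric gi dRm Ric k i j + rm_dric_tr gi Rm dRic k i j)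
  - 2 * (ric_der gi Ric dRic j k i + ric_der gi Ric dRic i k j)
  - 2 * c * (2 * ric_dric gi Ric dRic k) * g i j
  + 2 * c * (d k Scal * Ric i j + Scal * cov2 Ric k i j).
Proof.
pose Q1 i j := dot2 (fun p q => Rm i p j q) Ric.
pose Q2 i j := dot (Ric i) (Ric j).
rewrite (cov2D (fun i j => 2 * Q1 i j - 2 * Q2 i j - 2 * c * nRic * g i j)
  (fun i j => 2 * c * Scal * Ric i j)).
rewrite (cov2B (fun i j => 2 * Q1 i j - 2 * Q2 i j) (fun i j => 2 * c * nRic * g i j)).
rewrite (cov2B (fun i j => 2 * Q1 i j) (fun i j => 2 * Q2 i j)).
rewrite (cov2Z 2 Q1) (cov2Z 2 Q2) cov2Zg (cov2Z _ Ric) cov2_dot2 cov2_dot.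
rewrite (dM _ (2 * c) nRic) (dM _ (2 * c) Scal) (dM _ 2 c) dc d2 d_dot2.
rewrite (dotC (cov2 Ric k i)) (dot2C giC Ric) -/(rm_dric_tr gi Rm dRic k i j) -/(ric_dric gi Ric dRic k).
rewrite /drm_ric /ric_der; ring.
Qed.

Lemma dot_Sch (X : T1) j : dot X (Sch j) = dot X (Ric j) - c * Scal * X j.
Proof.
rewrite (dotBr gi X (Ric j) (fun q => c * (Scal * g j q))) !dotZr.
by rewrite (dot_gr2 gC giC gig); ring.
Qed.

Lemma SchC i j : Sch i j = Sch j i.
Proof. by rewrite /Sch (RicC i) (gC i). Qed.

Lemma dot_Schr (X : T1) j : dot X (fun q => Sch q j) = dot X (Ric j) - c * Scal * X j.
Proof. by rewrite -dot_Sch; apply: eq_dot => // q; exact: SchC. Qed.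

(** The bridge to [cotton_algebra]: all derivatives of order two and higher are gone. *)
Lemma evol_halfE k i j : evol_half k i j =
  evol_part g gi Rm dRm Ric dRic Scal dS c k i j.
Proof.
have H1 i' j' : dot (Ric k) (fun q => cov2 Sch q i' j') =
    ric_div gi Ric dRic k i' j' - c * g i' j' * ric_dscal gi Ric dS k.
  rewrite (eq_dot gi (X' := Ric k) (V' := fun q => dRic q i' j' - (c * g i' j') * d q Scal)) //.
    by rewrite dotBr dotZr.
  by move=> q; rewrite cov2_Sch; ring.
have H2 i' j' : ct (fun a b => ct (fun p q => Rm k a i' p * cov2 Sch b q j')) =
    rm_dric gi Rm dRic k i' j' - c * rm_dscal gi Rm dS k i' j'.
  rewrite -/(dot2 (fun a p => Rm k a i' p) (fun b q => cov2 Sch b q j')).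
  rewrite (eq_dot2 gi (X' := fun a p => Rm k a i' p)
    (V' := fun b q => dRic b q j' - c * (d b Scal * g j' q))) //; last first.
    by move=> b q; rewrite cov2_Sch (gC q); ring.
  rewrite dot2Br dot2Zr (dot2C giC _ (fun b q => d b Scal * g j' q)).
  by rewrite (dot2_gR gC giC gig) dotC.
have H3 i' j' : ct (fun a b => ct (fun p q => Rm k a i' p * cov2 Sch b j' q)) =
    rm_dric gi Rm dRic k i' j' - c * rm_dscal gi Rm dS k i' j'.
  rewrite -H2; apply: eq_ct => a b; apply: eq_ct => p q.
  by rewrite (cov2_C _ _ _ SchC).
have H4 i' j' : ct (fun p q => (dRic p i' k - dRic i' p k) * Sch j' q) =
    ric_div gi Ric dRic j' i' k - ric_der gi Ric dRic j' i' k
    - c * Scal * (dRic j' i' k - dRic i' j' k).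
  rewrite -/(dot (fun p => dRic p i' k - dRic i' p k) (Sch j')).
  rewrite dot_Sch dotBl; congr (_ - _ - _); rewrite dotC //.
  by apply: eq_dot => // q; rewrite (cov2_C _ _ _ RicC).
have H5 i' j' : ct (fun p q => (dRic p i' k - dRic i' p k) * Sch q j') =
    ric_div gi Ric dRic j' i' k - ric_der gi Ric dRic j' i' k
    - c * Scal * (dRic j' i' k - dRic i' j' k).
  by rewrite -H4; apply: eq_ct => p q; rewrite SchC.
rewrite /evol_half comm_lap2 cov2_reaction -/(dot (Ric k) (fun q => cov2 Sch q i j)) H1 H2 H3 H4 H5.
rewrite dot_Schr dotBl dotBl (dotC (fun q => dRic q k i)).
rewrite (dotC (dRic k i)) (dotC (dRic i k)) /evol_part /dGam /ric_div /ric_der; ring.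
Qed.

Definition Wey i j k l := weyl_part g Rm Ric Scal c u i j k l.

Lemma cov4_mulg (S : T2) a i j k l :
  [/\ cov4 (fun i j k l => S i k * g j l) a i j k l = cov2 S a i k * g j l,
      cov4 (fun i j k l => S i l * g j k) a i j k l = cov2 S a i l * g j k,
      cov4 (fun i j k l => S j l * g i k) a i j k l = cov2 S a j l * g i k
    & cov4 (fun i j k l => S j k * g i l) a i j k l = cov2 S a j k * g i l].
Proof. by split; rewrite /cov4 /cov2 dM !gamZl !gamZr d_g; ring. Qed.

Lemma cov4Z f (T : T4) a i j k l :
  cov4 (fun i j k l => f * T i j k l) a i j k l =
  d a f * T i j k l + f * cov4 T a i j k l.
Proof. by rewrite /cov4 dM !gamZl; ring. Qed.

Lemma cov_Wey a i j k l :
  cov4 Wey a i j k l = nab_weyl_part g dRm dRic dS c u a i j k l.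
Proof.
pose G1 (S : T2) i j k l := S i k * g j l.
pose G2 (S : T2) i j k l := S i l * g j k.
pose G3 (S : T2) i j k l := S j l * g i k.
pose G4 (S : T2) i j k l := S j k * g i l.
pose K i j k l := G1 Ric i j k l - G2 Ric i j k l + G3 Ric i j k l - G4 Ric i j k l.
pose L i j k l := G1 g i j k l - G2 g i j k l.
have [R1 R2 R3 R4] := cov4_mulg Ric a i j k l.
have [g1 g2 _ _] := cov4_mulg g a i j k l.
rewrite (cov4D (fun i j k l => Rm i j k l - u * K i j k l)
  (fun i j k l => 2 * c * u * Scal * L i j k l)).
rewrite (cov4B Rm (fun i j k l => u * K i j k l)) (cov4Z _ K) (cov4Z _ L).
rewrite (cov4B (fun i j k l => G1 Ric i j k l - G2 Ric i j k l + G3 Ric i j k l) (G4 Ric)).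
rewrite (cov4D (fun i j k l => G1 Ric i j k l - G2 Ric i j k l) (G3 Ric)).
rewrite (cov4B (G1 Ric) (G2 Ric)) (cov4B (G1 g) (G2 g)).
rewrite R1 R2 R3 R4 g1 g2 !cov_g (dM _ (2 * c * u) Scal) (dM _ (2 * c) u) (dM _ 2 c) dc d2 du.
by rewrite /nab_weyl_part /L /G1 /G2; ring.
Qed.

Theorem cotton_evolution i j k :
  dt (Cot i j k) - lap3 Cot i j k =
  u * (dot (Ric j) (fun q => Cot k q i + Cot q k i + (n%:R - 3) * Cot i k q)
       + (n%:R + 2) * dot (Ric i) (fun q => Cot q k j)
       - dot (Ric k) (fun q => Cot j q i + Cot q j i + (n%:R - 3) * Cot i j q))
  + 2 * u * Scal * Cot i j k + 2 * u * dot2 Ric (fun q l => Cot q j l) * g i k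
  - 2 * u * dot2 Ric (fun q l => Cot q k l) * g i j
  - 2 * dot2 (fun p l => Wey p i k l) (fun q m => Cot q j m)
  + 2 * dot2 (fun p l => Wey p i j l) (fun q m => Cot q k m)
  - 2 * dot2 (fun p l => Wey j k l p) (fun q m => Cot q i m)
  + (2 * c * u * d k nRic * g i j - 2 * c * u * d j nRic * g i k
     + 2 * c * u * Scal * d j Scal * g i k - 2 * c * u * Scal * d k Scal * g i j
     + 2 * u * dot (Ric k) (cov2 Ric j i) - 2 * u * dot (Ric j) (cov2 Ric k i)
     + u * Ric i j * d k Scal - u * Ric i k * d j Scal)
  + (2 * dot2 Ric (fun q m => cov4 Wey j q i k m)
     - 2 * dot2 Ric (fun q m => cov4 Wey k q i j m)).
Proof.
rewrite dt_Cot_lap !evol_halfE.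
rewrite (cotton_algebra gC giC gig RmN12 RmN34 RmC bianchi1 covRmN12 _ RicC _ _ _ half2
  div_Ric cE uE) //.
- have H a : d a nRic = 2 * ric_dric gi Ric dRic a.
    by rewrite d_dot2 (dot2C giC Ric) /ric_dric; ring.
  rewrite !H; congr (_ + (2 * _ - 2 * _)).
  + by apply: eq_dot2 => // p q; rewrite cov_Wey.
  + by apply: eq_dot2 => // p q; rewrite cov_Wey.
- by move=> *; exact: (cov2_C _ _ _ RicC).
- by move=> a; rewrite d_Scal.
Qed.

Lemma gam0 a i : gam a i (fun=> 0) = 0.
Proof. by rewrite /gam big1 // => m _; rewrite mulr0. Qed.

Lemma cov3_0 a i j k : cov3 (fun _ _ _ => 0) a i j k = 0.
Proof. by rewrite /cov3 d0 !gam0 !subr0. Qed.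

Lemma cov4_0 a i j k l : cov4 (fun _ _ _ _ => 0) a i j k l = 0.
Proof. by rewrite /cov4 d0 !gam0 !subr0. Qed.

Lemma lap3_0 i j k : lap3 (fun _ _ _ => 0) i j k = 0.
Proof.
rewrite /lap3 -[RHS](ct0 gi); apply: eq_ct => a b.
by rewrite (eq_cov4 _ _ _ _ _ cov3_0) cov4_0.
Qed.

(** Contracting $\nabla_a W_{jkil} = 0$ over $a, l$ gives, with the contracted Bianchi
    identities, $(n-3) C_{ijk} = 0$. *)
Lemma weyl0_cotton0 (w : A) : (n%:R - 3) * w = 1 ->
  (forall i j k l, Wey i j k l = 0) -> forall i j k, Cot i j k = 0.
Proof.
move=> wE W0 i j k.
have dW0 a i' j' k' l' : cov4 Wey a i' j' k' l' = 0.
  by rewrite (eq_cov4 _ _ _ _ _ W0) cov4_0.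
have : ct (fun a l => cov4 Wey a j k i l) = 0.
  by rewrite -[RHS](ct0 gi); apply: eq_ct => a l; exact: dW0.
have -> : ct (fun a l => cov4 Wey a j k i l) =
  ct (fun a l => cov4 Rm a j k i l)
  - u * (ct (fun a l => g k l * dRic a j i) - g k i * ct (fun a l => dRic a j l)
         + g j i * ct (fun a l => dRic a k l) - ct (fun a l => g j l * dRic a k i))
  + 2 * c * u * (g j i * ct (fun a l => g k l * d a Scal)
                 - g k i * ct (fun a l => g j l * d a Scal)).
  rewrite -!ctZl -!(ctB, ctD) -!ctZl -!(ctB, ctD).
  by apply: eq_ct => a l; rewrite cov_Wey /nab_weyl_part; ring.
have G k' (F : T1) : ct (fun a l => g k' l * F a) = F k'.
  by rewrite ctC ct_gl.
have D k' : ct (fun a l => dRic a k' l) = half * d k' Scal.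
  by rewrite -div_Ric; apply: eq_ct => a l; rewrite (cov2_C _ _ _ RicC).
rewrite !G !D div_Rm; set X := _ + _ => X0.
pose Gd := g j i * d k Scal - g k i * d j Scal.
have E1 : (n%:R - 3) * Cot i j k = (n%:R - 2) * X
    + (u * (n%:R - 2) - 1) * (dRic k j i - dRic j k i + half * Gd - 2 * c * Gd)
    - (c * (n%:R - 1) - half) * Gd.
  rewrite /X /Cot /Gd (cov2_C k i j RicC) (cov2_C j i k RicC) (gC i j) (gC i k); ring.
have : (n%:R - 3) * Cot i j k = 0 by rewrite E1 X0 uE cE !subrr; ring.
by move=> /(congr1 ( *%R w)); rewrite mulr0 mulrA (mulrC w) wE mul1r.
Qed.

End TensorCalculus.

(** * Mean values and mixed derivatives up to the boundary *)
Lemma cvg_to_within (T : Type) (F : set_system T) (D : set T) :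
  Filter F -> F D -> F --> within D F.
Proof.
by move=> FF FD P; rewrite /within/=; apply: filterS2 FD => x Dx; apply.
Qed.

Section MeanValue.
Variable R : realType.

(** Difference quotients at [s] of a function known only on the segment [a, b]; at the end
    points of the segment the limits are one-sided. *)
Definition seg_quot (phi : R -> R) (s k : R) : R := k^-1 * (phi (s + k) - phi s).
Definition seg_filter (a b s : R) := within [set k | a <= s + k <= b] (0 : R)^'.

Lemma seg_cont (phi : R -> R) (a b s l : R) :
  seg_quot phi s @ seg_filter a b s --> l ->
  phi (s + k) @[k --> seg_filter a b s] --> phi s.
Proof.
move=> H.
have K : k * seg_quot phi s k @[k --> seg_filter a b s] --> 0 * l.
  apply: cvgM H; apply: cvg_within_filter.
  exact/cvg_within.
have : phi s + k * seg_quot phi s k @[k --> seg_filter a b s] --> phi s + 0 * l.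
  by apply: cvgD => //; apply: cvg_cst.
rewrite mul0r addr0; apply: cvg_trans.
apply: near_eq_cvg; rewrite near_withinE; near=> k => _.
rewrite /seg_quot mulrA mulfV ?mul1r; first by rewrite addrC subrK.
by near: k; exact: nbhs_dnbhs_neq.
Unshelve. all: by end_near.
Qed.

Lemma MVT_seg (phi phi' : R -> R) (a b : R) : a < b ->
  (forall s, a <= s <= b -> seg_quot phi s @ seg_filter a b s --> phi' s) ->
  exists2 c, a <= c <= b & phi b - phi a = phi' c * (b - a).
Proof.
move=> ab H.
have C s : a <= s <= b -> phi (s + k) @[k --> seg_filter a b s] --> phi s.
  by move=> sab; exact: seg_cont (H s sab).
have itvE s : s \in `]a, b[ -> a <= s <= b.
  by move=> sab; rewrite !ltW ?(itvP sab).
have D s : s \in `]a, b[ -> is_derive s 1 phi (phi' s).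
  move=> sab.
  have : seg_quot phi s @ (0 : R)^' --> phi' s.
    apply: cvg_trans (H s (itvE s sab)); apply: cvg_app; apply: cvg_to_within.
    have d0 : 0 < Num.min (s - a) (b - s).
      by rewrite lt_min !subr_gt0 !(itvP sab).
    near=> k.
    have : `|k| < Num.min (s - a) (b - s) by near: k; exact: dnbhs0_lt.
    rewrite lt_min !ltr_norml /= => /andP[/andP[k1 k2] /andP[k3 k4]].
    by apply/andP; split; lra.
  move=> cv; have E : (fun h => h^-1 *: ((phi \o shift s) (h *: 1) - phi s)) = seg_quot phi s.
    apply/funext => h; rewrite /seg_quot /GRing.scale /= mulr1.
    by rewrite (addrC h).
  split; first by rewrite /derivable E; apply/cvg_ex; exists (phi' s).
  by rewrite /derive E; exact: cvg_lim.
have [|c cab E] := MVT ab D; last by exists c => //; exact: itvE.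
apply/subspace_continuousP => s /=; rewrite in_itv /= => sab.
have /cvgrPdist_lt Cs := C s sab.
apply/cvgrPdist_lt => e e0; have := Cs e e0.
rewrite !near_withinE => /nbhs_ballP [d /= d0 Hd].
apply/nbhs_ballP; exists d => //= y syd /=; rewrite in_itv /= => yab.
have [->|ys] := eqVneq y s; first by rewrite subrr normr0.
have := Hd (y - s); rewrite addrCA subrr addr0; apply => //.
  by move: syd; rewrite /ball /= sub0r opprB.
by rewrite subr_eq0.
Unshelve. all: by end_near.
Qed.
End MeanValue.

(** Products of a nondegenerate time interval, of any kind, with an open set. *)
Record st_domain (R : realType) (n : nat) := StDomain {
  st_I : set R;
  st_U : set 'rV[R]_n;
  st_itv : is_interval st_I;
  st_nondeg : exists t0 t1 : R, [/\ st_I t0, st_I t1 & t0 < t1];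
  st_open : open st_U
}.

Arguments st_itv {R n}.
Arguments st_nondeg {R n}.
Arguments st_open {R n}.

Section Directional.
Variables (R : realType) (n : nat) (D : st_domain R n).
Local Notation I := (st_I D).
Local Notation U := (st_U D).
Local Notation pnt := (R * 'rV[R]_n)%type.
Definition dom : set pnt := [set p | I p.1 /\ U p.2].

(** [None] is the time direction. Treating time and space directions alike lets one
    proof of each rule of calculus serve for both. *)
Definition mv (o : option 'I_n) (h : R) (p : pnt) : pnt :=
  match o with
  | None => (p.1 + h, p.2)
  | Some i => (p.1, h *: delta_mx 0 i + p.2)
  end.

Lemma mvD o h k p : mv o (h + k) p = mv o k (mv o h p).
Proof.
by case: o p => [i|] [t x]; rewrite /mv /= ?addrA // scalerDl (addrC (h *: _)).
Qed.

Lemma mvC o h o' k p : mv o h (mv o' k p) = mv o' k (mv o h p).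
Proof.
case: o o' p => [i|] [j|] [t x] //=; congr (_, _); first exact: addrCA.
exact: addrAC.
Qed.

Definition dquot (o : option 'I_n) (f : pnt -> R) (p : pnt) (h : R) : R :=
  h^-1 * (f (mv o h p) - f p).
(** Increments are restricted to those that stay in the domain. In the space directions
    this is no restriction near 0; in time it yields one-sided derivatives at end points. *)
Definition dfilter (o : option 'I_n) (p : pnt) :=
  within [set h | dom (mv o h p)] (0 : R)^'.
Definition has_der o (f f' : pnt -> R) :=
  forall p, dom p -> dquot o f p @ dfilter o p --> f' p.

Global Instance dfilter_filter o p : Filter (dfilter o p).
Proof. exact: within_filter. Qed.

Lemma near_mv_space (U' : set 'rV[R]_n) i (p : pnt) : open U' -> U' p.2 ->
  \forall h \near (0 : R), U' (mv (Some i) h p).2.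
Proof.
move=> oU Up.
have : (fun h : R => h *: (delta_mx 0 i : 'rV[R]_n) + p.2) @ (0 : R) --> p.2.
  rewrite -[X in _ --> X](_ : 0 *: (delta_mx 0 i : 'rV[R]_n) + p.2 = _); last first.
    by rewrite scale0r add0r.
  apply: cvgD; last exact: cvg_cst.
  by apply: cvgZr_tmp.
by move=> /(_ U'); apply; apply: open_nbhs_nbhs.
Qed.

(** A nondegenerate segment of admissible increments exists even at an end point of the
    time interval, where it lies on one side of 0. *)
Lemma small_seg o p (e : R) : dom p -> 0 < e ->
  exists a b : R, [/\ a < b, - e < a <= 0, 0 <= b < e &
    forall s, a <= s <= b -> dom (mv o s p)].
Proof.
case: o => [i|] [/= It Ux] e0.
- have := near_mv_space i (st_open D) Ux => /nbhs_ballP[d /= d0 Hd].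
  pose m := Num.min e d / 2.
  have m0 : 0 < m by rewrite divr_gt0 // lt_min e0 d0.
  have [me md] : m < e /\ m < d.
    by split; rewrite ltr_pdivrMr // gt_min; [rewrite ltr_pMr ?ltr1n ?e0|
      rewrite [X in _ || X]ltr_pMr ?ltr1n ?d0 // orbT].
  exists 0, m; split; rewrite ?oppr_lt0 ?e0 ?lexx ?(ltW m0) ?me //.
  move=> s /andP[s0 sm]; split => //; apply: Hd.
  by rewrite /ball /= sub0r normrN ger0_norm // (le_lt_trans sm).
- have [t [t' [It0 It1 t01]]] := st_nondeg D.
  have [lt|ge] := ltP p.1 t'.
  + pose m := Num.min (e / 2) (t' - p.1).
    have m0 : 0 < m by rewrite lt_min subr_gt0 lt divr_gt0.
    have me : m < e by rewrite gt_min ltr_pdivrMr // ltr_pMr ?ltr1n ?e0.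
    exists 0, m; split; rewrite ?oppr_lt0 ?e0 ?lexx ?(ltW m0) ?me //.
    move=> s /andP[s0 sm]; split => //=; apply: (st_itv D _ _ It It1).
    by rewrite lerDl s0 /= -lerBrDl (le_trans sm) // ge_min lexx orbT.
  + pose m := Num.min (e / 2) (p.1 - t).
    have m0 : 0 < m by rewrite lt_min subr_gt0 (lt_le_trans t01 ge) divr_gt0.
    have me : m < e by rewrite gt_min ltr_pdivrMr // ltr_pMr ?ltr1n ?e0.
    exists (- m), 0; split; rewrite ?oppr_lt0 ?ltrN2 ?oppr_le0 ?e0 ?lexx ?(ltW m0) ?me //.
    move=> s /andP[sm s0]; split => //=; apply: (st_itv D _ _ It0 It).
    rewrite gerDl s0 andbT -lerBlDl.
    rewrite (le_trans _ sm) // lerNr opprB.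
    by rewrite /m ge_min lexx orbT.
Qed.

Lemma dfilter_proper o p : dom p -> ProperFilter (dfilter o p).
Proof.
move=> dp; apply: Build_ProperFilter_ex => P.
rewrite /dfilter /dnbhs /within /= => /nbhs_ballP[d /= d0 Hd].
have [a [b [ab /andP[da a0] /andP[b0 bd] H]]] := small_seg o dp d0.
have [E|bn0] := eqVneq b 0.
  exists a; apply: Hd; rewrite /ball /= ?sub0r ?normrN ?ler0_norm 1?ltrNl //.
    by rewrite -E lt_eqF.
  by apply: H; rewrite lexx ltW.
exists b; apply: Hd; rewrite /ball /= ?sub0r ?normrN ?ger0_norm //.
by apply: H; rewrite lexx ltW.
Qed.

Lemma dquot_unique o f p (l l' : R) : dom p ->
  dquot o f p @ dfilter o p --> l -> dquot o f p @ dfilter o p --> l' -> l = l'.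
Proof.
move=> dp; have FF := dfilter_proper o dp; exact: cvg_unique.
Qed.

Lemma has_der_unique o f f1 f2 : has_der o f f1 -> has_der o f f2 ->
  {in dom, f1 =1 f2}.
Proof.
by move=> H1 H2 p /set_mem dp; exact: dquot_unique dp (H1 p dp) (H2 p dp).
Qed.

Lemma has_der_congr o f1 f2 f1' f2' : {in dom, f1 =1 f2} -> {in dom, f1' =1 f2'} ->
  has_der o f1 f1' -> has_der o f2 f2'.
Proof.
move=> E E' H p dp; rewrite -E' ?inE //; apply: cvg_trans (H p dp).
apply: near_eq_cvg; rewrite near_withinE; apply: nearW => h dh.
by rewrite /dquot !E // inE.
Qed.

Lemma dquot_cont o f p (l : R) : dquot o f p @ dfilter o p --> l ->
  f (mv o h p) @[h --> dfilter o p] --> f p.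
Proof.
move=> H.
have K : h * dquot o f p h @[h --> dfilter o p] --> 0 * l.
  by apply: cvgM H; apply: cvg_within_filter; exact/cvg_within.
have : f p + h * dquot o f p h @[h --> dfilter o p] --> f p + 0 * l.
  by apply: cvgD => //; apply: cvg_cst.
rewrite mul0r addr0; apply: cvg_trans.
apply: near_eq_cvg; rewrite near_withinE; near=> h => _.
rewrite /dquot mulrA mulfV ?mul1r; first by rewrite addrC subrK.
by near: h; exact: nbhs_dnbhs_neq.
Unshelve. all: by end_near.
Qed.

Lemma has_der_cst o c : has_der o (fun=> c) (fun=> 0).
Proof.
move=> p dp; rewrite [X in X @ _](_ : _ = fun=> 0); first exact: cvg_cst.
by apply/funext => h; rewrite /dquot subrr mulr0.
Qed.

Lemma has_derD o f f' g g' : has_der o f f' -> has_der o g g' ->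
  has_der o (fun p => f p + g p) (fun p => f' p + g' p).
Proof.
move=> Hf Hg p dp.
rewrite [X in X @ _](_ : _ = fun h => dquot o f p h + dquot o g p h).
  by apply: cvgD; [exact: Hf|exact: Hg].
by apply/funext => h; rewrite /dquot -mulrDr; congr (_ * _); ring.
Qed.

Lemma has_derM o f f' g g' : has_der o f f' -> has_der o g g' ->
  has_der o (fun p => f p * g p) (fun p => f' p * g p + f p * g' p).
Proof.
move=> Hf Hg p dp.
rewrite [X in X @ _](_ : _ = fun h => dquot o f p h * g (mv o h p) + f p * dquot o g p h).
  apply: cvgD; apply: cvgM; [exact: Hf|exact: dquot_cont (Hg p dp)|exact: cvg_cst|exact: Hg].
by apply/funext => h; rewrite /dquot; ring.
Qed.

Lemma has_derN o f f' : has_der o f f' -> has_der o (fun p => - f p) (fun p => - f' p).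
Proof.
move=> Hf p dp.
rewrite [X in X @ _](_ : _ = fun h => - dquot o f p h); first by apply: cvgN; exact: Hf.
by apply/funext => h; rewrite /dquot; ring.
Qed.

Lemma has_derV o f f' : (forall p, dom p -> f p != 0) -> has_der o f f' ->
  has_der o (fun p => (f p)^-1) (fun p => - (f' p * ((f p)^-1 * (f p)^-1))).
Proof.
move=> f0 Hf p dp.
have H : - (dquot o f p h * ((f (mv o h p))^-1 * (f p)^-1)) @[h --> dfilter o p] -->
   - (f' p * ((f p)^-1 * (f p)^-1)).
  apply: cvgN; apply: cvgM; first exact: Hf.
  by apply: cvgM; [apply: cvgV; [exact: f0|exact: dquot_cont (Hf p dp)]|exact: cvg_cst].
apply: cvg_trans H; apply: near_eq_cvg; rewrite near_withinE; apply: nearW => h /= dh.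
have a0 := f0 _ dp; have b0 := f0 _ dh; rewrite /dquot.
rewrite [in RHS](_ : (f (mv o h p))^-1 - (f p)^-1 =
   (f p - f (mv o h p)) * ((f (mv o h p))^-1 * (f p)^-1)); first ring.
by field; rewrite a0 b0.
Qed.

Definition jcont (f : pnt -> R) := forall p, dom p -> f @ within dom (nbhs p) --> f p.

Lemma jcont_congr f g : {in dom, f =1 g} -> jcont f -> jcont g.
Proof.
move=> E H p dp; rewrite -E ?inE //; apply: cvg_trans (H p dp).
apply: near_eq_cvg; rewrite near_withinE; apply: nearW => q dq.
by rewrite E // inE.
Qed.
Lemma jcont_cst c : jcont (fun=> c). Proof. by move=> p _; exact: cvg_cst. Qed.
Lemma jcontD f g : jcont f -> jcont g -> jcont (fun p => f p + g p).
Proof. by move=> Hf Hg p dp; apply: cvgD; [exact: Hf|exact: Hg]. Qed.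
Lemma jcontM f g : jcont f -> jcont g -> jcont (fun p => f p * g p).
Proof. by move=> Hf Hg p dp; apply: cvgM; [exact: Hf|exact: Hg]. Qed.
Lemma jcontN f : jcont f -> jcont (fun p => - f p).
Proof. by move=> Hf p dp; apply: cvgN; exact: Hf. Qed.
Lemma jcontV f : (forall p, dom p -> f p != 0) -> jcont f -> jcont (fun p => (f p)^-1).
Proof. by move=> f0 Hf p dp; apply: cvgV; [exact: f0|exact: Hf]. Qed.

(** Existence and joint continuity of all iterated derivatives of order at most [k]. The
    derivatives are only asserted to exist, so that the class does not depend on values
    outside the domain; the grading by [k] permits induction in [SmM] and [SmV]. *)
Fixpoint Sm k (f : pnt -> R) : Prop := jcont f /\
  if k is k'.+1 then forall o, exists2 f', has_der o f f' & Sm k' f' else True.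

Lemma Sm_congr k f g : {in dom, f =1 g} -> Sm k f -> Sm k g.
Proof.
case: k => [|k] E [jf H]; split => //; try exact: jcont_congr jf.
move=> o; have [f' Hf' S] := H o; exists f' => //.
by apply: has_der_congr Hf' => // p _.
Qed.

Lemma Sm_pred k f : Sm k.+1 f -> Sm k f.
Proof.
elim: k f => [|k IH] f [jf H]; split => // o.
by have [f' Hf' S] := H o; exists f' => //; exact: IH.
Qed.

Lemma Sm_cst k c : Sm k (fun=> c).
Proof.
elim: k c => [|k IH] c; (split; first exact: jcont_cst) => // o.
by exists (fun=> 0) => //; exact: has_der_cst.
Qed.

Lemma SmD k f g : Sm k f -> Sm k g -> Sm k (fun p => f p + g p).
Proof.
elim: k f g => [|k IH] f g [jf Hf] [jg Hg]; (split; first exact: jcontD) => // o.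
have [f' df Sf] := Hf o; have [g' dg Sg] := Hg o.
by exists (fun p => f' p + g' p); [exact: has_derD|exact: IH].
Qed.

Lemma SmN k f : Sm k f -> Sm k (fun p => - f p).
Proof.
elim: k f => [|k IH] f [jf Hf]; (split; first exact: jcontN) => // o.
have [f' df Sf] := Hf o.
by exists (fun p => - f' p); [exact: has_derN|exact: IH].
Qed.

Lemma SmM k f g : Sm k f -> Sm k g -> Sm k (fun p => f p * g p).
Proof.
elim: k f g => [|k IH] f g Sf Sg; move: (Sf) (Sg) => [jf Hf] [jg Hg];
  (split; first exact: jcontM) => // o.
have [f' df Sf'] := Hf o; have [g' dg Sg'] := Hg o.
exists (fun p => f' p * g p + f p * g' p); first exact: has_derM.
by apply: SmD; apply: IH => //; exact: Sm_pred.
Qed.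

(** $(1/f)' = - f' \cdot (1/f) \cdot (1/f)$, and $1/f$ has one more derivative than
    assumed by induction. *)
Lemma SmV k f : (forall p, dom p -> f p != 0) -> Sm k f -> Sm k (fun p => (f p)^-1).
Proof.
move=> f0; elim: k => [|k IH] Sf; move: (Sf) => [jf Hf];
  (split; first exact: jcontV) => // o.
have [f' df Sf'] := Hf o.
exists (fun p => - (f' p * ((f p)^-1 * (f p)^-1))); first exact: has_derV.
by apply: SmN; apply: SmM => //; apply: SmM; apply: IH; exact: Sm_pred.
Qed.
End Directional.

Section Schwarz.
Variables (R : realType) (n : nat) (D : st_domain R n).
Local Notation I := (st_I D).
Local Notation U := (st_U D).
Local Notation pnt := (R * 'rV[R]_n)%type.
Local Notation dom := (dom D).
Local Notation dfilter := (dfilter D).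
Local Notation has_der := (has_der D).
Local Notation jcont := (jcont D).
Local Notation Sm := (Sm D).

Lemma mv_ball o (s e : R) (p : pnt) : `|s| < e -> ball p e (mv o s p).
Proof.
move=> se; have e0 : 0 < e by rewrite (le_lt_trans _ se).
case: o => [i|]; split => //=; try exact: ballxx.
- split => // a b; rewrite /ball /= !mxE opprD addrCA subrr addr0 normrN normrM.
  by rewrite (le_lt_trans _ se) // ler_piMr //; case: (_ && _); rewrite ?normr1 ?normr0.
- by rewrite /ball /= opprD addrA subrr add0r normrN.
Qed.

Lemma rect_half o j (p : pnt) (e : R) : dom p -> 0 < e ->
  exists a1 b1 a2 b2 : R, [/\ a1 < b1, a2 < b2 & forall s r,
    a1 <= s <= b1 -> a2 <= r <= b2 ->
    dom (mv (Some j) r (mv o s p)) /\ ball p e (mv (Some j) r (mv o s p))].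
Proof.
move=> dp e0; have /nbhs_ballP[d /= d0 Hd] : nbhs p.2 U.
  by apply: open_nbhs_nbhs; split; [exact: st_open|exact: dp.2].
pose m := Num.min d e.
have m0 : 0 < m by rewrite lt_min d0 e0.
have m3 : 0 < m / 3 by rewrite divr_gt0.
have [a [b [ab /andP[ma a0] /andP[b0 bm] H]]] := small_seg o dp m3.
exists a, b, 0, (m / 3); split => // s r sab /andP[r0 rm].
have B : ball p m (mv (Some j) r (mv o s p)).
  have -> : m = m / 3 + (m / 3 + m / 3) by lra.
  apply: (ball_triangle (y := mv o s p)); apply: mv_ball.
    by move/andP: sab => [? ?]; rewrite ltr_norml; apply/andP; split; lra.
  by rewrite ger0_norm //; lra.
split; last by apply: le_ball B; rewrite ge_min lexx orbT.
split; first exact: (H s sab).1.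
apply: Hd; apply: le_ball B.2.
by rewrite ge_min lexx.
Qed.

(** Two different directions span small rectangles inside the domain. This fails if both
    directions are time, as increments could leave the interval. *)
Lemma rect_exists o o' (p : pnt) (e : R) : dom p -> 0 < e -> o != o' ->
  exists a1 b1 a2 b2 : R, [/\ a1 < b1, a2 < b2 & forall s r,
    a1 <= s <= b1 -> a2 <= r <= b2 ->
    dom (mv o' r (mv o s p)) /\ ball p e (mv o' r (mv o s p))].
Proof.
move=> dp e0; case: o' => [j|] oo'; first exact: rect_half.
case: o oo' => [i|] // _.
have [a1 [b1 [a2 [b2 [h1 h2 H]]]]] := rect_half None i dp e0.
exists a2, b2, a1, b1; split => // s r sb rb.
by rewrite mvC; exact: H.
Qed.

Lemma der_seg o f f' q (a b s : R) : has_der o f f' -> dom q ->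
  (forall k, a <= s + k <= b -> dom (mv o k q)) ->
  dquot o f q @ seg_filter a b s --> f' q.
Proof.
move=> Hf dq H; apply: cvg_trans (Hf q dq); apply: cvg_app.
exact: within_subset.
Qed.

(** Mean value theorem in the direction [o] for the increment of [f] in the direction [o'],
    then in the direction [o'] for [f1]. *)
Lemma second_diff o o' f f1 f12 p (a1 b1 a2 b2 : R) : a1 < b1 -> a2 < b2 ->
  (forall s r, a1 <= s <= b1 -> a2 <= r <= b2 -> dom (mv o' r (mv o s p))) ->
  has_der o f f1 -> has_der o' f1 f12 ->
  exists s r, [/\ a1 <= s <= b1, a2 <= r <= b2 &
    f (mv o' b2 (mv o b1 p)) - f (mv o' a2 (mv o b1 p))
    - (f (mv o' b2 (mv o a1 p)) - f (mv o' a2 (mv o a1 p))) =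
    f12 (mv o' r (mv o s p)) * (b2 - a2) * (b1 - a1)].
Proof.
move=> ab1 ab2 H Hf Hf1.
have e2 : a2 <= a2 <= b2 by rewrite lexx ltW.
have e2' : a2 <= b2 <= b2 by rewrite lexx ltW.
pose phi s := f (mv o' b2 (mv o s p)) - f (mv o' a2 (mv o s p)).
pose phi' s := f1 (mv o' b2 (mv o s p)) - f1 (mv o' a2 (mv o s p)).
have [s sab|s sab Es] := @MVT_seg _ phi phi' a1 b1 ab1.
  have -> : seg_quot phi s = fun k => dquot o f (mv o' b2 (mv o s p)) k
                                  - dquot o f (mv o' a2 (mv o s p)) k.
    apply/funext => k; rewrite /seg_quot /dquot /phi mvD !(mvC o').
    by ring.
  by apply: cvgB; (apply: der_seg Hf _ _; first exact: H) => k kab;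
    rewrite mvC -mvD; apply: H.
pose q := mv o s p.
have [r rab|r rab Er] := @MVT_seg _ (fun r => f1 (mv o' r q)) (fun r => f12 (mv o' r q)) a2 b2 ab2.
  have -> : seg_quot (fun r => f1 (mv o' r q)) r = dquot o' f1 (mv o' r q).
    by apply/funext => k; rewrite /seg_quot /dquot mvD.
  by apply: der_seg Hf1 _ _; [exact: H|move=> k kab; rewrite -mvD; apply: H].
by exists s, r; split => //; rewrite -Er -/(phi' s) -Es.
Qed.

(** The second difference over a small rectangle is symmetric in the two directions, so
    [f12] and [f21] agree at two points of the rectangle; let the rectangle shrink. *)
Lemma schwarz o o' f f1 f2 f12 f21 : has_der o f f1 -> has_der o' f f2 ->
  has_der o' f1 f12 -> has_der o f2 f21 -> jcont f12 -> jcont f21 ->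
  {in dom, f12 =1 f21}.
Proof.
move=> H1 H2 H12 H21 J12 J21.
have [E|oo'] := eqVneq o o'.
  subst o'; apply: (has_der_unique H12); apply: has_der_congr H21 => //.
  exact: (has_der_unique H2 H1).
move=> p /set_mem dp; apply/eqP; apply: contraT => ne.
pose e := `|f12 p - f21 p| / 2.
have e0 : 0 < e by rewrite divr_gt0 // normr_gt0 subr_eq0.
have /cvgrPdist_lt/(_ e e0) := J12 p dp.
rewrite near_withinE => /nbhs_ballP[d1 /= d10 B1].
have /cvgrPdist_lt/(_ e e0) := J21 p dp.
rewrite near_withinE => /nbhs_ballP[d2 /= d20 B2].
have d0 : 0 < Num.min d1 d2 by rewrite lt_min d10 d20.
have [a1 [b1 [a2 [b2 [ab1 ab2 H]]]]] := rect_exists dp d0 oo'.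
have [s [r [sab rab E]]] := second_diff ab1 ab2 (fun s r hs hr => (H s r hs hr).1) H1 H12.
have H' r' s' : a2 <= r' <= b2 -> a1 <= s' <= b1 -> dom (mv o s' (mv o' r' p)).
  by move=> hr hs; rewrite mvC; exact: (H s' r' hs hr).1.
have [r' [s' [rab' sab' E']]] := second_diff ab2 ab1 H' H2 H21.
have EE : f12 (mv o' r (mv o s p)) = f21 (mv o s' (mv o' r' p)).
  have n1 : b1 - a1 != 0 by rewrite subr_eq0 gt_eqF.
  have n2 : b2 - a2 != 0 by rewrite subr_eq0 gt_eqF.
  apply: (mulIf n2); apply: (mulIf n1); rewrite -E [RHS]mulrAC -E'.
  by rewrite !(mvC o); ring.
have h1 : `|f12 p - f12 (mv o' r (mv o s p))| < e.
  have [d b] := H s r sab rab; apply: B1 => //.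
  by apply: le_ball b; rewrite ge_min lexx.
have h2 : `|f21 p - f21 (mv o s' (mv o' r' p))| < e.
  rewrite mvC; have [d b] := H s' r' sab' rab'; apply: B2 => //.
  by apply: le_ball b; rewrite ge_min lexx orbT.
have : `|f12 p - f21 p| < e + e.
  apply: le_lt_trans (ltrD h1 h2); rewrite -EE.
  by apply: le_trans (ler_normB _ _); rewrite opprB addrA subrK.
by rewrite /e -splitr ltxx.
Qed.

Definition unc (f : R -> 'rV[R]_n -> R) (p : pnt) : R := f p.1 p.2.

Lemma time_quotP (f : R -> 'rV[R]_n -> R) t x (l : R) : U x ->
  (time_quotient (f^~ x) t @ within I t^' --> l) <->
  (dquot None (unc f) (t, x) @ dfilter None (t, x) --> l).
Proof.
move=> Ux; split => /cvgrPdist_lt H; apply/cvgrPdist_lt => e e0; have := H e e0.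
- rewrite /dnbhs !near_withinE => /nbhs_ballP[d /= d0 B].
  apply/nbhs_ballP; exists d => //= h hd h0 [/= Ih _].
  have := B (t + h); rewrite /time_quotient /dquot /unc /= (addrC t h) addrK mulrC.
  rewrite (addrC h t); apply => //.
  + by move: hd; rewrite /ball /= sub0r opprD addrA subrr add0r.
  + by rewrite -subr_eq0 addrAC subrr add0r.
- rewrite /dnbhs !near_withinE => /nbhs_ballP[d /= d0 B].
  apply/nbhs_ballP; exists d => //= s sd s0 Is.
  have := B (s - t); rewrite /time_quotient /dquot /unc /= addrCA subrr addr0 mulrC.
  apply => //; last by rewrite subr_eq0.
  by move: sd; rewrite /ball /= sub0r opprB.
Qed.

Lemma space_filter i (p : pnt) : dom p -> (0 : R)^' --> dfilter (Some i) p.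
Proof.
move=> [Ip Up]; apply: cvg_to_within.
have : \forall h \near (0 : R), U (mv (Some i) h p).2.
  exact: (near_mv_space i (st_open D) Up).
by rewrite /dnbhs /within /=; apply: filterS => h Uh _.
Qed.

Lemma space_quotP (f : R -> 'rV[R]_n -> R) i t x (l : R) : I t -> U x ->
  (is_derive x (delta_mx 0 i : 'rV[R]_n) (f t) l) <->
  (dquot (Some i) (unc f) (t, x) @ dfilter (Some i) (t, x) --> l).
Proof.
move=> It Ux.
have E : (fun h => h^-1 *: ((f t \o shift x) (h *: (delta_mx 0 i : 'rV[R]_n)) - f t x)) =
  dquot (Some i) (unc f) (t, x) by [].
split=> [[ex v]|H].
  apply: cvg_within_filter; rewrite -E -v; exact: ex.
have H' : dquot (Some i) (unc f) (t, x) @ (0 : R)^' --> l.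
  by apply: cvg_trans H; apply: cvg_app; apply: space_filter.
split; first by rewrite /derivable E; apply/cvg_ex; exists l.
by rewrite /derive E; exact: cvg_lim.
Qed.

Lemma has_der_spacetime f : (forall t x, I t -> U x ->
    time_derivable I (f^~ x) t /\ forall i, derivable (f t) x (delta_mx 0 i)) ->
  forall o, has_der o (unc f) (unc (spacetime_deriv I o f)).
Proof.
move=> H o [t x] [/= It Ux]; have [Ht Hx] := H t x It Ux.
case: o => [i|].
  by apply/space_quotP => //; exact/derivableP.
by apply/time_quotP => //; exact: Ht.
Qed.

Lemma has_der_ex f t x : (forall o, exists f', has_der o (unc f) f') -> I t -> U x ->
  time_derivable I (f^~ x) t /\ forall i, derivable (f t) x (delta_mx 0 i).
Proof.
move=> H It Ux; have dp : dom (t, x) by [].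
split=> [|i].
  have [g Hg] := H None; have /(time_quotP _ _ _ Ux) := Hg _ dp.
  by move=> K; apply/cvg_ex; exists (g (t, x)).
have [g Hg] := H (Some i).
by have /(space_quotP _ _ _ It Ux)[] := Hg _ dp.
Qed.

Lemma smooth_Sm f : smooth_spacetime I U f -> forall k, Sm k (unc f).
Proof.
move=> S k; elim: k f S => [|k IH] f S.
  split => // p dp; have [/subspace_continuousP J _] := S [::]; exact: J.
split; first by move=> p dp; have [/subspace_continuousP J _] := S [::]; exact: J.
move=> o; exists (unc (spacetime_deriv I o f)).
  by apply: has_der_spacetime; have [_] := S [::].
by apply: IH => w; have := S (rcons w o); rewrite foldr_rcons.
Qed.

Lemma Sm_smooth f : (forall k, Sm k (unc f)) -> smooth_spacetime I U f.
Proof.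
move=> S w.
have {}S k : Sm k (unc (foldr (@spacetime_deriv R n I) f w)).
  elim: w k => [|o w IH] k //=.
  have [_ /(_ o)[f' Hf' Sf']] := IH k.+1.
  apply: Sm_congr Sf'; apply: (has_der_unique Hf').
  apply: has_der_spacetime => t x It Ux; apply: has_der_ex => // o'.
  by have [_ /(_ o')[g Hg _]] := IH 1; exists g.
split; first by apply/subspace_continuousP => p dp; exact: (S 0).1.
move=> t x It Ux; apply: has_der_ex => // o.
by have [_ /(_ o)[g Hg _]] := S 1; exists g.
Qed.
End Schwarz.

(** * The ring of smooth functions *)

(** Functions are set to 0 outside the domain, so that equality of two elements is equality
    on the domain. *)
Record sfun (R : realType) (n : nat) (D : st_domain R n) := SFun {
  sval_fun :> R * 'rV[R]_n -> R;
  sfun_smooth : forall k, Sm D k sval_fun;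
  sfun_out : forall p, ~ dom D p -> sval_fun p = 0
}.

Section SmoothRing.
Variables (R : realType) (n : nat) (D : st_domain R n).
Local Notation I := (st_I D).
Local Notation U := (st_U D).
Local Notation pnt := (R * 'rV[R]_n)%type.
Local Notation dom := (dom D).
Local Notation has_der := (has_der D).
Local Notation Sm := (Sm D).
Local Notation sfun := (sfun D).
Implicit Types a b c : sfun.

Lemma sfun_ext a b : (forall p, dom p -> a p = b p) -> a = b.
Proof.
move=> E; have {E} : sval_fun a = sval_fun b.
  apply/funext => p; have [/E//|np] := pselect (dom p).
  by rewrite !sfun_out.
case: a b => f Hf f0 [f' Hf' f0'] /= E; subst f'.
by rewrite (Prop_irrelevance Hf Hf') (Prop_irrelevance f0 f0').
Qed.

Definition cut (f : pnt -> R) (p : pnt) : R := if `[< dom p >] then f p else 0.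

Lemma cutE f p : dom p -> cut f p = f p.
Proof. by move=> dp; rewrite /cut asboolT. Qed.

Lemma cut_smooth f : (forall k, Sm k f) -> forall k, Sm k (cut f).
Proof.
by move=> H k; apply: Sm_congr (H k) => p /set_mem dp; rewrite cutE.
Qed.

Lemma cut_out f p : ~ dom p -> cut f p = 0.
Proof. by move=> dp; rewrite /cut asboolF. Qed.

(** The ring operations and derivations are obtained from opaque existence statements, so
    that they are known by their values on the domain alone and comparing two elements
    never unfolds smoothness proofs. *)
Fact sfun_of_sub f (H : forall k, Sm k f) : {a : sfun | forall p, dom p -> a p = f p}.
Proof. by exists (SFun (cut_smooth H) (@cut_out f)) => p; exact: cutE. Qed.
Definition sfun_of f (H : forall k, Sm k f) : sfun := sval (sfun_of_sub H).
Lemma sfun_ofE f H p : dom p -> @sfun_of f H p = f p.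
Proof. exact: (svalP (sfun_of_sub H)). Qed.

Fact scst_sub x : {a : sfun | forall p, dom p -> a p = x}.
Proof. exact: (sfun_of_sub (fun k => Sm_cst D k x)). Qed.
Fact sadd_sub a b : {c : sfun | forall p, dom p -> c p = a p + b p}.
Proof. exact: (sfun_of_sub (fun k => SmD (sfun_smooth a k) (sfun_smooth b k))). Qed.
Fact sopp_sub a : {c : sfun | forall p, dom p -> c p = - a p}.
Proof. exact: (sfun_of_sub (fun k => SmN (sfun_smooth a k))). Qed.
Fact smul_sub a b : {c : sfun | forall p, dom p -> c p = a p * b p}.
Proof. exact: (sfun_of_sub (fun k => SmM (sfun_smooth a k) (sfun_smooth b k))). Qed.

Definition scst x : sfun := sval (scst_sub x).
Definition sadd a b : sfun := sval (sadd_sub a b).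
Definition sopp a : sfun := sval (sopp_sub a).
Definition smul a b : sfun := sval (smul_sub a b).

Lemma scstE x p : dom p -> scst x p = x. Proof. exact: (svalP (scst_sub x)). Qed.
Lemma saddE a b p : dom p -> sadd a b p = a p + b p.
Proof. exact: (svalP (sadd_sub a b)). Qed.
Lemma soppE a p : dom p -> sopp a p = - a p.
Proof. exact: (svalP (sopp_sub a)). Qed.
Lemma smulE a b p : dom p -> smul a b p = a p * b p.
Proof. exact: (svalP (smul_sub a b)). Qed.
Let sE := (scstE, saddE, soppE, smulE).

Fact saddA : associative sadd.
Proof. by move=> a b c; apply: sfun_ext => p dp; rewrite !sE // addrA. Qed.
Fact saddC : commutative sadd.
Proof. by move=> a b; apply: sfun_ext => p dp; rewrite !sE // addrC. Qed.
Fact sadd0 : left_id (scst 0) sadd.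
Proof. by move=> a; apply: sfun_ext => p dp; rewrite !sE // add0r. Qed.
Fact saddN : left_inverse (scst 0) sopp sadd.
Proof. by move=> a; apply: sfun_ext => p dp; rewrite !sE // addNr. Qed.
Fact smulA : associative smul.
Proof. by move=> a b c; apply: sfun_ext => p dp; rewrite !sE // mulrA. Qed.
Fact smulC : commutative smul.
Proof. by move=> a b; apply: sfun_ext => p dp; rewrite !sE // mulrC. Qed.
Fact smul1 : left_id (scst 1) smul.
Proof. by move=> a; apply: sfun_ext => p dp; rewrite !sE // mul1r. Qed.
Fact smulD : left_distributive smul sadd.
Proof. by move=> a b c; apply: sfun_ext => p dp; rewrite !sE // mulrDl. Qed.

HB.instance Definition _ := gen_eqMixin sfun.
HB.instance Definition _ := gen_choiceMixin sfun.
HB.instance Definition _ := GRing.isZmodule.Build sfun saddA saddC sadd0 saddN.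
HB.instance Definition _ :=
  GRing.Zmodule_isComPzRing.Build sfun smulA smulC smul1 smulD.

Definition sring : comPzRingType := sfun.

Section Eval.
Variable p : pnt.
Hypothesis dp : dom p.
Lemma evD (a b : sring) : (a + b) p = a p + b p. Proof. exact: saddE. Qed.
Lemma evN (a : sring) : (- a) p = - a p. Proof. exact: soppE. Qed.
Lemma evB (a b : sring) : (a - b) p = a p - b p. Proof. by rewrite evD evN. Qed.
Lemma evM (a b : sring) : (a * b) p = a p * b p. Proof. exact: smulE. Qed.
Lemma ev0 : (0 : sring) p = 0. Proof. exact: scstE. Qed.
Lemma ev1 : (1 : sring) p = 1. Proof. exact: scstE. Qed.
Lemma ev_cst x : scst x p = x. Proof. exact: scstE. Qed.
Lemma ev_nat m : (m%:R : sring) p = m%:R.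
Proof.
elim: m => [|m IH]; first exact: ev0.
by rewrite -[m.+1]addn1 !natrD evD IH ev1.
Qed.
Lemma ev_sum (J : Type) (r : seq J) (P : pred J) (F : J -> sring) :
  (\sum_(i <- r | P i) F i) p = \sum_(i <- r | P i) F i p.
Proof. by apply: (big_morph (fun a : sring => a p)); [exact: evD|exact: ev0]. Qed.
End Eval.

Lemma sm_smooth a : smooth_spacetime I U (fun t x => a (t, x)).
Proof.
apply: Sm_smooth => k; apply: Sm_congr (sfun_smooth a k) => -[t x] _.
by [].
Qed.

Fact sder_sub o a : {b : sfun | has_der o a b}.
Proof.
pose f t x := a (t, x); have [_ H] := sm_smooth a [::].
have S k : Sm k (unc (spacetime_deriv I o f)).
  by apply: smooth_Sm => w; have := sm_smooth a (rcons w o); rewrite foldr_rcons.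
have E : {in dom, unc f =1 a} by case.
have [b bE] := sfun_of_sub S; exists b.
apply: has_der_congr E _ (@has_der_spacetime R n D _ H o) => p /set_mem dp.
by rewrite bE.
Qed.
Definition sder o a : sfun := sval (sder_sub o a).
Lemma sderP o a : has_der o a (sder o a). Proof. exact: (svalP (sder_sub o a)). Qed.

Lemma sder_unique o a b : has_der o a b -> sder o a = b.
Proof.
move=> H; apply: sfun_ext => p dp.
by apply: (has_der_unique (@sderP o a) H); rewrite inE.
Qed.

Lemma sderD o (a b : sring) : sder o (a + b) = sder o a + sder o b.
Proof.
apply: sder_unique; apply: has_der_congr (has_derD (@sderP o a) (@sderP o b)) => p /set_mem dp.
  by rewrite evD.
by rewrite evD.
Qed.

Lemma sderM o (a b : sring) : sder o (a * b) = sder o a * b + a * sder o b.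
Proof.
apply: sder_unique; apply: has_der_congr (has_derM (@sderP o a) (@sderP o b)) => p /set_mem dp.
  by rewrite evM.
by rewrite evD // !evM.
Qed.

(** Time and space derivatives are two cases of [sder]; their commutation is what makes the
    abstract calculus applicable. *)
Lemma sderC o o' a : sder o (sder o' a) = sder o' (sder o a).
Proof.
apply: sfun_ext => p dp.
apply: (schwarz (@sderP o' a) (@sderP o a) (@sderP o _) (@sderP o' _)); last by rewrite inE.
  exact: (sfun_smooth _ 0).1.
exact: (sfun_smooth _ 0).1.
Qed.

Lemma sder_cst o x : sder o (scst x) = 0.
Proof.
apply: sder_unique; apply: has_der_congr (@has_der_cst R n D o x) => p /set_mem dp.
  by rewrite ev_cst.
by rewrite ev0.
Qed.

Lemma pderiv_sder i (f : 'rV[R]_n -> R) a t x : I t -> U x ->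
  (forall y, U y -> f y = a (t, y)) -> pderiv i f x = sder (Some i) a (t, x).
Proof.
move=> It Ux E; have dp : dom (t, x) by [].
have aE : unc (fun s y => a (s, y)) = a by apply/funext => -[].
have : is_derive x (delta_mx 0 i : 'rV[R]_n) (fun y => a (t, y)) (sder (Some i) a (t, x)).
  by apply/(space_quotP (fun s y => a (s, y)) i _ It Ux); rewrite aE; exact: sderP.
case=> _ <-; apply: near_eq_derive.
have : nbhs x U by apply: open_nbhs_nbhs; split => //; exact: st_open.
by apply: filterS => y; exact: E.
Qed.

Lemma dtime_sder (f : R -> R) a t x : I t -> U x ->
  (forall s, I s -> f s = a (s, x)) ->
  time_derivable I f t /\ dtime I f t = sder None a (t, x).
Proof.
move=> It Ux E; have dp : dom (t, x) by [].
have FF := dfilter_proper None dp.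
have H : time_quotient f t @ within I t^' --> sder None a (t, x).
  have /(time_quotP (fun s y => a (s, y)) _ _ Ux) H : dquot None (unc (fun s y => a (s, y))) (t, x)
     @ dfilter D None (t, x) --> sder None a (t, x).
    have -> : unc (fun s y => a (s, y)) = a by apply/funext => -[].
    exact: sderP.
  apply: cvg_trans H; apply: near_eq_cvg; rewrite near_withinE.
  by apply: nearW => s Is; rewrite /time_quotient !E.
split; first by apply/cvg_ex; eexists; exact: H.
have PF : ProperFilter (within I t^').
  apply: Build_ProperFilter_ex => P; rewrite /dnbhs /within /= => /nbhs_ballP[d /= d0 Hd].
  have [a0 [b0 [ab /andP[da _] /andP[_ bd] Hs]]] := small_seg None dp d0.
  have [e0|e0] := eqVneq b0 0.
    exists (t + a0); apply: Hd; last by have [] := Hs a0 _; rewrite ?lexx ?ltW.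
      rewrite /ball /= opprD addrA subrr add0r normrN ltr_norml da /=.
      by apply: lt_trans ab _ => //; rewrite e0.
    by rewrite -subr_eq0 addrAC subrr add0r -e0 lt_eqF.
  exists (t + b0); apply: Hd; last by have [] := Hs b0 _; rewrite ?lexx ?ltW.
    rewrite /ball /= opprD addrA subrr add0r normrN ltr_norml bd andbT.
    by apply: lt_trans da ab.
  by rewrite -subr_eq0 addrAC subrr add0r.
exact: cvg_lim H.
Qed.
End SmoothRing.

(** * Inverse metric and curvature in a chart *)
Section InverseMatrix.
Variables (R : realType) (n : nat) (D : st_domain R n).
Local Notation pnt := (R * 'rV[R]_n)%type.
Local Notation Sm := (Sm D).

Lemma Sm_sum k (J : finType) (F : J -> pnt -> R) :
  (forall j, Sm k (F j)) -> Sm k (fun p => \sum_j F j p).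
Proof.
move=> H; have E s : Sm k (fun p => \sum_(j <- s) F j p).
  elim: s => [|j s IH].
    by apply: Sm_congr (Sm_cst D k 0) => p _; rewrite big_nil.
  by apply: Sm_congr (SmD (H j) IH) => p _; rewrite big_cons.
exact: E.
Qed.

Lemma Sm_prod k (J : finType) (F : J -> pnt -> R) :
  (forall j, Sm k (F j)) -> Sm k (fun p => \prod_j F j p).
Proof.
move=> H; have E s : Sm k (fun p => \prod_(j <- s) F j p).
  elim: s => [|j s IH].
    by apply: Sm_congr (Sm_cst D k 1) => p _; rewrite big_nil.
  by apply: Sm_congr (SmM (H j) IH) => p _; rewrite big_cons.
exact: E.
Qed.

Lemma Sm_det k m (F : pnt -> 'M[R]_m) :
  (forall i j, Sm k (fun p => F p i j)) -> Sm k (fun p => \det (F p)).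
Proof.
move=> H; apply: Sm_sum => s; apply: SmM; first exact: Sm_cst.
exact: Sm_prod.
Qed.

(** Cramer's rule: entries of the inverse are polynomials in the entries, divided by the
    determinant. *)
Lemma Sm_invmx k m (F : pnt -> 'M[R]_m) i j :
  (forall p, dom D p -> F p \in unitmx) ->
  (forall i j, Sm k (fun p => F p i j)) -> Sm k (fun p => invmx (F p) i j).
Proof.
move=> uF H.
have d0 p : dom D p -> \det (F p) != 0.
  by move=> /uF; rewrite unitmxE unitfE.
have := SmM (SmV d0 (Sm_det H))
  (SmM (Sm_cst D k ((-1) ^+ (j + i)))
    (Sm_det (F := fun p => row' j (col' i (F p))) (fun x y => _))).
move=> S; apply: Sm_congr (S _) => [p /set_mem dp|x y].
  by rewrite /invmx uF // !mxE.
by apply: Sm_congr (H (lift j x) (lift i y)) => p _; rewrite !mxE.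
Qed.

Lemma posdef_unitmx m (G : 'M[R]_m) :
  (forall v : 'rV[R]_m, v != 0 -> 0 < (v *m G *m v^T) 0 0) -> G \in unitmx.
Proof.
move=> H; rewrite unitmxE unitfE; apply/det0P => -[v v0 vG].
by have := H v v0; rewrite vG mul0mx mxE ltxx.
Qed.
End InverseMatrix.

Section Riemann.
Variables (R : realType) (n : nat) (G : 'rV[R]_n -> 'M[R]_n).

Lemma pderiv_cst i (c : R) x : pderiv i (fun _ : 'rV[R]_n => c) x = 0.
Proof. exact: derive_cst. Qed.

Lemma nabla_coord i Z l x : nabla_vect G (@coord_field R n i) Z l x =
  pderiv i (Z l) x + \sum_b christoffel G l i b x * Z b x.
Proof.
rewrite /nabla_vect /coord_field.
by rewrite (sum_delta i (fun a => pderiv a (Z l) x + \sum_b christoffel G l a b x * Z b x)).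
Qed.

Lemma nabla_coord2 i k l :
  nabla_vect G (@coord_field R n i) (@coord_field R n k) l = christoffel G l i k.
Proof.
apply/funext => x; rewrite nabla_coord {1}/coord_field pderiv_cst add0r.
under eq_bigr do rewrite mulrC.
exact: (sum_delta k (fun b => christoffel G l i b x)).
Qed.

(** For coordinate fields the bracket term vanishes and the covariant derivatives are
    Christoffel symbols. *)
Lemma riem_upE l i j k x : riem_up G l i j k x =
  pderiv j (christoffel G l i k) x - pderiv i (christoffel G l j k) x
  + \sum_m (christoffel G l j m x * christoffel G m i k x
            - christoffel G l i m x * christoffel G m j k x).
Proof.
rewrite /riem_up /Riem !nabla_coord !nabla_coord2.
have -> : nabla_vect G (lie_bracket (@coord_field R n i) (@coord_field R n j))
    (@coord_field R n k) l x = 0.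
  rewrite /nabla_vect big1 // => a _; rewrite /lie_bracket big1 ?mul0r // => b _.
  by rewrite !pderiv_cst !mulr0 subrr.
rewrite addr0 sumrB.
under eq_bigr do rewrite nabla_coord2.
under [X in _ - (_ + X)]eq_bigr do rewrite nabla_coord2.
by rewrite opprD addrACA.
Qed.
End Riemann.

(** * The flow in a chart *)
Section Bridge.
Variables (R : realType) (n : nat) (M : topologicalType) (A : smooth_atlas R n M).
Variables (I : set R) (hI : is_interval I).
Hypothesis hI' : exists t0 t1 : R, [/\ I t0, I t1 & t0 < t1].
Variables (g : metric_family A I) (a : chart_index A).

Definition chart_domain : st_domain R n := StDomain hI hI' (@chart_img_open R n M A a).
Local Notation D := chart_domain.
Local Notation U := (chart_img a).
Local Notation SF := (sring D).

Lemma metric_unit (p : R * 'rV[R]_n) : dom D p -> metric g a p.1 p.2 \in unitmx.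
Proof.
by move=> [It Ux]; apply: posdef_unitmx => v; exact: metric_pos.
Qed.

(** The metric and its inverse in the chart, as elements of the ring of smooth functions; every
    tensor of the chart is the value of the one built from them by the abstract calculus. *)
Definition gA i j : SF := sfun_of (@smooth_Sm R n D _ (@metric_smooth R n M A I g a i j)).
Definition giA i j : SF :=
  sfun_of (fun k => @Sm_invmx R n D k n (fun p => metric g a p.1 p.2) i j metric_unit
    (fun i j => @smooth_Sm R n D _ (@metric_smooth R n M A I g a i j) k)).

Local Notation d := (fun i => sder (Some i)).
Let half : SF := scst D 2^-1.
Local Notation GamA := (Gam d half gA giA).
Local Notation RicA := (Ric d half gA giA).
Local Notation RmA := (Rm d half gA giA).
Local Notation ScA := (Scal d half gA giA).
Local Notation nab1 := (cov1 d half gA giA).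
Local Notation nab2 := (cov2 d half gA giA).
Local Notation nab3 := (cov3 d half gA giA).
Local Notation nab4 := (cov4 d half gA giA).

Arguments gA : simpl never.
Arguments giA : simpl never.

Lemma gA_E t x i j : I t -> U x -> metric g a t x i j = gA i j (t, x).
Proof. by move=> It Ux; rewrite sfun_ofE. Qed.

Lemma giA_E t x i j : I t -> U x -> ginv (metric g a t) i j x = giA i j (t, x).
Proof. by move=> It Ux; rewrite sfun_ofE. Qed.

Lemma gAC i j : gA i j = gA j i.
Proof.
apply: sfun_ext => -[t x] [It Ux]; rewrite -!gA_E //.
by rewrite -[in RHS](@Defs.metric_sym R n M A I g a t x It Ux) mxE.
Qed.

Lemma giAC i j : giA i j = giA j i.
Proof.
apply: sfun_ext => -[t x] [It Ux]; rewrite -!giA_E // /ginv.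
by rewrite -[in RHS](@Defs.metric_sym R n M A I g a t x It Ux) -trmx_inv mxE.
Qed.

Lemma gigA i j : \sum_k giA i k * gA k j = (i == j)%:R.
Proof.
apply: sfun_ext => -[t x] dp; have [It Ux] := dp; rewrite ev_sum // ev_nat //.
transitivity ((invmx (metric g a t x) *m metric g a t x) i j).
  rewrite mxE; apply: eq_bigr => k _.
  by rewrite evM // -gA_E // -giA_E.
by rewrite mulVmx ?mxE //; exact: (metric_unit dp).
Qed.

Lemma half2A : half * 2 = 1.
Proof.
by apply: sfun_ext => p dp; rewrite evM // ev_cst // ev_nat // ev1 // mulVf.
Qed.

Section AtPoint.
Variables (t : R) (It : I t).
Local Notation G := (metric g a t).

Lemma christoffel_E m i j x : U x -> christoffel G m i j x = GamA m i j (t, x).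
Proof.
move=> Ux; have dp : dom D (t, x) by [].
rewrite /christoffel /Gam evM // ev_cst // ev_sum //; congr (_ * _).
apply: eq_bigr => l _; rewrite evM // evB // evD // giA_E //.
by congr (_ * (_ + _ - _)); apply: (@pderiv_sder R n D) => // y Uy; exact: gA_E.
Qed.

Lemma riem_up_E l i j k x : U x ->
  riem_up G l i j k x = curv d half gA giA l i j k (t, x).
Proof.
move=> Ux; have dp : dom D (t, x) by [].
rewrite riem_upE /curv evD // evB // ev_sum //; congr (_ - _ + _).
- by apply: (@pderiv_sder R n D) => // y; exact: christoffel_E.
- by apply: (@pderiv_sder R n D) => // y; exact: christoffel_E.
apply: eq_bigr => m _; rewrite (evB dp (GamA l j m * GamA m i k)).
rewrite (evM dp (GamA l j m) (GamA m i k)) (evM dp (GamA l i m) (GamA m j k)).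
by rewrite -!(christoffel_E _ _ _ Ux).
Qed.

Lemma riem_E i j k l x : U x -> riem G i j k l x = RmA i j k l (t, x).
Proof.
move=> Ux; have dp : dom D (t, x) by [].
rewrite /riem /Rm ev_sum //; apply: eq_bigr => m _.
by rewrite evM // gA_E // riem_up_E.
Qed.

Lemma ct_E (F : 'I_n -> 'I_n -> R) (FA : 'I_n -> 'I_n -> SF) x : U x ->
  (forall i j, F i j = FA i j (t, x)) ->
  \sum_i \sum_j ginv G i j x * F i j = contr giA FA (t, x).
Proof.
move=> Ux E; have dp : dom D (t, x) by [].
rewrite /contr ev_sum //; apply: eq_bigr => i _; rewrite ev_sum //.
by apply: eq_bigr => j _; rewrite evM // giA_E // E.
Qed.

Lemma ricci_E i k x : U x -> ricci G i k x = RicA i k (t, x).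
Proof. by move=> Ux; apply: ct_E => // j l; exact: riem_E. Qed.

Lemma scal_E x : U x -> scal G x = ScA (t, x).
Proof. by move=> Ux; apply: ct_E => // j l; exact: ricci_E. Qed.

Lemma gam_E (i j : 'I_n) (F : 'I_n -> R) (FA : 'I_n -> SF) x : U x ->
  (forall m, F m = FA m (t, x)) ->
  \sum_m christoffel G m i j x * F m = gam d half gA giA i j FA (t, x).
Proof.
move=> Ux E; have dp : dom D (t, x) by [].
rewrite /gam ev_sum //; apply: eq_bigr => m _.
by rewrite evM // christoffel_E // E.
Qed.

Lemma nabla2_E (T : 'I_n -> 'I_n -> 'rV[R]_n -> R)
    (TA : 'I_n -> 'I_n -> SF) b i j x : U x ->
  (forall i j y, U y -> T i j y = TA i j (t, y)) ->
  nabla2 G T b i j x = nab2 TA b i j (t, x).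
Proof.
move=> Ux E; have dp : dom D (t, x) by [].
rewrite /nabla2 big_split /= opprD addrA /cov2 !evB //.
rewrite (gam_E b i (FA := fun m => TA m j) Ux) => [|m]; last exact: E.
rewrite (gam_E b j (FA := TA i) Ux) => [|m]; last exact: E.
by rewrite (@pderiv_sder R n D b _ (TA i j) t x) // => y; exact: E.
Qed.

Lemma nabla3_E (T : 'I_n -> 'I_n -> 'I_n -> 'rV[R]_n -> R)
    (TA : 'I_n -> 'I_n -> 'I_n -> SF) b i j k x : U x ->
  (forall i j k y, U y -> T i j k y = TA i j k (t, y)) ->
  nabla3 G T b i j k x = nab3 TA b i j k (t, x).
Proof.
move=> Ux E; have dp : dom D (t, x) by [].
rewrite /nabla3 !big_split /= !opprD !addrA /cov3 !evB //.
rewrite (gam_E b i (FA := fun m => TA m j k) Ux) => [|m]; last exact: E.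
rewrite (gam_E b j (FA := fun m => TA i m k) Ux) => [|m]; last exact: E.
rewrite (gam_E b k (FA := TA i j) Ux) => [|m]; last exact: E.
by rewrite (@pderiv_sder R n D b _ (TA i j k) t x) // => y; exact: E.
Qed.

Lemma nabla4_E (T : 'I_n -> 'I_n -> 'I_n -> 'I_n -> 'rV[R]_n -> R)
    (TA : 'I_n -> 'I_n -> 'I_n -> 'I_n -> SF) b i j k l x :
  U x ->
  (forall i j k l y, U y -> T i j k l y = TA i j k l (t, y)) ->
  nabla4 G T b i j k l x = nab4 TA b i j k l (t, x).
Proof.
move=> Ux E; have dp : dom D (t, x) by [].
rewrite /nabla4 !big_split /= !opprD !addrA /cov4 !evB //.
rewrite (gam_E b i (FA := fun m => TA m j k l) Ux) => [|m]; last exact: E.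
rewrite (gam_E b j (FA := fun m => TA i m k l) Ux) => [|m]; last exact: E.
rewrite (gam_E b k (FA := fun m => TA i j m l) Ux) => [|m]; last exact: E.
rewrite (gam_E b l (FA := TA i j k) Ux) => [|m]; last exact: E.
by rewrite (@pderiv_sder R n D b _ (TA i j k l) t x) // => y; exact: E.
Qed.

Hypothesis hn : (3 <= n)%N.
Definition cA : SF := scst D (2 * (n%:R - 1))^-1.
Definition uA : SF := scst D (n%:R - 2)^-1.
Local Notation CA := (Cot d half gA giA cA).
Local Notation WA := (Wey d half gA giA uA cA).

Lemma n1_neq0 : n%:R - 1 != 0 :> R.
Proof. by rewrite subr_eq0 (eqr_nat _ n 1); case: n hn => [|[|]]. Qed.
Lemma n2_neq0 : n%:R - 2 != 0 :> R.
Proof. by rewrite subr_eq0 (eqr_nat _ n 2); case: n hn => [|[|[|]]]. Qed.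

Lemma cotton_E i j k x : U x -> cotton G i j k x = CA i j k (t, x).
Proof.
move=> Ux; have dp : dom D (t, x) by [].
rewrite /cotton /Cot (evB dp (_ - _) (cA * _)) (evB dp (nab2 _ _ _ _)).
rewrite (evM dp cA) (evB dp (_ * _)) (evM dp _ (gA i j)) (evM dp _ (gA i k)) ev_cst //.
rewrite (nabla2_E (TA := RicA) k i j Ux (fun _ _ _ => @ricci_E _ _ _)).
rewrite (nabla2_E (TA := RicA) j i k Ux (fun _ _ _ => @ricci_E _ _ _)).
rewrite (@pderiv_sder R n D k _ ScA t x It Ux); last by move=> *; exact: scal_E.
rewrite (@pderiv_sder R n D j _ ScA t x It Ux); last by move=> *; exact: scal_E.
by rewrite !gA_E.
Qed.

Lemma two_cu : 2 * ((2 * (n%:R - 1))^-1 * (n%:R - 2)^-1) = ((n%:R - 1) * (n%:R - 2))^-1 :> R.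
Proof. by field; rewrite n1_neq0 n2_neq0. Qed.

Lemma eval_weyl p (r r1 r2 r3 r4 g1 g2 g3 g4 S : SF) : dom D p ->
  (r - uA * (r1 * g2 - r2 * g4 + r3 * g1 - r4 * g3)
   + 2 * cA * uA * S * (g1 * g2 - g3 * g4)) p =
  r p - (n%:R - 2)^-1 * (r1 p * g2 p - r2 p * g4 p + r3 p * g1 p - r4 p * g3 p)
  + S p / ((n%:R - 1) * (n%:R - 2)) * (g1 p * g2 p - g3 p * g4 p).
Proof.
move=> dp; rewrite -two_cu.
rewrite !(evD dp, evN dp, evM dp, ev_cst dp, ev_nat dp).
move: (r p) (r1 p) (r2 p) (r3 p) (r4 p) (g1 p) (g2 p) (g3 p) (g4 p) (S p) => *.
by ring.
Qed.

Lemma weyl_E i j k l x : U x -> weyl G i j k l x = WA i j k l (t, x).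
Proof.
move=> Ux; have dp : dom D (t, x) by [].
rewrite [RHS](eval_weyl (RmA i j k l) (RicA i k) (RicA i l) (RicA j l) (RicA j k)
  (gA i k) (gA j l) (gA i l) (gA j k) ScA dp).
by rewrite /weyl riem_E // !ricci_E // scal_E // !gA_E.
Qed.

Lemma dot_E (X Y : 'I_n -> R) (XA YA : 'I_n -> SF) x : U x ->
  (forall p, X p = XA p (t, x)) -> (forall q, Y q = YA q (t, x)) ->
  \sum_p \sum_q ginv G p q x * X p * Y q = pair1 giA XA YA (t, x).
Proof.
move=> Ux EX EY; have dp : dom D (t, x) by [].
rewrite -(ct_E (F := fun p q => X p * Y q) Ux) => [|p q].
  by apply: eq_bigr => p _; apply: eq_bigr => q _; rewrite mulrA.
by rewrite (evM dp) EX EY.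
Qed.

Lemma dot2_E (X Y : 'I_n -> 'I_n -> R) (XA YA : 'I_n -> 'I_n -> SF) x : U x ->
  (forall p q, X p q = XA p q (t, x)) -> (forall p q, Y p q = YA p q (t, x)) ->
  \sum_p \sum_q \sum_l \sum_m ginv G p q x * ginv G l m x * X p l * Y q m =
  pair2 giA XA YA (t, x).
Proof.
move=> Ux EX EY; have dp : dom D (t, x) by [].
rewrite -(ct_E (F := fun p q => \sum_l \sum_m ginv G l m x * (X p l * Y q m)) Ux) => [|p q].
  apply: eq_bigr => p _; apply: eq_bigr => q _; rewrite mulr_sumr.
  apply: eq_bigr => l _; rewrite mulr_sumr; apply: eq_bigr => m _.
  by rewrite !mulrA.
by apply: ct_E => // l m; rewrite (evM dp) EX EY.
Qed.

Lemma ricci_up_dot2 (Y : 'I_n -> 'I_n -> R) (YA : 'I_n -> 'I_n -> SF) x : U x ->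
  (forall p q, Y p q = YA p q (t, x)) ->
  \sum_q \sum_l ricci_up G q l x * Y q l = pair2 giA RicA YA (t, x).
Proof.
move=> Ux EY.
rewrite (dot2C giAC) -(dot2_E (X := Y) (Y := fun a b => ricci G a b x) Ux) => //; last first.
  by move=> *; exact: ricci_E.
apply: eq_bigr => q _; rewrite exchange_big /=; apply: eq_bigr => l _.
rewrite /ricci_up mulr_suml; apply: eq_bigr => b _; rewrite mulr_suml.
by apply: eq_bigr => e _; rewrite mulrAC.
Qed.

Lemma ricci_norm2_E x : U x -> ricci_norm2 G x = nRic d half gA giA (t, x).
Proof. by move=> Ux; apply: ricci_up_dot2 => // *; exact: ricci_E. Qed.

Lemma laplacian3_E (T : 'I_n -> 'I_n -> 'I_n -> 'rV[R]_n -> R)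
    (TA : 'I_n -> 'I_n -> 'I_n -> SF) i j k x : U x ->
  (forall i j k y, U y -> T i j k y = TA i j k (t, y)) ->
  laplacian3 G T i j k x = lap3 d half gA giA TA i j k (t, x).
Proof.
move=> Ux E; apply: ct_E => // b e; apply: nabla4_E => // *.
exact: nabla3_E.
Qed.

(** The right-hand side of the evolution equation as a function of its constituents, so that
    the two versions of it can be compared constituent by constituent. *)
Definition rhs_expr (X1 X2 X3 S Cc K1 gik K2 gij W1 W2 W3 dk dj sj sk D1 D2
    Rij Rik N1 N2 : R) : R :=
  ((n%:R - 2)^-1 * (X1 + (n%:R + 2) * X2 - X3)
   + 2 / (n%:R - 2) * S * Cc + 2 / (n%:R - 2) * K1 * gik
   - 2 / (n%:R - 2) * K2 * gij - 2 * W1 + 2 * W2 - 2 * W3)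
  + (1 / ((n%:R - 1) * (n%:R - 2)) * dk * gij
     - 1 / ((n%:R - 1) * (n%:R - 2)) * dj * gik
     + S / ((n%:R - 1) * (n%:R - 2)) * sj * gik
     - S / ((n%:R - 1) * (n%:R - 2)) * sk * gij
     + 2 / (n%:R - 2) * D1 - 2 / (n%:R - 2) * D2
     + 1 / (n%:R - 2) * Rij * sk - 1 / (n%:R - 2) * Rik * sj)
  + (2 * N1 - 2 * N2).

Lemma rhs_congr (a1 a2 a3 a4 a5 a6 a7 a8 a9 b0 b1 b2 b3 b4 b5 b6 b7 b8 b9
    c0 c1 c2 a1' a2' a3' a4' a5' a6' a7' a8' a9' b0' b1' b2' b3' b4' b5' b6'
    b7' b8' b9' c0' c1' c2' : R) :
  a1 = a1' -> a2 = a2' -> a3 = a3' -> a4 = a4' -> a5 = a5' -> a6 = a6' ->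
  a7 = a7' -> a8 = a8' -> a9 = a9' -> b0 = b0' -> b1 = b1' -> b2 = b2' ->
  b3 = b3' -> b4 = b4' -> b5 = b5' -> b6 = b6' -> b7 = b7' -> b8 = b8' ->
  b9 = b9' -> c0 = c0' -> c1 = c1' -> c2 = c2' ->
  rhs_expr a1 a2 a3 a4 a5 a6 a7 a8 a9 b0 b1 b2 b3 b4 b5 b6 b7 b8 b9 c0 c1 c2 =
  rhs_expr a1' a2' a3' a4' a5' a6' a7' a8' a9' b0' b1' b2' b3' b4' b5' b6' b7'
    b8' b9' c0' c1' c2'.
Proof. by do 22!move=> ->. Qed.

Lemma eval_rhs p (X1 X2 X3 S Cc K1 gik K2 gij W1 W2 W3 dk dj sj sk D1 D2
    Rij Rik N1 N2 : SF) : dom D p ->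
  (uA * (X1 + (n%:R + 2) * X2 - X3) + 2 * uA * S * Cc + 2 * uA * K1 * gik
   - 2 * uA * K2 * gij - 2 * W1 + 2 * W2 - 2 * W3
   + (2 * cA * uA * dk * gij - 2 * cA * uA * dj * gik
      + 2 * cA * uA * S * sj * gik - 2 * cA * uA * S * sk * gij
      + 2 * uA * D1 - 2 * uA * D2 + uA * Rij * sk - uA * Rik * sj)
   + (2 * N1 - 2 * N2)) p =
  rhs_expr (X1 p) (X2 p) (X3 p) (S p) (Cc p) (K1 p) (gik p) (K2 p) (gij p)
    (W1 p) (W2 p) (W3 p) (dk p) (dj p) (sj p) (sk p) (D1 p) (D2 p) (Rij p)
    (Rik p) (N1 p) (N2 p).
Proof.
move=> dp; rewrite /rhs_expr -two_cu.
rewrite !(evD dp, evN dp, evM dp, ev_cst dp, ev_nat dp).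
move: (X1 p) (X2 p) (X3 p) (S p) (Cc p) (K1 p) (gik p) (K2 p) (gij p) (W1 p)
  (W2 p) (W3 p) (dk p) (dj p) (sj p) (sk p) (D1 p) (D2 p) (Rij p) (Rik p)
  (N1 p) (N2 p) => *.
by ring.
Qed.
End AtPoint.

Let sD (i : 'I_n) (x y : SF) := @sderD R n D (Some i) x y.
Let sM (i : 'I_n) (x y : SF) := @sderM R n D (Some i) x y.
Let sC (i j : 'I_n) (x : SF) := @sderC R n D (Some i) (Some j) x.
Let sRicC := RicC sD sM sC half2A gAC giAC gigA.

Lemma flow_A (hg : ricci_flow g) i j :
  sder None (gA i j) = - (2 * RicA i j) :> SF.
Proof.
apply: sfun_ext => -[t x] dp; have [It Ux] := dp.
have [_ <-] := @dtime_sder R n D (fun s => metric g a s x i j) (gA i j) t x It Ux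
  (fun s Is => gA_E i j Is Ux).
rewrite hg // (evN dp) (evM dp 2) (ev_nat dp) -ricci_E //.
by rewrite mulNr.
Qed.

Hypothesis hn : (3 <= n)%N.
Local Notation c := cA.
Local Notation u := uA.
Local Notation CA := (Cot d half gA giA cA).
Local Notation WA := (Wey d half gA giA uA cA).

Lemma cA_E : c * (n%:R - 1) = half.
Proof.
apply: sfun_ext => p dp.
rewrite !(evD dp, evN dp, evM dp, ev_cst dp, ev_nat dp, ev1 dp).
by field; exact: (n1_neq0 hn).
Qed.

Lemma uA_E : u * (n%:R - 2) = 1.
Proof.
apply: sfun_ext => p dp.
rewrite !(evD dp, evN dp, evM dp, ev_cst dp, ev_nat dp, ev1 dp).
by rewrite mulVf //; exact: (n2_neq0 hn).
Qed.

Lemma chart_evolution (hg : ricci_flow g) t x i j k : I t -> U x ->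
  time_derivable I (fun s => cotton (metric g a s) i j k x) t /\
  dtime I (fun s => cotton (metric g a s) i j k x) t
    - laplacian3 (metric g a t) (cotton (metric g a t)) i j k x
  = cotton_terms (metric g a t) i j k x + ricci_terms (metric g a t) i j k x
    + nabla_weyl_terms (metric g a t) i j k x.
Proof.
move=> It Ux; have dp : dom D (t, x) by [].
have [td ->] := @dtime_sder R n D (fun s => cotton (metric g a s) i j k x) (CA i j k) t x It Ux
  (fun s Is => cotton_E Is i j k Ux).
split => //.
rewrite (laplacian3_E It (TA := CA) i j k Ux (fun i j k y => @cotton_E t It i j k y)).
rewrite -(evB dp).
have T := cotton_evolution sD sM sC half2A gAC giAC gigA
  (@sderD R n D None) (@sderM R n D None) (fun b y => @sderC R n D None (Some b) y)
  (flow_A hg) cA_E uA_E (fun b => sder_cst D (Some b) _) (fun b => sder_cst D (Some b) _)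
  (sder_cst D None _) i j k.
rewrite {}T (eval_rhs hn _ _ _ _ _ _ _ _ _ _ _ _ _ _ _ _ _ _ _ _ _ _ dp).
set G := metric g a t.
have Rr p q y : U y -> ricci G p q y = RicA q p (t, y).
  move=> Uy; rewrite (ricci_E It p q Uy).
  exact: (congr1 (fun b : SF => b (t, y)) (sRicC p q)).
have DR b p q : nabla2 G (ricci G) b p q x = nab2 RicA b p q (t, x).
  exact: (nabla2_E It (TA := RicA) b p q Ux (fun p q y => @ricci_E t It p q y)).
have DRr b p q : nabla2 G (ricci G) b p q x = nab2 RicA b q p (t, x).
  rewrite DR.
  exact: (congr1 (fun b : SF => b (t, x)) (cov2_C d half gA giA b p q sRicC)).
have DW b p q l m : nabla4 G (weyl G) b p q l m x = nab4 WA b p q l m (t, x).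
  exact: (nabla4_E It (TA := WA) b p q l m Ux
    (fun p q l m y => @weyl_E t It hn p q l m y)).
have DS b : pderiv b (scal G) x = sder (Some b) ScA (t, x).
  exact: (@pderiv_sder R n D b _ ScA t x It Ux (fun y => @scal_E t It y)).
have DN b : pderiv b (ricci_norm2 G) x = sder (Some b) (nRic d half gA giA) (t, x).
  exact: (@pderiv_sder R n D b _ (nRic d half gA giA) t x It Ux
    (fun y => @ricci_norm2_E t It y)).
have T1 j' k' : \sum_p \sum_q ginv G p q x * ricci G p j' x *
    (cotton G k' q i x + cotton G q k' i x + (n%:R - 3) * cotton G i k' q x) =
    pair1 giA (RicA j') (fun q => CA k' q i + CA q k' i + (n%:R - 3) * CA i k' q) (t, x).
  apply: (dot_E It Ux (X := fun p => ricci G p j' x)) => [p|q]; first exact: Rr.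
  rewrite (evD dp (_ + _)) (evD dp (CA _ _ _)) (evM dp (_ - _)) (evB dp n%:R) !(ev_nat dp).
  by rewrite -!(cotton_E It _ _ _ Ux).
have T2 : \sum_p \sum_q ginv G p q x * ricci G i p x * cotton G q k j x =
    pair1 giA (RicA i) (fun q => CA q k j) (t, x).
  by apply: (dot_E It Ux (X := fun p => ricci G i p x)) => [p|q];
    [exact: ricci_E|exact: cotton_E].
have K1 j' : \sum_q \sum_l ricci_up G q l x * cotton G q j' l x =
    pair2 giA RicA (fun q l => CA q j' l) (t, x).
  exact: (ricci_up_dot2 It Ux (fun p q => @cotton_E t It p j' q x Ux)).
have W1 j' k' : \sum_p \sum_q \sum_l \sum_m ginv G p q x * ginv G l m x
    * weyl G p i k' l x * cotton G q j' m x =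
    pair2 giA (fun p l => WA p i k' l) (fun q m => CA q j' m) (t, x).
  exact: (dot2_E It Ux (fun p l => @weyl_E t It hn p i k' l x Ux)
    (fun q m => @cotton_E t It q j' m x Ux)).
have W3 : \sum_p \sum_q \sum_l \sum_m ginv G p q x * ginv G l m x
    * weyl G j k l p x * cotton G q i m x =
    pair2 giA (fun p l => WA j k l p) (fun q m => CA q i m) (t, x).
  exact: (dot2_E It Ux (fun p l => @weyl_E t It hn j k l p x Ux)
    (fun q m => @cotton_E t It q i m x Ux)).
have D1 j' k' : \sum_p \sum_q ginv G p q x * ricci G p k' x * nabla2 G (ricci G) j' q i x =
    pair1 giA (RicA k') (nab2 RicA j' i) (t, x).
  by apply: (dot_E It Ux (X := fun p => ricci G p k' x)) => [p|q];
    [exact: Rr|exact: DRr].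
have N1 j' k' : \sum_p \sum_q \sum_l \sum_m ginv G p q x * ginv G l m x
    * ricci G p l x * nabla4 G (weyl G) j' q i k' m x =
    pair2 giA RicA (fun q m => nab4 WA j' q i k' m) (t, x).
  exact: (dot2_E It Ux (fun p l => @ricci_E t It p l x Ux)
    (fun q m => DW j' q i k' m)).
have H := rhs_congr (esym (T1 j k)) (esym T2) (esym (T1 k j)) (esym (scal_E It Ux))
  (esym (cotton_E It i j k Ux)) (esym (K1 j)) (esym (gA_E i k It Ux)) (esym (K1 k))
  (esym (gA_E i j It Ux)) (esym (W1 j k)) (esym (W1 k j)) (esym W3) (esym (DN k))
  (esym (DN j)) (esym (DS j)) (esym (DS k)) (esym (D1 j k)) (esym (D1 k j))
  (esym (ricci_E It i j Ux)) (esym (ricci_E It i k Ux)) (esym (N1 j k)) (esym (N1 k j)).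
exact: H.
Qed.

Lemma chart_weyl0 t x i j k (hn4 : (4 <= n)%N) :
  (forall t x i j k l, I t -> U x -> weyl (metric g a t) i j k l x = 0) ->
  I t -> U x -> cotton (metric g a t) i j k x = 0.
Proof.
move=> W0 It Ux; have dp : dom D (t, x) by [].
rewrite cotton_E // -[RHS](ev0 dp); congr (sval_fun _ _).
have w3 : (n%:R - 3) * scst D (n%:R - 3)^-1 = 1 :> SF.
  apply: sfun_ext => p dp'.
  rewrite !(evD dp', evN dp', evM dp', ev_cst dp', ev_nat dp', ev1 dp').
  by rewrite mulfV // subr_eq0 (eqr_nat _ n 3); case: n hn4 => [|[|[|[|]]]].
apply: (weyl0_cotton0 sD sM sC half2A gAC giAC gigA cA_E uA_E
  (fun b => sder_cst D (Some b) _) (fun b => sder_cst D (Some b) _) w3).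
move=> i' j' k' l'; apply: sfun_ext => -[s y] dp'; have [Is Uy] := dp'.
by rewrite ev0 // -weyl_E // W0.
Qed.

Lemma cotton_expr0 (X1 X2 X3 S Cc K1 gik K2 gij W1 W2 W3 : R) :
  X1 = 0 -> X2 = 0 -> X3 = 0 -> Cc = 0 -> K1 = 0 -> K2 = 0 ->
  W1 = 0 -> W2 = 0 -> W3 = 0 ->
  (n%:R - 2)^-1 * (X1 + (n%:R + 2) * X2 - X3)
  + 2 / (n%:R - 2) * S * Cc + 2 / (n%:R - 2) * K1 * gik
  - 2 / (n%:R - 2) * K2 * gij - 2 * W1 + 2 * W2 - 2 * W3 = 0.
Proof.
move=> -> -> -> -> -> -> -> -> ->.
by rewrite !(mulr0, mul0r, addr0, subr0).
Qed.

Lemma sum2_0 (F : 'I_n -> 'I_n -> R) : (forall p q, F p q = 0) ->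
  \sum_p \sum_q F p q = 0.
Proof. by move=> F0; rewrite big1 // => p _; rewrite big1. Qed.

Lemma sum4_0 (F : 'I_n -> 'I_n -> 'I_n -> 'I_n -> R) :
  (forall p q l m, F p q l m = 0) ->
  \sum_p \sum_q \sum_l \sum_m F p q l m = 0.
Proof. by move=> F0; apply: sum2_0 => p q; exact: sum2_0. Qed.

Lemma cotton_terms0 (G : 'rV[R]_n -> 'M[R]_n) i j k x :
  (forall i j k, cotton G i j k x = 0) -> cotton_terms G i j k x = 0.
Proof.
move=> C0; rewrite /cotton_terms; cbv zeta; apply: cotton_expr0;
  (try (apply: sum4_0 => p q l m)); (try (apply: sum2_0 => p q));
  by rewrite !C0 ?mulr0 ?addr0 ?mulr0.
Qed.

Lemma nabla_weyl_terms0 (G : 'rV[R]_n -> 'M[R]_n) i j k x :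
  (forall b i j k l, nabla4 G (weyl G) b i j k l x = 0) ->
  nabla_weyl_terms G i j k x = 0.
Proof.
move=> W0; rewrite /nabla_weyl_terms; cbv zeta.
rewrite !(sum4_0 (F := fun p q l m => _)) ?mulr0 ?subr0 // => p q l m.
  by rewrite W0 mulr0.
by rewrite W0 mulr0.
Qed.

(** The left-hand side and the terms linear in the Cotton tensor vanish. *)
Lemma chart_cotton0 (hg : ricci_flow g) t x i j k :
  (forall t x i j k, I t -> U x -> cotton (metric g a t) i j k x = 0) ->
  I t -> U x ->
  0 = ricci_terms (metric g a t) i j k x + nabla_weyl_terms (metric g a t) i j k x.
Proof.
move=> C0 It Ux; have dp : dom D (t, x) by [].
have [_] := chart_evolution hg i j k It Ux.
have [_ ->] := @dtime_sder R n D (fun s => cotton (metric g a s) i j k x) 0 t x It Ux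
  (fun s Is => etrans (C0 s x i j k Is Ux) (esym (@ev0 R n D (s, x) (conj Is Ux)))).
rewrite (drv0 (@sderD R n D None)).
rewrite (laplacian3_E It (TA := fun _ _ _ => 0) i j k Ux); last first.
  by move=> i' j' k' y Uy; rewrite C0 // ev0.
rewrite (lap3_0 sD) ev0 // cotton_terms0; last by move=> *; exact: C0.
by rewrite subrr add0r.
Qed.

Lemma chart_weyl0_terms t x i j k :
  (forall t x i j k l, I t -> U x -> weyl (metric g a t) i j k l x = 0) ->
  I t -> U x -> nabla_weyl_terms (metric g a t) i j k x = 0.
Proof.
move=> W0 It Ux; have dp : dom D (t, x) by [].
apply: nabla_weyl_terms0 => b i' j' k' l'.
rewrite (nabla4_E It (TA := fun _ _ _ _ => 0) b i' j' k' l' Ux); last first.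
  by move=> ? ? ? ? y Uy; rewrite W0 // ev0.
by rewrite (cov4_0 sD) ev0.
Qed.
End Bridge.

Theorem proposition4p1 (R : realType) (n : nat) (hn : (3 <= n)%N)
    (M : topologicalType) (hM : hausdorff_space M)
    (cM : @second_countable M) (A : smooth_atlas R n M)
    (I : set R) (hI : is_interval I)
    (hI' : exists t0 t1 : R, [/\ I t0, I t1 & t0 < t1])
    (g : metric_family A I) (hg : ricci_flow g) :
  [/\ forall (a : chart_index A) (t : R) (x : 'rV[R]_n) (i j k : 'I_n),
        I t -> chart_img a x ->
        let G := metric g a t in
        time_derivable I (fun s => cotton (metric g a s) i j k x) t /\
        dtime I (fun s => cotton (metric g a s) i j k x) t
          - laplacian3 G (cotton G) i j k x
        = cotton_terms G i j k x + ricci_terms G i j k x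
          + nabla_weyl_terms G i j k x,
      (forall (a : chart_index A) (t : R) (x : 'rV[R]_n) (i j k : 'I_n),
        I t -> chart_img a x -> cotton (metric g a t) i j k x = 0) ->
      forall (a : chart_index A) (t : R) (x : 'rV[R]_n) (i j k : 'I_n),
        I t -> chart_img a x ->
        let G := metric g a t in
        0 = ricci_terms G i j k x + nabla_weyl_terms G i j k x
    & (4 <= n)%N ->
      (forall (a : chart_index A) (t : R) (x : 'rV[R]_n) (i j k l : 'I_n),
        I t -> chart_img a x -> weyl (metric g a t) i j k l x = 0) ->
      forall (a : chart_index A) (t : R) (x : 'rV[R]_n) (i j k : 'I_n),
        I t -> chart_img a x ->
        0 = ricci_terms (metric g a t) i j k x].
Proof.
split=> [a t x i j k It Ux|C0 a t x i j k It Ux|hn4 W0 a t x i j k It Ux].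
- exact: (chart_evolution hI hI' hn hg i j k It Ux).
- exact: (chart_cotton0 hI hI' hn hg i j k (fun t x => @C0 a t x) It Ux).
- have C0 t' x' i' j' k' It' Ux' :=
    @chart_weyl0 R n M A I hI hI' g a hn t' x' i' j' k' hn4 (fun t x => @W0 a t x) It' Ux'.
  rewrite [LHS](chart_cotton0 hI hI' hn hg i j k C0 It Ux).
  rewrite (chart_weyl0_terms hI hI' i j k (fun t x => @W0 a t x) It Ux).
  exact: addr0.
Qed.
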